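(* For every $p\in(1,\infty)$ the following two statements hold. (a) If $\|M_1\|_p<\infty$, then $\lambda\in\overline{\mathcal B}^{L_p}$. (b) If $\lambda\in\overline{\mathcal B}^{L_p}$, then $\|M_1\|_r<\infty$ for all $r\in(1,p)$.
   Context: $\rho(x):=x-[x]$ is the fractional part of the real number $x$. $\chi$ is the characteristic function of $(0,1]$, and $\lambda(x):=\chi(x)\log x$ for $x>0$. $M(x):=\sum_{k\le x}\mu(k)$ where $\mu$ is the Möbius function, and $M_1(\theta):=M(1/\theta)$ for $\theta>0$ (so $M_1(\theta)=0$ for $\theta>1$). $\mathcal B$ is the vector space of functions on $(0,\infty)$ of the form $f(x)=\sum_{k=1}^{n}c_k\,\rho(\theta_k/x)$ with $n\in\mathbb N$, $c_k\in\mathbb C$, $\theta_k\in(0,1]$; one has $\mathcal B\subset L_p(0,\infty)$ for $1<p\le\infty$. $\|\cdot\|_p$ is the norm of $L_p(0,\infty)$ (Lebesgue measure), and $\overline{\mathcal B}^{L_p}$ is the closure of $\mathcal B$ in $L_p(0,\infty)$. *)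

(* Defs.v *)
From HB Require Import structures.
From mathcomp Require Import all_boot all_order all_algebra.
From mathcomp Require Import all_classical all_reals all_analysis.
From mathcomp Require Import complex.

Set Implicit Arguments.
Unset Strict Implicit.
Unset Printing Implicit Defensive.

Import Order.TTheory GRing.Theory Num.Theory.
Import numFieldNormedType.Exports.

Local Open Scope classical_set_scope.
Local Open Scope ring_scope.
Local Open Scope complex_scope.

(* The value at n = 0 is junk and is never used. *)
Definition moebius (n : nat) : int :=
  if all (fun q => ~~ (q ^ 2 %| n)%N) (primes n)
  then (-1) ^+ size (primes n) else 0.

(* Num.truncn x is the integer part of x when 0 <= x, and 0 otherwise, so the
   sum ranges over the integers k with 1 <= k <= x. *)
Definition mertens (R : realType) (x : R) : int :=
  \sum_(1 <= k < (Num.truncn x).+1) moebius k.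

Definition mertens1 (R : realType) (theta : R) : int := mertens (1 / theta).

Definition frac_part (R : realType) (x : R) : R := x - (Num.floor x)%:~R.

Definition lambda (R : realType) (x : R) : R := \1_(`]0, 1] : set R) x * ln x.

(* Functions on (0, +oo) are represented by total functions on R: the values
   on (-oo, 0] are irrelevant to every definition below. *)
Definition half_line (R : realType) : set R := `]0, +oo[.
Arguments half_line R : clear implicits.

Definition LpC_norm (R : realType) (p : \bar R) (f : R -> R[i]) : \bar R :=
  Lnorm (@lebesgue_measure R) p
    (EFin \o ((fun x => ComplexField.Normc.normc (f x)) \_ (half_line R))).

Definition LpC (R : realType) (p : \bar R) : set (R -> R[i]) :=
  [set f | [/\ measurable_fun (half_line R) (fun x => complex.Re (f x)),
               measurable_fun (half_line R) (fun x => complex.Im (f x)) &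
               (LpC_norm p f < +oo)%E]].

(* Intended for A included in LpC p. *)
Definition LpC_closure (R : realType) (p : \bar R) (A : set (R -> R[i])) :
    set (R -> R[i]) :=
  [set g | LpC p g /\
    forall e : R, 0 < e ->
      exists2 f, A f & (LpC_norm p (fun x => (g x - f x)%R) < e%:E)%E].

Definition Beurling_space (R : realType) : set (R -> R[i]) :=
  [set f | exists (n : nat) (c : 'I_n -> R[i]) (theta : 'I_n -> R),
    (forall k, 0 < theta k <= 1) /\
    (forall x : R, 0 < x ->
       f x = \sum_(k < n) c k * (frac_part (theta k / x))%:C)].
Arguments Beurling_space R : clear implicits.

(* Main.v *)
(* Part (a). Since the sum of M(z/k) over k <= z is 1, the integral of
   M_1(t) rho(t/x) dt/t over ]y, 1] equals log x + A_y/x for y < x <= 1, where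
   A_y is the integral of M_1 over ]y, 1]; subtracting (A_y/y) rho(y/x) leaves
   exactly log x there. On ]0, y] what remains is bounded by a constant T_y, and
   y^(1/p) T_y tends to 0 by Young's inequality, because M_1 has integral 0 over
   ]0, 1]. Riemann sums on a geometric grid replace the integral by an element
   of the Beurling space.

   Part (b). By the Mellin transform and Hoelder's inequality, an approximation
   of lambda in L_p makes zeta(s)/s P(s) close to 1/s^2, uniformly on half-planes
   Re s >= b > 1/p away from the pole, where P is an exponential sum. Hence P has
   no zero in large discs centred at 5 + it, and a Borel-Caratheodory argument
   between two such circles shows that P = O(|t|^(-1+eta)) there. Cauchy's
   estimates pass to the limit in the Taylor coefficients at 5 + it, which
   become those of the Mellin transform 1/(s zeta(s)) of M_1. No analytic
   continuation is formed: the coefficients are resummed against a Gaussian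
   kernel, which turns the bound into M(x) = O(x^(sigma + eta)) for every
   sigma > 1/p. *)

Require Import Defs.
From HB Require Import structures.
From mathcomp Require Import all_boot all_order all_algebra.
From mathcomp Require Import all_classical all_reals all_analysis.
From mathcomp Require Import measurable_realfun.
From mathcomp Require Import complex.
From mathcomp Require Import cyclic separable cyclotomic.
From mathcomp Require Import zify ring lra.

Set Implicit Arguments.
Unset Strict Implicit.
Unset Printing Implicit Defensive.

Import Order.TTheory GRing.Theory Num.Theory.
Import numFieldNormedType.Exports.
Import ComplexField.Normc.

Local Open Scope classical_set_scope.
Local Open Scope ring_scope.
Local Open Scope complex_scope.


(** The obstacle is that closeness to lambda in L_p gives no uniform control of the size of P: on
    the large circle the lower bound for |s P(s)| decays like 1/|t|. Its logarithm enters only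
    through Taylor coefficients of order at least K, weighted by (r / r2)^K, so that it costs a
    factor |t|^eta with eta as small as desired; the lower orders are estimated on the small circle,
    where |s P(s)| lies between 1/3 and 3. The centre 5 + it is such that the disc of radius 2 stays
    in Re s >= 3, where zeta(s) is within 1/2 of 1. At low height the disc may contain the pole at
    1; zeta is then bounded from below by one approximation fixed in advance. Complex analysis is
    reduced to finite sums: holomorphic functions are replaced by approximating polynomials, contour
    integrals by averages over roots of unity. The Gaussian window has width 1/N in log x: it sees
    1/x within O(1) of N, where M varies by O(1), so that smoothing loses nothing in the
    exponent. *)

(** * The Moebius function and its summatory function *)

Lemma moebius_sqr (p d : nat) : prime p -> (0 < d)%N -> (p ^ 2 %| d)%N -> moebius d = 0.
Proof.
move=> pp d0 pd; rewrite /moebius ifF //; apply/negbTE/allPn; exists p; last by rewrite negbK.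
by rewrite mem_primes pp d0 (dvdn_trans _ pd) // expnS dvdn_mulr.
Qed.

Lemma moebius_prime_mul (p d : nat) : prime p -> (0 < d)%N -> ~~ (p %| d)%N ->
  moebius (p * d) = - moebius d.
Proof.
move=> pp d0 pNd.
have pr : perm_eq (primes (p * d)) (p :: primes d).
  apply: uniq_perm; rewrite ?primes_uniq //=.
    by rewrite primes_uniq andbT mem_primes pp d0.
  move=> q; rewrite (primesM _ (prime_gt0 pp) d0) (primes_prime pp) !inE //.
rewrite /moebius (perm_size pr) /= exprS (perm_all _ pr) /=.
have -> : ~~ (p ^ 2 %| p * d)%N by rewrite expnS dvdn_pmul2l ?prime_gt0 // expn1.
rewrite /=.
have -> : all (fun q => ~~ (q ^ 2 %| p * d)%N) (primes d) = all (fun q => ~~ (q ^ 2 %| d)%N) (primes d).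
  apply: eq_in_all => q; rewrite mem_primes => /and3P[pq _ qd]; congr (~~ _).
  rewrite Gauss_dvdr // coprimeXl // prime_coprime // dvdn_prime2 //.
  by apply/negP => /eqP qp; rewrite -qp qd in pNd.
by case: ifP => _; rewrite ?oppr0 // mulN1r.
Qed.

(** Let p be the least prime factor of n. Divisors divisible by p^2 contribute 0, and multiplication
    by p pairs the divisors prime to p with those in which p occurs once, with opposite signs. *)
Lemma sum_moebius_dvd (n : nat) : (0 < n)%N ->
  \sum_(d <- divisors n) moebius d = (n == 1%N)%:R.
Proof.
move=> n0; case: (ltngtP n 1) => [| n1 | ->]; first by rewrite ltnS leqNgt n0.
  have pp := pdiv_prime n1; set p := pdiv n in pp.
  have p0 := prime_gt0 pp.
  have pn : (p %| n)%N := pdiv_dvd n.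
  have np0 : (0 < n %/ p)%N by rewrite divn_gt0 // (dvdn_leq n0 pn).
  rewrite (bigID (fun d => p %| d)%N) /=.
  have -> : \sum_(d <- divisors n | (p %| d)%N) moebius d =
    \sum_(d <- divisors (n %/ p)) moebius (p * d).
    rewrite -[RHS](big_map (fun d => (p * d)%N) xpredT moebius) -[LHS]big_filter.
    apply: perm_big; apply: uniq_perm.
    - by rewrite filter_uniq ?divisors_uniq.
    - rewrite map_inj_uniq ?divisors_uniq // => a b /eqP; rewrite eqn_pmul2l // => /eqP //.
    - move=> d; rewrite mem_filter -dvdn_divisors //; apply/andP/mapP.
        move=> [/dvdnP[k ->] kn]; exists k; last by rewrite mulnC.
        by rewrite -dvdn_divisors // dvdn_divRL.
      move=> [k]; rewrite -dvdn_divisors // dvdn_divRL // => kn ->.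
      by rewrite dvdn_mulr // mulnC.
  rewrite (bigID (fun d => p %| d)%N) /= big1_seq ?add0r; last first.
    move=> d /andP[pd]; rewrite -dvdn_divisors // => dn.
    have d0 : (0 < d)%N by apply: dvdn_gt0 dn.
    by rewrite (@moebius_sqr p) ?muln_gt0 ?p0 // expnS expn1 dvdn_pmul2l.
  have -> : \sum_(d <- divisors n | ~~ (p %| d)%N) moebius d =
    \sum_(d <- divisors (n %/ p) | ~~ (p %| d)%N) moebius d.
    rewrite -big_filter -[RHS]big_filter; apply: perm_big; apply: uniq_perm;
      rewrite ?filter_uniq ?divisors_uniq // => d; rewrite !mem_filter.
    case: (boolP (p %| d)%N) => //= pNd.
    rewrite -!dvdn_divisors // -{1}(divnK pn) Gauss_dvdl //.
    by rewrite coprime_sym prime_coprime.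
  rewrite -big_split big1_seq // => d /andP[pNd]; rewrite -dvdn_divisors // => dn.
  by rewrite moebius_prime_mul //= ?addNr // (dvdn_gt0 np0 dn).
by rewrite (_ : divisors 1 = [:: 1%N]) // big_seq1.
Qed.

(** M at an integer: [mertens x] is [mertensn (Num.truncn x)] by conversion. *)
Definition mertensn (n : nat) : int := \sum_(1 <= k < n.+1) moebius k.

Lemma moebius_le1 n : `|moebius n| <= 1.
Proof. by rewrite /moebius; case: ifP; rewrite ?normr0 // normrX normrN1 expr1n. Qed.

Lemma mertensn_le n : `|mertensn n| <= n%:Z.
Proof.
rewrite /mertensn (le_trans (ler_norm_sum _ _ _)) //.
rewrite (le_trans (ler_sum _ (fun i _ => moebius_le1 i))) //.
by rewrite sumr_const_nat subSS subn0 natz.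
Qed.

Lemma mertensn_dist m n : (m <= n)%N -> `|mertensn n - mertensn m| <= (n - m)%:Z.
Proof.
move=> mn; rewrite /mertensn (@big_cat_nat _ _ _ m.+1 1 n.+1) //= [X in X - _]addrC addrK.
rewrite (le_trans (ler_norm_sum _ _ _)) //.
rewrite (le_trans (ler_sum _ (fun i _ => moebius_le1 i))) //.
by rewrite sumr_const_nat subSS natz.
Qed.

(** Double counting: with m = j k, the double sum of mu(j) runs over m <= n and the divisors j of m,
    and only m = 1 contributes. *)
Lemma sum_mertensn_div n : (0 < n)%N -> \sum_(1 <= k < n.+1) mertensn (n %/ k) = 1.
Proof.
move=> n0.
transitivity (\sum_(1 <= k < n.+1) \sum_(1 <= j < n.+1 | (j * k <= n)%N) moebius j).
  apply: eq_big_nat => k /andP[k1 kn]; rewrite /mertensn big_nat_cond [RHS]big_nat_cond.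
  rewrite (big_nat_widen _ _ n.+1) ?ltnS ?leq_div //; apply: eq_bigl => j.
  rewrite ltnS leq_divRL // ; case: (_ <= j)%N => //=.
  case: (leqP (j * k)%N n) => [h|]; rewrite ?andbF // !andbT.
  by rewrite ltnS (leq_trans _ h) // leq_pmulr.
transitivity (\sum_(1 <= m < n.+1) \sum_(d <- divisors m) moebius d); last first.
  rewrite (@eq_big_nat _ _ _ _ _ _ (fun m => (m == 1%N)%:R)); last first.
    by move=> m /andP[m1 _]; rewrite sum_moebius_dvd.
  by rewrite big_ltn // big1_seq ?addr0 // => m /=; rewrite mem_index_iota => /andP[]; case: m => [|[]].
rewrite (@eq_big_nat _ _ _ _ _ (fun m => \sum_(d <- divisors m) moebius d)
  (fun m => \sum_(1 <= d < n.+1) if (d %| m)%N then moebius d else 0)); last first.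
  move=> m /andP[m1 mn]; rewrite -[RHS]big_mkcond -[RHS]big_filter; apply: perm_big; apply: uniq_perm.
  - exact: divisors_uniq.
  - by rewrite filter_uniq // iota_uniq.
  - move=> d; rewrite mem_filter mem_index_iota -dvdn_divisors //.
    case: (boolP (d %| m)%N) => //= dm; symmetry; apply/andP; split.
      exact: dvdn_gt0 dm.
    by apply: leq_trans mn; rewrite ltnS dvdn_leq.
under [LHS]eq_bigr do rewrite big_mkcond.
rewrite exchange_big [RHS]exchange_big /=; apply: eq_big_nat => d /andP[d1 dn].
(* For fixed d both sides add [moebius d] once for each multiple of d up to n; the map k -> d k
   matches the index sets. *)
rewrite -[LHS]big_mkcond -[RHS]big_mkcond /= -[LHS]big_filter -[RHS]big_filter !big_const_seq !count_predT.
congr (iter _ _ _); rewrite -(size_map (muln d)); apply: perm_size; apply: uniq_perm.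
- rewrite map_inj_uniq ?filter_uniq ?iota_uniq // => a b /eqP; rewrite eqn_pmul2l // => /eqP //.
- by rewrite filter_uniq ?iota_uniq.
move=> m; rewrite mem_filter mem_index_iota; apply/mapP/and3P => [[k]|[/dvdnP[k ->] k1 k2]].
  rewrite mem_filter mem_index_iota => /and3P[kn k1 _] ->; split; rewrite ?dvdn_mulr //.
    by rewrite muln_gt0 d1.
exists k; last by rewrite mulnC.
have k2' : (k * d <= n)%N by [].
rewrite mem_filter mem_index_iota mulnC k2' /=; move: k1; rewrite muln_gt0 => /andP[-> _] /=.
by rewrite (leq_ltn_trans _ k2) // leq_pmulr.
Qed.

(** * Derivatives of real functions and elementary comparison *)

Section Rderiv.
Variable R : realType.
Implicit Types (f g : R -> R) (x a b : R).

Lemma dvD f g x a b : is_derive x (1:R) f a -> is_derive x (1:R) g b ->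
  is_derive x (1:R) (fun t => f t + g t) (a + b).
Proof. exact: is_deriveD. Qed.

Lemma dvB f g x a b : is_derive x (1:R) f a -> is_derive x (1:R) g b ->
  is_derive x (1:R) (fun t => f t - g t) (a - b).
Proof. exact: is_deriveB. Qed.

Lemma dvM f g x a b : is_derive x (1:R) f a -> is_derive x (1:R) g b ->
  is_derive x (1:R) (fun t => f t * g t) (a * g x + f x * b).
Proof. by move=> df dg; apply: is_derive_eq (is_deriveM df dg) _; rewrite /GRing.scale /=; ring. Qed.

Lemma dvZ k f x a : is_derive x (1:R) f a -> is_derive x (1:R) (fun t => k * f t) (k * a).
Proof. exact: is_deriveZ. Qed.

Lemma dvcst (k x : R) : is_derive x (1:R) (fun _ => k) 0.
Proof. exact: is_derive_cst. Qed.

Lemma dvid x : is_derive x (1:R) (fun t => t) 1.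
Proof. exact: is_derive_id. Qed.

Lemma dvX n x : is_derive x (1:R) (fun t => t ^+ n) (n%:R * x ^+ n.-1).
Proof.
elim: n => [|n IH]; first by rewrite mul0r; exact: dvcst.
have -> : (fun t : R => t ^+ n.+1) = (fun t => t * t ^+ n) by apply/funext => t; rewrite exprS.
apply: is_derive_eq (dvM (dvid x) IH) _.
by case: n {IH} => [|n] /=; rewrite ?expr0 ?mul0r ?mulr0 ?addr0 // [in RHS]mulrS mulrDl !mul1r [x * _]mulrCA -exprS.
Qed.

Lemma dvcomp f g x a b : is_derive (g x) (1:R) f a -> is_derive x (1:R) g b ->
  is_derive x (1:R) (fun t => f (g t)) (a * b).
Proof. exact: is_derive1_comp. Qed.

Lemma dv_cont f (df : R -> R) a b : (forall x, a <= x <= b -> is_derive x (1:R) f (df x)) ->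
  {within `[a, b], continuous f}.
Proof.
move=> H; apply: derivable_within_continuous => x; rewrite in_itv /= => xab.
by have [] := H x xab.
Qed.

(** A mean value inequality: g - f and g + f have nonnegative derivatives, hence increase. It bounds
    Taylor remainders without integration. *)
Lemma derive_norm_le (f df g dg : R -> R) a b : a <= b ->
  (forall x, a <= x <= b -> is_derive x (1:R) f (df x)) ->
  (forall x, a <= x <= b -> is_derive x (1:R) g (dg x)) ->
  (forall x, a <= x <= b -> `|df x| <= dg x) ->
  `|f b - f a| <= g b - g a.
Proof.
move=> ab Hf Hg H.
have P (h dh : R -> R) : (forall x, a <= x <= b -> is_derive x (1:R) h (dh x)) ->
  (forall x, a <= x <= b -> 0 <= dh x) -> h a <= h b.
  move=> Hh h0; have K1 : forall x, x \in `]a, b[%R -> is_derive x (1:R) h (dh x).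
    by move=> x; rewrite in_itv /= => /andP[/ltW ? /ltW ?]; apply: Hh; apply/andP.
  have [c] := MVT_segment ab K1 (dv_cont Hh).
  rewrite in_itv /= => cab E; rewrite -subr_ge0 E mulr_ge0 ?h0 ?subr_ge0 //.
have P1 := P (fun x => g x - f x) (fun x => dg x - df x)
  (fun x hx => dvB (Hg x hx) (Hf x hx)).
have P2 := P (fun x => g x + f x) (fun x => dg x + df x)
  (fun x hx => dvD (Hg x hx) (Hf x hx)).
rewrite ler_norml; apply/andP; split.
  suff: g a + f a <= g b + f b by lra.
  by apply: P2 => x hx; have := H x hx; rewrite ler_norml => /andP[]; lra.
suff: g a - f a <= g b - f b by lra.
by apply: P1 => x hx; have := H x hx; rewrite ler_norml => /andP[]; lra.
Qed.

(** Disposes of an error that decays geometrically in an auxiliary parameter. *)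
Lemma le_geo (a b c q : R) : 0 <= q < 1 -> (forall m : nat, a <= b + c * q ^+ m) -> a <= b.
Proof.
move=> /andP[q0 q1] H.
have C1 : (fun m => b + c * q ^+ m) @ \oo --> b + c * 0.
  by apply: cvgD; [exact: cvg_cst|apply: cvgMr; apply: cvg_expr; rewrite ger0_norm].
by have := ler_cvg_to (cvg_cst a) C1; rewrite mulr0 addr0; apply; near=> m; exact: H.
Unshelve. all: by end_near. Qed.

End Rderiv.

(** * Zeros of polynomials and the Borel-Caratheodory inequality *)

Section Cnorm.
Variable R : realType.
Local Notation C := R[i].
Local Notation nc := (@normc R).
Implicit Types x y z w : C.

Lemma nc_ge0 z : 0 <= nc z. Proof. by case: z => a b; rewrite sqrtr_ge0. Qed.
Lemma ncD x y : nc (x + y) <= nc x + nc y. Proof. exact: le_normcD. Qed.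
Lemma ncN x : nc (- x) = nc x. Proof. exact: normcN. Qed.
Lemma ncB x y : nc (x - y) <= nc x + nc y. Proof. by rewrite (le_trans (ncD _ _)) ?ncN. Qed.
Lemma nc_dist x y : nc (x - y) = nc (y - x). Proof. by rewrite -ncN opprB. Qed.
Lemma nc_subl x y : nc x - nc y <= nc (x - y).
Proof. by rewrite lerBlDr -{1}(subrK y x) ncD. Qed.
Lemma nc_subr x y : nc y - nc x <= nc (x - y).
Proof. by rewrite nc_dist nc_subl. Qed.
Lemma nc_eq0 z : (nc z == 0) = (z == 0).
Proof. by apply/eqP/eqP => [/eq0_normc|->]; rewrite ?normc0. Qed.
Lemma nc_gt0 z : (0 < nc z) = (z != 0).
Proof. by rewrite lt_def nc_eq0 nc_ge0 andbT. Qed.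
Lemma nc_div x y : nc (x / y) = nc x / nc y. Proof. by rewrite normcM normcV. Qed.
Lemma ncX x n : nc (x ^+ n) = nc x ^+ n.
Proof. by elim: n => [|n IH]; rewrite ?normc1 // !exprS normcM IH. Qed.
Lemma nc_real (a : R) : nc a%:C = `|a|.
Proof. by rewrite /= expr0n /= addr0 sqrtr_sqr. Qed.
Lemma nc_nat n : nc n%:R = n%:R.
Proof. by rewrite (_ : n%:R = n%:R%:C) ?nc_real ?normr_nat // rmorph_nat. Qed.
Lemma nc_sum I (r : seq I) (P : pred I) (F : I -> C) :
  nc (\sum_(i <- r | P i) F i) <= \sum_(i <- r | P i) nc (F i).
Proof.
elim/big_rec2 : _ => [|i y1 y2 _ H]; first by rewrite normc0.
by rewrite (le_trans (ncD _ _)) // lerD2l.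
Qed.
Lemma nc_Re z : `|complex.Re z| <= nc z.
Proof. by case: z => a b /=; rewrite -sqrtr_sqr ler_sqrt ?addr_ge0 ?sqr_ge0 // lerDl sqr_ge0. Qed.
Lemma nc_Im z : `|complex.Im z| <= nc z.
Proof. by case: z => a b /=; rewrite -sqrtr_sqr ler_sqrt ?addr_ge0 ?sqr_ge0 // lerDr sqr_ge0. Qed.
Lemma nc_le_ReIm z : nc z <= `|complex.Re z| + `|complex.Im z|.
Proof.
case: z => a b /=; rewrite -[leRHS]ger0_norm ?addr_ge0 // -sqrtr_sqr ler_sqrt ?sqr_ge0 //.
rewrite sqrrD !real_normK ?num_real // lerD2r lerDl mulrn_wge0 // mulr_ge0 //.
Qed.
Lemma nc_sqr z : nc z ^+ 2 = complex.Re z ^+ 2 + complex.Im z ^+ 2.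
Proof. by case: z => a b /=; rewrite sqr_sqrtr // addr_ge0 ?sqr_ge0. Qed.

(** X^N - 1 splits and is separable, and N distinct N-th roots of unity include a primitive one. *)
Lemma prim_root_exists N : (0 < N)%N -> exists z : C, N.-primitive_root z.
Proof.
pose p : {poly C} := 'X^N - 1; have [r Dp] := closed_field_poly_normal p.
move=> n_gt0; rewrite (monicP _) ?monicXnsubC // scale1r in Dp.
have rn1: all N.-unity_root r by apply/allP=> z; rewrite -root_prod_XsubC -Dp.
have sz_r: (N < (size r).+1)%N by rewrite -(size_prod_XsubC r id) -Dp size_XnsubC.
have [|z] := hasP (has_prim_root n_gt0 rn1 _ sz_r); last by exists z.
by rewrite -separable_prod_XsubC -Dp separable_Xn_sub_1 // pnatr_eq0 -lt0n.
Qed.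

Lemma prim_nc N (om : C) : (0 < N)%N -> N.-primitive_root om -> nc om = 1.
Proof.
move=> N0 pr; apply/eqP; rewrite -(pexpr_eq1 N0 (nc_ge0 om)).
by rewrite -ncX prim_expr_order // normc1.
Qed.

Lemma prim_sum N (om : C) i : N.-primitive_root om ->
  \sum_(j < N) om ^+ (j * i) = if (N %| i)%N then N%:R else 0.
Proof.
move=> pr; have [Ni|Ni] := boolP (N %| i)%N.
  rewrite (eq_bigr (fun=> 1)) ?sumr_const ?card_ord // => j _.
  by apply/eqP; rewrite -(prim_order_dvd pr) dvdn_mull.
have z1 : om ^+ i - 1 != 0 by rewrite subr_eq0 -(prim_order_dvd pr).
apply: (mulfI z1); rewrite mulr0.
under eq_bigr do rewrite mulnC exprM.
by rewrite -subrX1 -exprM mulnC exprM (prim_expr_order pr) expr1n subrr.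
Qed.

(** Averaging T(r om^j) om^(-jk) over the N-th roots of unity isolates the coefficient of index k as
    soon as N exceeds the size of T plus k. The exponent n = N - k stands for -k. *)
Lemma poly_cauchy (T : {poly C}) (B r : R) k : 0 < r ->
  (forall z, nc z = r -> nc T.[z] <= B) -> nc T`_k * r ^+ k <= B.
Proof.
move=> r0 H.
have [kT|kT] := leqP (size T) k.
  rewrite nth_default // normc0 mul0r (le_trans _ (H r%:C _)) ?nc_ge0 ?nc_real ?gtr0_norm //.
pose N := (size T + k).+1; have [om pr] := @prim_root_exists N isT.
have om1 := prim_nc (ltn0Sn _) pr.
pose n := (N - k)%N.
have E : \sum_(j < N) T.[r%:C * om ^+ j] * om ^+ (j * n) = N%:R * (T`_k * r%:C ^+ k).
  transitivity (\sum_(j < N) \sum_(i < size T) T`_i * r%:C ^+ i * om ^+ (j * (i + n))).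
    apply: eq_bigr => j _; rewrite horner_coef big_distrl /=; apply: eq_bigr => i _.
    by rewrite exprMn -exprM mulnDr exprD !mulrA.
  rewrite exchange_big /= (bigD1 (Ordinal kT)) //= [X in _ + X]big1 ?addr0.
    rewrite -big_distrr /= prim_sum // subnKC ?dvdnn 1?mulrC //.
    by rewrite /N ltnW // ltnS leq_addl.
  move=> i ik; rewrite -big_distrr /= prim_sum // ifF ?mulr0 //.
  apply/negbTE/negP => /dvdnP[q Eq].
  have iT := ltn_ord i; have := ik; rewrite -val_eqE /= => /eqP; apply.
  have kN : (k < N)%N by rewrite ltnS leq_addl.
  have qN : (q * N < 2 * N)%N.
    rewrite -Eq mul2n -addnn -addSn leq_add ?leq_subr // (leq_trans iT) //.
    by rewrite leqW // leq_addr.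
  have : (0 < q * N)%N by rewrite -Eq addn_gt0 subn_gt0 kN orbT.
  case: q qN Eq => [|[|q]] //; last by rewrite ltn_pmul2r.
  by rewrite mul1n => _ Eq _; apply/eqP; rewrite -(eqn_add2r n) Eq /n subnKC // ltnW.
have : nc (\sum_(j < N) T.[r%:C * om ^+ j] * om ^+ (j * n)) <= N%:R * B.
  rewrite (le_trans (nc_sum _ _ _)) // (le_trans (ler_sum _ (fun j _ => _ : _ <= B))) //.
    move=> j _; rewrite normcM !ncX om1 expr1n mulr1; apply: H.
    by rewrite normcM ncX om1 expr1n mulr1 nc_real gtr0_norm.
  by rewrite big_const_ord iter_addr_0 mulr_natl.
rewrite E !normcM ncX nc_nat nc_real gtr0_norm // ler_pM2l ?ltr0n //.
Qed.

Definition lognc1 w : R := ln (nc (1 - w)).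

Lemma Re_sum I (r : seq I) (P : pred I) (F : I -> C) :
  complex.Re (\sum_(i <- r | P i) F i) = \sum_(i <- r | P i) complex.Re (F i).
Proof. by elim/big_rec2 : _ => // i y1 y2 _ <-; case: (F i) y2 => [a b] []. Qed.

Lemma Re_realM (a : R) z : complex.Re (a%:C * z) = a * complex.Re z.
Proof. by case: z => x y /=; rewrite mul0r subr0. Qed.

(** Taylor expansion along the segment t w, 0 <= t <= 1: adding the partial sum to log |1 - t w|
    leaves the derivative - Re (w (t w)^m / (1 - t w)), of modulus at most |w|^(m+1) / (1 - |w|). *)
Lemma log_series w m : nc w < 1 ->
  `|lognc1 w + \sum_(i < m) complex.Re (w ^+ i.+1) / i.+1%:R| <= nc w ^+ m.+1 / (1 - nc w).
Proof.
move=> w1; have nw0 := nc_ge0 w.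
pose x := complex.Re w; pose y := complex.Im w.
have Dn (t : R) : (1 - t * x) ^+ 2 + (t * y) ^+ 2 = nc (1 - t%:C * w) ^+ 2.
  by rewrite nc_sqr /x /y; case: (w) => a b /=; ring.
have Dp (t : R) : 0 <= t <= 1 -> 0 < nc (1 - t%:C * w).
  move=> /andP[t0 t1]; have := nc_subl 1 (t%:C * w); rewrite normc1 normcM nc_real ger0_norm //.
  apply: lt_le_trans; rewrite subr_gt0 (le_lt_trans _ w1) // ler_piMl //.
have Dlb (t : R) : 0 <= t <= 1 -> 1 - nc w <= nc (1 - t%:C * w).
  move=> /andP[t0 t1]; have := nc_subl 1 (t%:C * w); rewrite normc1 normcM nc_real ger0_norm //.
  apply: le_trans; rewrite lerD2l lerN2 ler_piMl //.
(* Half the logarithm of the squared modulus, which is a polynomial in t without zero on [0, 1]. *)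
pose f (t : R) := 2^-1 * ln ((1 - t * x) ^+ 2 + (t * y) ^+ 2) + \sum_(i < m) complex.Re (w ^+ i.+1) / i.+1%:R * t ^+ i.+1.
pose df (t : R) := 2^-1 * (((1 - t * x) ^+ 2 + (t * y) ^+ 2)^-1 * (2 * (1 - t * x) * - x + 2 * (t * y) * y))
   + \sum_(i < m) complex.Re (w ^+ i.+1) * t ^+ i.
have Hf (t : R) : 0 <= t <= 1 -> is_derive t (1:R) f (df t).
  move=> ht; rewrite /f /df; apply: dvD.
    apply: dvZ; apply: (@dvcomp _ (@ln R) (fun t => (1 - t * x) ^+ 2 + (t * y) ^+ 2)).
      by apply: is_derive1_ln; rewrite Dn exprn_gt0 // Dp.
    apply: dvD.
      apply: is_derive_eq (dvcomp (dvX 2 _) (dvB (dvcst 1 t) (dvM (dvid t) (dvcst x t)))) _ => /=; ring.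
    apply: is_derive_eq (dvcomp (dvX 2 _) (dvM (dvid t) (dvcst y t))) _ => /=; ring.
  rewrite (_ : (fun t => \sum_(i < m) _) = \sum_(i < m) (fun t => complex.Re (w ^+ i.+1) / i.+1%:R * t ^+ i.+1)).
    apply: is_derive_sum => i; apply: is_derive_eq (dvZ _ (dvX _ _)) _ => /=.
    by rewrite mulrA divfK // pnatr_eq0.
  by apply/funext => s; rewrite fct_sumE.
have dfE (t : R) : 0 <= t <= 1 -> df t = - complex.Re (w * (t%:C * w) ^+ m / (1 - t%:C * w)).
  move=> ht; have nz : 1 - t%:C * w != 0 by rewrite -nc_gt0 Dp.
  have -> : w * (t%:C * w) ^+ m / (1 - t%:C * w) = w / (1 - t%:C * w) - \sum_(i < m) (t ^+ i)%:C * w ^+ i.+1.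
    have -> : \sum_(i < m) (t ^+ i)%:C * w ^+ i.+1 = w * \sum_(i < m) (t%:C * w) ^+ i.
      rewrite big_distrr; apply: eq_bigr => i _; rewrite exprMn exprS rmorphXn /=; ring.
    apply: (mulIf nz); rewrite mulfVK // mulrBl divfK // -mulrA [(\sum_(i < m) _) * _]mulrC.
    have -> : (1 - t%:C * w) * (\sum_(i < m) (t%:C * w) ^+ i) = 1 - (t%:C * w) ^+ m.
      by rewrite -[1 - t%:C * w]opprB mulNr -subrX1 opprB.
    by rewrite mulrBr mulr1 opprB addrCA subrr addr0.
  have -> : complex.Re (w / (1 - t%:C * w) - \sum_(i < m) (t ^+ i)%:C * w ^+ i.+1)
    = complex.Re (w / (1 - t%:C * w)) - \sum_(i < m) complex.Re (w ^+ i.+1) * t ^+ i.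
    rewrite raddfB /= Re_sum; congr (_ - _); apply: eq_bigr => i _; by rewrite Re_realM mulrC.
  rewrite opprB addrC /df; congr (_ + _).
  have nn : (1 - t * x) ^+ 2 + (t * y) ^+ 2 != 0 by rewrite Dn expf_neq0 // gt_eqF // Dp.
  move: nn; rewrite /x /y; case: (w) => a b /= nn.
  by rewrite !mul0r !subr0 !addr0; field; rewrite !expr2 in nn *; move: nn; congr (~~ (_ == 0)); ring.
have Hg (t : R) : 0 <= t <= 1 -> is_derive t (1:R) (fun t => nc w ^+ m.+1 / (1 - nc w) * t) (nc w ^+ m.+1 / (1 - nc w)).
  by move=> _; apply: is_derive_eq (dvZ _ (dvid t)) _; rewrite mulr1.
have : `|f 1 - f 0| <= nc w ^+ m.+1 / (1 - nc w) * 1 - nc w ^+ m.+1 / (1 - nc w) * 0.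
  apply: (derive_norm_le ler01 Hf Hg) => t ht; rewrite dfE // normrN (le_trans (nc_Re _)) //.
  rewrite nc_div normcM ncX normcM nc_real exprS.
  have /andP[t0 t1] := ht.
  apply: ler_pM; rewrite ?invr_ge0 ?nc_ge0 ?mulr_ge0 ?exprn_ge0 ?mulr_ge0 ?nc_ge0 //.
    apply: ler_wpM2l => //; apply: lerXn2r; rewrite ?nnegrE ?mulr_ge0 //.
    by rewrite ger0_norm // ler_piMl.
  by rewrite lef_pV2 ?posrE ?Dp ?Dlb // subr_gt0.
rewrite mulr1 mulr0 subr0; apply: le_trans; rewrite le_eqVlt; apply/orP; left; apply/eqP; congr (`|_|).
rewrite /f mul0r subr0 mul0r expr1n expr0n addr0 ln1 mulr0 add0r.
rewrite [X in _ = _ - X]big1 ?subr0; last by move=> i _; rewrite expr0n mulr0.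
congr (_ + _); last by apply: eq_bigr => i _; rewrite expr1n mulr1.
have p1 := Dp 1; rewrite lexx ler01 rmorph1 mul1r in p1.
by rewrite Dn rmorph1 mul1r /lognc1 lnXn ?p1 // -[X in _ = _ * X]mulr_natl mulKf // pnatr_eq0.
Qed.


Lemma prim_conj N (om : C) : (0 < N)%N -> N.-primitive_root om -> (om^*)%C = om ^+ N.-1.
Proof.
move=> N0 pr; have om0 : om != 0 by rewrite -nc_gt0 (prim_nc N0 pr).
apply: (mulfI om0); rewrite -exprS prednK // prim_expr_order //.
by rewrite -sqr_normc normc_def; have := prim_nc N0 pr; case: (om) => a b /= ->; rewrite expr1n.
Qed.

(** The k-th Fourier coefficient of log |1 - w| on a circle is - w^k / (2k). In the partial sum each
    real part is half the sum of a term and its conjugate; m + k < N prevents the conjugate terms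
    from aliasing onto frequency k. For k = 0 the quotient N / (2k) is 0, as division by 0 gives 0,
    so that the statement includes the mean value property. *)
Lemma log_avg N (om w : C) k m : N.-primitive_root om -> nc w < 1 ->
  (k <= m)%N -> (m + k < N)%N ->
  nc (\sum_(j < N) (lognc1 (w * om ^+ j))%:C * om ^+ (j * (N - k)) + N%:R / (2 * k%:R) * w ^+ k)
   <= N%:R * (nc w ^+ m.+1 / (1 - nc w)).
Proof.
move=> pr w1 km mkN; have N0 : (0 < N)%N by apply: leq_ltn_trans mkN.
have om1 := prim_nc N0 pr.
have kN : (k <= N)%N by rewrite ltnW // (leq_ltn_trans _ mkN) // leq_addl.
pose S j : R := \sum_(i < m) complex.Re ((w * om ^+ j) ^+ i.+1) / i.+1%:R.
have E : \sum_(j < N) (S j)%:C * om ^+ (j * (N - k)) = N%:R / (2 * k%:R) * w ^+ k.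
  transitivity (\sum_(j < N) \sum_(i < m) (2 * i.+1%:R)^-1 *
     (w ^+ i.+1 * om ^+ (j * (i.+1 + (N - k))) + (w^*)%C ^+ i.+1 * om ^+ (j * (N.-1 * i.+1 + (N - k))))).
    apply: eq_bigr => j _; rewrite rmorph_sum big_distrl /=; apply: eq_bigr => i _.
    rewrite rmorphM /= ReJ_add rmorphXn rmorphM rmorphXn /= (prim_conj N0 pr).
    rewrite fmorphV rmorph_nat !exprMn -!exprM !mulnDr !exprD !mulnA invfM.
    rewrite [(_ * j * i.+1)%N](_ : _ = (j * N.-1 * i.+1)%N); first by ring.
    by rewrite [(_ * j)%N]mulnC.
  rewrite exchange_big /=.
  transitivity (\sum_(i < m) if i.+1 == k then N%:R / (2 * k%:R) * w ^+ k else 0).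
    apply: eq_bigr => i _; have im := ltn_ord i.
    rewrite -big_distrr big_split -!big_distrr /= !prim_sum //.
    rewrite [X in _ + _ * X]ifF; last first.
      apply/negbTE/negP => H.
      have E1 : (N.-1 * i.+1 + (N - k) + (i.+1 + k) = N * i.+1 + N)%N.
        by rewrite addnACA -mulSnr prednK // subnK.
      have : (N %| i.+1 + k)%N by rewrite -(dvdn_addr _ H) E1 dvdn_addr ?dvdn_mulr.
      by rewrite gtnNdvd // (leq_ltn_trans _ mkN) // leq_add2r.
    have -> : (N %| i.+1 + (N - k))%N = (i.+1 == k).
      apply/idP/eqP => [/dvdnP[q Eq]|->]; last by rewrite subnKC // dvdnn.
      have qN : (q * N < 2 * N)%N.
        rewrite -Eq mul2n -addnn -addSn leq_add ?leq_subr //.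
        by rewrite (leq_trans _ mkN) // ltnS (leq_trans im) // leq_addr.
      have : (0 < q * N)%N by rewrite -Eq.
      case: q qN Eq => [|[|q]] //; last by rewrite ltn_pmul2r.
      rewrite mul1n => _ Eq _; apply/eqP; rewrite -(eqn_add2r (N - k)) Eq subnKC //.
    by case: eqP => [->|]; rewrite !mulr0 ?addr0 ?mulr0 //; ring.
  case: k km {mkN kN} => [|k] km.
    by rewrite mulr0 invr0 mulr0 mul0r big1.
  by rewrite (bigD1 (Ordinal km)) //= eqxx big1 ?addr0 // => i; rewrite -val_eqE /= eqSS => /negbTE->.
rewrite -E -big_split /= (le_trans (nc_sum _ _ _)) //.
have -> : N%:R * (nc w ^+ m.+1 / (1 - nc w)) = \sum_(j < N) (nc w ^+ m.+1 / (1 - nc w)).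
  by rewrite big_const_ord iter_addr_0 mulr_natl.
rewrite ler_sum // => j _.
rewrite -mulrDl -rmorphD /= normcM nc_real ncX om1 expr1n mulr1.
have := @log_series (w * om ^+ j) m; rewrite normcM ncX om1 expr1n mulr1; exact.
Qed.

Lemma roots_gap (rs : seq C) r : 0 < r -> (forall a, a \in rs -> r < nc a) ->
  exists2 q, 0 <= q < 1 & forall a, a \in rs -> r / nc a <= q.
Proof.
move=> r0; elim: rs => [_|a rs IH H]; first by exists 0; rewrite ?lexx ?ltr01.
have [b bi|q /andP[q0 q1] Hq] := IH; first by apply: H; rewrite inE bi orbT.
have ra : r < nc a by apply: H; rewrite mem_head.
exists (Num.max q (r / nc a)).
  by rewrite le_max q0 gt_max q1 ltr_pdivrMr ?mul1r // (lt_trans r0).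
by move=> b; rewrite inE => /orP[/eqP->|/Hq h]; rewrite le_max ?lexx ?h ?orbT.
Qed.

Lemma frac_mono (x q : R) m : 0 <= x <= q -> q < 1 -> x ^+ m / (1 - x) <= q ^+ m / (1 - q).
Proof.
move=> /andP[x0 xq] q1; apply: ler_pM; rewrite ?exprn_ge0 ?invr_ge0 ?subr_ge0 //.
- by rewrite ltW // (le_lt_trans xq).
- by rewrite lerXn2r ?nnegrE // (le_trans x0).
- by rewrite lef_pV2 ?posrE ?subr_gt0 ?lerD2l ?lerN2 // (le_lt_trans xq).
Qed.

(* By Fourier analysis over the N-th roots of unity, the power sum is read off
   the values of the logarithm on the circle, without complex integration. *)
Lemma borel_caratheodory_powersum (rs : seq C) (r A : R) k : 0 < r -> (0 < k)%N ->
  (forall a, a \in rs -> r < nc a) ->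
  (forall z, nc z = r -> 0 <= A + \sum_(a <- rs) lognc1 (z / a)) ->
  nc (\sum_(a <- rs) a ^- k) * r ^+ k <= 2 * k%:R * A.
Proof.
move=> r0 k0 H HA; have [q /andP[q0 q1] Hq] := roots_gap r0 H.
have k0' : 0 < 2 * k%:R :> R by rewrite mulr_gt0 // ltr0n.
(* The truncation error of the logarithmic series, of order q^m, disappears as m grows. N = 2k + m +
   1 leaves room for the frequencies k and 0. *)
suff K m : nc (\sum_(a <- rs) a ^- k) * r ^+ k <= 2 * k%:R * A +
    (2 * k%:R * 2 * (size rs)%:R * (q ^+ k.+1 / (1 - q))) * q ^+ m.
  by apply: (le_geo _ K); rewrite q0.
set D := 2 * k%:R * 2 * _ * _.
pose m' := (k + m)%N; pose N := (m' + k).+1.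
have [om pr] := @prim_root_exists N (ltn0Sn _); have om1 := prim_nc (ltn0Sn _) pr.
pose er : R := q ^+ m'.+1 / (1 - q).
pose L (j : nat) : R := A + \sum_(a <- rs) lognc1 (r%:C / a * om ^+ j).
have L0 j : 0 <= L j.
  rewrite /L; under eq_bigr do rewrite mulrAC.
  by apply: HA; rewrite normcM ncX om1 expr1n mulr1 nc_real gtr0_norm.
have T1 (kk : nat) : (kk <= m')%N -> (m' + kk < N)%N -> nc (\sum_(j < N) (\sum_(a <- rs) lognc1 (r%:C / a * om ^+ j))%:C * om ^+ (j * (N - kk))
   + N%:R / (2 * kk%:R) * (r%:C ^+ kk * \sum_(a <- rs) a ^- kk)) <= N%:R * ((size rs)%:R * er).
  move=> h1 h2.
  have -> : \sum_(j < N) (\sum_(a <- rs) lognc1 (r%:C / a * om ^+ j))%:C * om ^+ (j * (N - kk))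
    + N%:R / (2 * kk%:R) * (r%:C ^+ kk * \sum_(a <- rs) a ^- kk) = \sum_(a <- rs)
     (\sum_(j < N) (lognc1 (r%:C / a * om ^+ j))%:C * om ^+ (j * (N - kk)) + N%:R / (2 * kk%:R) * (r%:C / a) ^+ kk).
    rewrite big_split /=; congr (_ + _).
      by rewrite exchange_big; apply: eq_bigr => j _; rewrite rmorph_sum big_distrl.
    rewrite !big_distrr /=; apply: eq_bigr => a _; by rewrite exprMn exprVn.
  rewrite (le_trans (nc_sum _ _ _)) // [X in _ <= X]mulrCA [X in _ <= X]mulr_natl.
  rewrite big_seq (le_trans (ler_sum _ (fun a ai => _ : _ <= N%:R * er))) //.
    move=> a ai; have ha := Hq a ai.
    have E1 : nc (r%:C / a) = r / nc a by rewrite nc_div nc_real gtr0_norm.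
    rewrite (le_trans (log_avg pr _ h1 h2)) //; rewrite E1.
      exact: le_lt_trans ha q1.
    rewrite ler_wpM2l // frac_mono // ha divr_ge0 ?nc_ge0 ?(ltW r0) //.
  rewrite -big_seq big_const_seq count_predT iter_addr_0 //.
have h1 : (k <= m')%N by rewrite leq_addr.
have h2 : (m' + k < N)%N by [].
have := T1 k h1 h2; set X := \sum_(j < N) _ => HX.
(* L is nonnegative on the circle, so that its k-th Fourier coefficient is at most its mean; the
   constant A does not affect that coefficient, as 0 < k. *)
have X1 : nc X <= \sum_(j < N) L j.
  have -> : X = \sum_(j < N) (L j)%:C * om ^+ (j * (N - k)).
    rewrite /L; under [RHS]eq_bigr do rewrite rmorphD mulrDl.
    rewrite big_split /= -big_distrr /= prim_sum // ifF ?mulr0 ?add0r //.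
    apply/negbTE; rewrite gtnNdvd // ?subn_gt0 ?ltn_subrL ?k0 //.
    by rewrite (leq_ltn_trans _ h2) // leq_addl.
  rewrite (le_trans (nc_sum _ _ _)) // ler_sum // => j _.
  by rewrite normcM ncX om1 expr1n mulr1 nc_real ger0_norm.
(* Mean value property: the logarithms average to 0 up to the truncation error, which is [T1] at
   frequency 0. *)
have X2 : \sum_(j < N) L j <= N%:R * A + N%:R * ((size rs)%:R * er).
  have EA : \sum_(j < N) A = N%:R * A by rewrite big_const_ord iter_addr_0 mulr_natl.
  rewrite /L big_split /= EA lerD2l.
  have := T1 0 (leq0n _) _; rewrite addn0 => /(_ _)/(le_trans _) K.
  have := K _ _; rewrite mulr0 invr0 mulr0 mul0r addr0 => {}K.
  apply: K; last by rewrite ltnS leq_addr.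
  under [X in nc X]eq_bigr do rewrite subn0 mulnC exprM (prim_expr_order pr) expr1n mulr1.
  by rewrite -rmorph_sum nc_real ler_norm.
have X3 : N%:R / (2 * k%:R) * (r ^+ k * nc (\sum_(a <- rs) a ^- k)) <= N%:R * A + N%:R * ((size rs)%:R * er * 2).
  have -> : N%:R / (2 * k%:R) * (r ^+ k * nc (\sum_(a <- rs) a ^- k)) =
    nc (N%:R / (2 * k%:R) * (r%:C ^+ k * \sum_(a <- rs) a ^- k)).
    by rewrite !normcM normcV normcM ncX !nc_nat nc_real gtr0_norm.
  set Y : C := N%:R / (2 * k%:R) * _; rewrite -/Y in HX.
  have K := nc_subl Y (- X); rewrite opprK ncN [Y + X]addrC in K.
  rewrite [N%:R * (_ * 2)]mulrA; move: HX X1 X2 K; lra.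
have Np : 0 < N%:R :> R by rewrite ltr0n.
have {}X3 : (2 * k%:R)^-1 * (r ^+ k * nc (\sum_(a <- rs) a ^- k)) <= A + (size rs)%:R * er * 2.
  by have := X3; rewrite -mulrA -mulrDr (ler_pM2l Np).
rewrite mulrC -(ler_pM2l (_ : 0 < (2 * k%:R)^-1)) ?invr_gt0 // (le_trans X3) //.
have kn0 : k%:R != 0 :> R by rewrite pnatr_eq0 -lt0n.
have q1n0 : 1 - q != 0 by rewrite subr_eq0 gt_eqF.
rewrite /D /er /m' -addSn exprD le_eqVlt; apply/orP; left; apply/eqP; field.
by rewrite kn0 q1n0.
Qed.

(** The way back: up to factors -1/k, the power sums of the inverse roots are the Taylor
    coefficients of log (Q(z) / Q(0)), and bounds on them bound log |Q(z) / Q(0)| from above. *)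
Lemma sum_log_roots_le (rs : seq C) (r : R) (z : C) m q : 0 <= q < 1 ->
  (forall a, a \in rs -> nc z / nc a <= q) ->
  \sum_(a <- rs) lognc1 (z / a) <= \sum_(i < m) nc (\sum_(a <- rs) a ^- i.+1) * nc z ^+ i.+1 / i.+1%:R
    + (size rs)%:R * (q ^+ m.+1 / (1 - q)).
Proof.
move=> /andP[q0 q1] Hq.
have K a : a \in rs -> lognc1 (z / a) <= - (\sum_(i < m) complex.Re ((z / a) ^+ i.+1) / i.+1%:R) + q ^+ m.+1 / (1 - q).
  move=> ai; have ha := Hq a ai; have E : nc (z / a) = nc z / nc a by rewrite nc_div.
  have := @log_series (z / a) m; rewrite E => /(_ (le_lt_trans ha q1)).
  rewrite ler_norml => /andP[_ h]; rewrite addrC -lerBlDr opprK.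
  by apply: (le_trans h); apply: frac_mono => //; rewrite ha divr_ge0 ?nc_ge0.
rewrite big_seq (le_trans (ler_sum _ K)) // -big_seq big_split /= lerD //; last first.
  by rewrite big_const_seq count_predT iter_addr_0 mulr_natl.
rewrite sumrN exchange_big /= -sumrN ler_sum // => i _.
rewrite -mulr_suml -Re_sum -mulNr ler_wpM2r ?invr_ge0 ?ler0n //.
rewrite (le_trans (ler_norm _)) // normrN (le_trans (nc_Re _)) //.
have -> : \sum_(a <- rs) (z / a) ^+ i.+1 = z ^+ i.+1 * \sum_(a <- rs) a ^- i.+1.
  by rewrite big_distrr; apply: eq_bigr => a _; rewrite exprMn exprVn.
by rewrite normcM ncX mulrC.
Qed.

(* The Taylor coefficients of log Q below K are bounded on the small circle, and
   those from K on, where the ratio r / r2 makes them small, on the large one. *)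
Lemma two_circles (Q : {poly C}) (r1 r r2 A1 A2 : R) K : 0 < r1 <= r -> r < r2 ->
  (forall z, nc z <= r2 -> Q.[z] != 0) ->
  (forall z, nc z = r1 -> 0 <= A1 + ln (nc Q.[z] / nc Q.[0])) ->
  (forall z, nc z = r2 -> 0 <= A2 + ln (nc Q.[z] / nc Q.[0])) ->
  forall z, nc z <= r -> ln (nc Q.[z] / nc Q.[0]) <=
    2 * A1 * K%:R * (r / r1) ^+ K + 2 * A2 * ((r / r2) ^+ K / (1 - r / r2)).
Proof.
move=> /andP[r10 r1r] rr2 Q0 H1 H2 z zr.
have r0 : 0 < r := lt_le_trans r10 r1r; have r20 : 0 < r2 := lt_trans r0 rr2.
have [rs DQ] := closed_field_poly_normal Q.
have Qn : Q != 0 by apply: contraNneq (Q0 0 _) => [->|]; rewrite ?horner0 ?normc0 ?ltW.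
have lQ : lead_coef Q != 0 by rewrite lead_coef_eq0.
have rsP a : a \in rs -> r2 < nc a.
  move=> ai; rewrite ltNge; apply/negP => /Q0; rewrite DQ hornerZ mulf_eq0 (negbTE lQ) /=.
  by rewrite -rootE root_prod_XsubC ai.
have rs0 a : a \in rs -> a != 0 by move/rsP => h; rewrite -nc_gt0 (lt_trans r20).
have E x : nc x <= r2 -> ln (nc Q.[x] / nc Q.[0]) = \sum_(a <- rs) lognc1 (x / a).
  (* Stated for sublists of [rs] to allow induction, together with positivity, which [lnM]
     requires. *)
  move=> xr; have : forall s : seq C, {subset s <= rs} ->
     ln (nc (\prod_(a <- s) (x - a)) / nc (\prod_(a <- s) (0 - a))) = \sum_(a <- s) lognc1 (x / a) /\
      0 < nc (\prod_(a <- s) (x - a)) / nc (\prod_(a <- s) (0 - a)).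
    elim => [_|a s IH sub]; first by rewrite !big_nil normc1 divr1 ln1 ltr01.
    have ars : a \in rs by apply: sub; rewrite mem_head.
    have [b bi|IH1 IH2] := IH; first by apply: sub; rewrite inE bi orbT.
    have xa : 0 < nc (1 - x / a).
      have := nc_subl 1 (x / a); rewrite normc1 nc_div; apply: lt_le_trans.
      rewrite subr_gt0 ltr_pdivrMr ?nc_gt0 ?rs0 // mul1r (le_lt_trans xr) ?rsP //.
    have Ea : nc (x - a) / nc (0 - a) = nc (1 - x / a).
      by rewrite -nc_div; congr nc; rewrite sub0r invrN mulrN mulrBl divff ?rs0 // opprB.
    rewrite !big_cons !normcM invfM mulrACA Ea; split; last exact: mulr_gt0.
    by rewrite lnM ?posrE // IH1.
  move=> /(_ rs (fun _ h => h))[<- _]; congr ln.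
  rewrite DQ !hornerZ !horner_prod !normcM invfM mulrACA divff ?nc_eq0 // mul1r.
  by congr (nc _ / nc _); apply: eq_bigr => a _; rewrite hornerXsubC.
have B1 k : (0 < k)%N -> nc (\sum_(a <- rs) a ^- k) * r1 ^+ k <= 2 * k%:R * A1.
  move=> k0; apply: borel_caratheodory_powersum => //.
    by move=> a ai; rewrite (lt_trans _ (rsP a ai)) // (le_lt_trans r1r).
  by move=> x xr; rewrite -E ?H1 // xr (le_trans r1r) // ltW.
have B2 k : (0 < k)%N -> nc (\sum_(a <- rs) a ^- k) * r2 ^+ k <= 2 * k%:R * A2.
  move=> k0; apply: borel_caratheodory_powersum => //.
  by move=> x xr; rewrite -E ?H2 // xr.
have A10 : 0 <= A1.
  have := B1 1%N isT; rewrite mulr1 => /(le_trans _) h; rewrite -(pmulr_rge0 _ (ltr0Sn _ 1)).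
  by apply: h; rewrite mulr_ge0 ?nc_ge0 // exprn_ge0 // ltW.
have A20 : 0 <= A2.
  have := B2 1%N isT; rewrite mulr1 => /(le_trans _) h; rewrite -(pmulr_rge0 _ (ltr0Sn _ 1)).
  by apply: h; rewrite mulr_ge0 ?nc_ge0 // exprn_ge0 // ltW.
have [q /andP[q0 q1] Hq] := roots_gap r20 rsP.
rewrite E; last by rewrite (le_trans zr) // ltW.
have rq : r / r2 < 1 by rewrite ltr_pdivrMr // mul1r.
have rq0 : 0 <= r / r2 by rewrite divr_ge0 // ltW.
have rr1 : 1 <= r / r1 by rewrite ler_pdivlMr // mul1r.
suff Km m : \sum_(a <- rs) lognc1 (z / a) <= 2 * A1 * K%:R * (r / r1) ^+ K + 2 * A2 * ((r / r2) ^+ K / (1 - r / r2)) +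
    ((size rs)%:R * (q ^+ K.+1 / (1 - q))) * q ^+ m.
  by apply: (le_geo _ Km); rewrite q0.
have Hz a : a \in rs -> nc z / nc a <= q.
  move=> ai; rewrite (le_trans _ (Hq a ai)) // ler_wpM2r ?invr_ge0 ?nc_ge0 //.
  by rewrite (le_trans zr) // ltW.
have := @sum_log_roots_le rs r z (K + m) q _ Hz; rewrite q0 q1 => /(_ isT)/le_trans; apply.
apply: lerD; last by rewrite -addSn exprD mulrAC !mulrA.
rewrite big_split_ord /=; apply: lerD.
  rewrite (le_trans (ler_sum _ (fun i _ => _ : _ <= 2 * A1 * (r / r1) ^+ K))).
  - by [].
  - move=> i _; have iK := ltn_ord i.
    have := B1 i.+1 isT; rewrite -ler_pdivlMr ?exprn_gt0 // => h.
    rewrite ler_pdivrMr ?ltr0n // (le_trans (ler_wpM2r _ h)) ?exprn_ge0 ?nc_ge0 //.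
    have -> : 2 * i.+1%:R * A1 / r1 ^+ i.+1 * nc z ^+ i.+1 = 2 * A1 * i.+1%:R * (nc z / r1) ^+ i.+1.
      by rewrite expr_div_n; ring.
    rewrite [leRHS]mulrAC ler_wpM2l ?mulr_ge0 //.
    rewrite (@le_trans _ _ ((r / r1) ^+ i.+1)) //.
      by rewrite lerXn2r ?nnegrE ?divr_ge0 ?nc_ge0 ?(ltW r0) ?(ltW r10) // ler_wpM2r // invr_ge0 ltW.
    by rewrite ler_weXn2l.
  by rewrite big_const_ord iter_addr_0 -[leLHS]mulr_natr mulrAC.
rewrite (le_trans (ler_sum _ (fun (i : 'I_m) _ => _ : _ <= 2 * A2 * (r / r2) ^+ K * (r / r2) ^+ i))).
- by [].
- move=> i _.
  have := B2 (K + i).+1 isT; rewrite -ler_pdivlMr ?exprn_gt0 // => h.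
  rewrite ler_pdivrMr ?ltr0n // (le_trans (ler_wpM2r _ h)) ?exprn_ge0 ?nc_ge0 //.
  have -> : 2 * (K + i).+1%:R * A2 / r2 ^+ (K + i).+1 * nc z ^+ (K + i).+1 = 2 * A2 * (K + i).+1%:R * (nc z / r2) ^+ (K + i).+1.
    by rewrite expr_div_n; ring.
  rewrite -[X in _ <= X * _]mulrA -exprD [leRHS]mulrAC ler_wpM2l ?mulr_ge0 //.
  rewrite (@le_trans _ _ ((r / r2) ^+ (K + i).+1)) //.
    by rewrite lerXn2r ?nnegrE ?divr_ge0 ?nc_ge0 ?(ltW r0) ?(ltW r20) // ler_wpM2r // invr_ge0 ltW.
  by rewrite ler_wiXn2l // ltW.
rewrite -mulr_sumr !mulrA -mulrA ler_wpM2l ?mulr_ge0 ?exprn_ge0 //.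
rewrite -[leRHS]mul1r ler_pdivlMr ?subr_gt0 // mulrC -opprB mulNr -subrX1 opprB gerBl exprn_ge0 //.
Qed.

End Cnorm.

(** * Integrals of real and complex functions *)

Section Rint.
Variable R : realType.
Local Notation mu := (@lebesgue_measure R).
Local Notation itg D f := (mu.-integrable D (EFin \o f)).
Implicit Types (D : set (measurableTypeR R)) (f g : R -> R).

Lemma itg_le D f g : measurable D -> measurable_fun D f -> itg D g ->
  (forall x, D x -> `|f x| <= g x) -> itg D f.
Proof.
move=> mD mf ig H; apply: (le_integrable mD _ _ ig); first exact/measurable_EFinP.
by move=> x Dx /=; rewrite lee_fin (le_trans (H x Dx)) // ler_norm.
Qed.

Lemma itg_meas D f : itg D f -> measurable_fun D f.
Proof. by move=> /measurable_int/measurable_EFinP. Qed.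

Lemma itgD D f g : measurable D -> itg D f -> itg D g -> itg D (fun x => f x + g x).
Proof. by move=> mD fi gi; have := integrableD mD fi gi; apply: eq_integrable. Qed.

Lemma itgB D f g : measurable D -> itg D f -> itg D g -> itg D (fun x => f x - g x).
Proof. by move=> mD fi gi; have := integrableB mD fi gi; apply: eq_integrable. Qed.

Lemma itgZ D k f : measurable D -> itg D f -> itg D (fun x => k * f x).
Proof. by move=> mD fi; have := integrableZl mD k fi; apply: eq_integrable. Qed.

Lemma itg0 D : measurable D -> itg D (fun _ => 0).
Proof. by move=> mD; have := @integrable0 _ _ _ mu D; apply: eq_integrable. Qed.

Lemma eq_itg D f g : measurable D -> (forall x, D x -> f x = g x) -> itg D f -> itg D g.
Proof. by move=> mD H; apply: (eq_integrable mD) => x /set_mem Dx /=; rewrite H. Qed.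

Lemma itg_sum D I (s : seq I) (h : I -> R -> R) : measurable D ->
  (forall i, itg D (h i)) -> itg D (fun x => \sum_(i <- s) h i x).
Proof.
move=> mD H; elim: s => [|i s IH].
  by apply: eq_itg (itg0 mD) => // x _; rewrite big_nil.
by apply: eq_itg (itgD mD (H i) IH) => // x _; rewrite big_cons.
Qed.

Lemma itg_norm D f : measurable D -> itg D f -> itg D (fun x => `|f x|).
Proof. by move=> mD fi; have := integrable_abse fi; apply: eq_integrable. Qed.

Lemma eq_Rint D f g : (forall x, D x -> f x = g x) ->
  \int[mu]_(x in D) f x = \int[mu]_(x in D) g x.
Proof. by move=> H; apply: eq_Rintegral => x /set_mem; apply: H. Qed.

Lemma Rint_sum D I (s : seq I) (h : I -> R -> R) : measurable D ->
  (forall i, itg D (h i)) ->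
  \int[mu]_(x in D) (\sum_(i <- s) h i x) = \sum_(i <- s) \int[mu]_(x in D) h i x.
Proof.
move=> mD H; elim: s => [|i s IH].
  by under eq_Rint do rewrite big_nil; rewrite Rintegral_cst // mul0r big_nil.
under eq_Rint do rewrite big_cons.
by rewrite RintegralD // ?big_cons ?IH //; exact: itg_sum.
Qed.

Lemma Rint_norm_le D f g : measurable D -> itg D f -> itg D g ->
  (forall x, D x -> `|f x| <= g x) -> `|\int[mu]_(x in D) f x| <= \int[mu]_(x in D) g x.
Proof.
move=> mD fi gi H; rewrite (le_trans (le_normr_Rintegral mD fi)) // le_Rintegral //.
exact: itg_norm.
Qed.

Lemma Rint_dct D (f_ : nat -> R -> R) f g : measurable D ->
  (forall n, measurable_fun D (f_ n)) -> measurable_fun D f -> itg D g ->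
  (forall x n, D x -> `|f_ n x| <= g x) ->
  (forall x, D x -> (fun n => f_ n x) @ \oo --> f x) ->
  (fun n => \int[mu]_(x in D) f_ n x) @ \oo --> \int[mu]_(x in D) f x.
Proof.
move=> mD mf_ mf gi H C.
have [] := @dominated_convergence _ _ R mu D mD (fun n => EFin \o f_ n) (EFin \o f) (EFin \o g).
- by move=> n; exact/measurable_EFinP.
- exact/measurable_EFinP.
- apply: aeW => x Dx; apply: cvg_EFin; [by near=> n|exact: C].
- exact: gi.
- by apply: aeW => x n Dx; rewrite lee_fin H.
move=> fi _ K; apply: fine_cvg; rewrite fineK //; exact: integrable_fin_num fi.
Unshelve. all: by end_near. Qed.

Lemma itg_cc f (a b : R) : {within `[a, b], continuous f} -> itg `[a, b] f.
Proof. by move=> cf; apply: continuous_compact_integrable => //; exact: segment_compact. Qed.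

Lemma Rint_FTC f F (a b : R) : a < b ->
  (forall x, a <= x <= b -> is_derive x (1:R) F (f x)) ->
  {within `[a, b], continuous f} -> \int[mu]_(x in `[a, b]) f x = F b - F a.
Proof.
move=> ab H cf; rewrite /Rintegral (@continuous_FTC2 _ f F) // -?EFinB //.
  have cF x : a <= x <= b -> {for x, continuous F}.
    by move=> /H[d _]; apply: differentiable_continuous; exact/derivable1_diffP.
  split.
  - by move=> x; rewrite in_itv /= => /andP[/ltW ? /ltW ?]; have [] := H x; first exact/andP.
  - by apply: cvg_at_right_filter; apply: cF; rewrite lexx ltW.
  - by apply: cvg_at_left_filter; apply: cF; rewrite lexx ltW.
move=> x; rewrite in_itv /= => /andP[/ltW ? /ltW ?]; rewrite derive1E.
by have [|_ ->] := H x; first exact/andP.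
Qed.

Lemma cvg_invn : (fun n : nat => n.+1%:R^-1 : R) @ \oo --> 0.
Proof. exact: cvg_harmonic. Qed.

Lemma indic_cvg (b x : R) : 0 < x <= b -> \forall n \near \oo, (\1_(`[b / n.+1%:R, b]) x : R) = 1.
Proof.
move=> /andP[x0 xb]; have b0 := lt_le_trans x0 xb.
have : (fun n : nat => b * n.+1%:R^-1 : R) @ \oo --> b * 0 by apply: cvgMr; exact: cvg_invn.
rewrite mulr0 => /cvgr_lt/(_ x x0); apply: filterS => n h.
by rewrite indicE mem_set //= in_itv /= xb andbT ltW.
Qed.

Lemma Rint_indic_sub (b : R) n f : 0 < b -> (forall x, 0 < x <= b -> {for x, continuous f}) ->
  \int[mu]_(x in `]0, b]) (\1_(`[b / n.+1%:R, b]) x * f x) = \int[mu]_(x in `[b / n.+1%:R, b]) f x.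
Proof.
move=> b0 cf; rewrite [LHS]Rintegral_mkcond [RHS]Rintegral_mkcond; apply: eq_Rintegral => x _.
rewrite !patchE indicE; case: ifPn; case: ifPn; rewrite ?mul1r ?mul0r //.
move=> /set_mem /= + /negP K; rewrite in_itv /= => /andP[h1 h2]; exfalso; apply: K; apply/mem_set.
by rewrite /= in_itv /= h2 andbT (lt_le_trans _ h1) // divr_gt0 // ltr0n.
Qed.

Lemma cont_meas (b : R) f : (forall x, 0 < x <= b -> {for x, continuous f}) ->
  measurable_fun (`]0, b] : set (measurableTypeR R)) f.
Proof.
move=> cf; apply: subspace_continuous_measurable_fun => //.
by apply: continuous_in_subspaceT => x /set_mem /=; rewrite in_itv /=; exact: cf.
Qed.

Lemma within_cc (b c : R) f : (forall x, 0 < x <= b -> {for x, continuous f}) -> 0 < c ->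
  {within `[c, b], continuous f}.
Proof.
move=> cf c0; apply: continuous_in_subspaceT => x /set_mem /=; rewrite in_itv /= => /andP[h1 h2].
by apply: cf; rewrite h2 (lt_le_trans c0).
Qed.

(** An integral improper at 0: the integrals over [b / (n + 1), b] converge to it by domination. *)
Lemma Rint_FTC0 f F (b l : R) : 0 < b ->
  (forall x, 0 < x <= b -> is_derive x (1:R) F (f x)) ->
  (forall x, 0 < x <= b -> {for x, continuous f}) ->
  itg `]0, b] f -> (fun n => F (b / n.+1%:R)) @ \oo --> l ->
  \int[mu]_(x in `]0, b]) f x = F b - l.
Proof.
move=> b0 dF cf fi Fl.
have bn n : 0 < b / n.+1%:R by rewrite divr_gt0 // ltr0n.
have K : (fun n => \int[mu]_(x in `]0, b]) (\1_(`[b / n.+1%:R, b]) x * f x)) @ \oo -->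
    \int[mu]_(x in `]0, b]) f x.
  apply: (@Rint_dct _ _ _ (fun x => `|f x|)) => //.
  - by move=> n; apply: measurable_funM; [exact: measurable_indic|exact: itg_meas fi].
  - exact: itg_meas fi.
  - exact: itg_norm.
  - by move=> x n _; rewrite indicE normrM; case: (_ \in _); rewrite ?normr1 ?mul1r // normr0 mul0r.
  - move=> x; rewrite /= in_itv /= => hx; apply: cvg_near_cst; near=> n.
    by rewrite (near (indic_cvg hx) n) ?mul1r.
(* The index n + 2 keeps the interval [b / (n + 2), b] nondegenerate, as [Rint_FTC] requires. *)
have K2 : (fun n => \int[mu]_(x in `]0, b]) (\1_(`[b / n.+2%:R, b]) x * f x)) @ \oo --> F b - l.
  have -> : (fun n => \int[mu]_(x in `]0, b]) (\1_(`[b / n.+2%:R, b]) x * f x)) = (fun n => F b - F (b / n.+2%:R)).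
    apply/funext => n; rewrite Rint_indic_sub //; apply: Rint_FTC.
    - by rewrite ltr_pdivrMr ?ltr0n // ltr_pMr // ltr1n.
    - by move=> x /andP[h1 h2]; apply: dF; rewrite h2 (lt_le_trans _ h1).
    - exact: within_cc.
  by apply: cvgB; [exact: cvg_cst|exact: (cvg_comp _ _ (cvg_addnl 1) Fl)].
apply: cvg_unique K2 => //.
exact: (cvg_comp _ _ (cvg_addnl 1) K).
Unshelve. all: by end_near. Qed.

(** A nonnegative function with a bounded primitive is integrable: by monotone convergence its
    integral is a limit of differences of F, each at most 2B. *)
Lemma itg_FTC0 f F (b B : R) : 0 < b ->
  (forall x, 0 < x <= b -> is_derive x (1:R) F (f x)) ->
  (forall x, 0 < x <= b -> {for x, continuous f}) ->
  (forall x, 0 < x <= b -> 0 <= f x) -> (forall x, 0 < x <= b -> `|F x| <= B) ->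
  itg `]0, b] f.
Proof.
move=> b0 dF cf f0 FB; apply/integrableP; split.
  by apply/measurable_EFinP; exact: cont_meas.
pose g n (x : measurableTypeR R) : \bar R := (\1_(`[b / n.+1%:R, b]) x * f x)%:E.
have bn n : 0 < b / n.+1%:R by rewrite divr_gt0 // ltr0n.
pose D : set (measurableTypeR R) := `]0, b]%classic.
have mg n : measurable_fun D (g n).
  by apply/measurable_EFinP; apply: measurable_funM; [exact: measurable_indic|exact: cont_meas].
have g0 n x : D x -> (0 <= g n x)%E.
  by rewrite /D /= in_itv /= => hx; rewrite lee_fin mulr_ge0 // f0.
have nd x : D x -> nondecreasing_seq (g ^~ x).
  rewrite /D /= in_itv /= => hx m n mn; rewrite lee_fin ler_wpM2r ?f0 //.
  rewrite !indicE ler_nat; case: (boolP (x \in `[b / m.+1%:R, b]%classic)) => //.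
  move=> /set_mem /=; rewrite in_itv /= => /andP[h1 h2].
  rewrite mem_set //= in_itv /= h2 andbT (le_trans _ h1) // ler_pM2l //.
  by rewrite lef_pV2 ?posrE ?ltr0n // ler_nat.
have mD : measurable D by exact: measurable_itv.
have C := @cvg_monotone_convergence _ _ R mu D mD g mg g0 nd.
apply: (@le_lt_trans _ _ (B + B)%:E); last by rewrite ltry.
have E : (\int[mu]_(x in `]0%R, b%R]) `|(EFin \o f) x| = \int[mu]_(x in D) (fun x : measurableTypeR R => limn (fun n => g n x)) x)%E.
  apply: eq_integral => x /set_mem /=; rewrite in_itv /= => hx; apply/esym/cvg_lim => //.
  rewrite ger0_norm ?f0 //; apply: cvg_EFin; first by near=> n.
  by apply: cvg_near_cst; near=> n; rewrite /= (near (indic_cvg hx) n) ?mul1r.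
rewrite E; apply: cvge_to_le (cvg_comp _ _ (cvg_addnl 1) C) _; near=> n.
have fin : itg `]0, b] (fun x => \1_(`[b / n.+2%:R, b]) x * f x).
  apply: (@eq_itg _ (f \_ `[b / n.+2%:R, b])) => //.
    by move=> x _; rewrite patchE indicE; case: ifPn; rewrite ?mul1r ?mul0r.
  rewrite -restrict_EFin; apply/integrable_restrict => //.
  have fi2 : itg `[b / n.+2%:R, b] f by apply: itg_cc; exact: within_cc.
  by apply: integrableS fi2 => //; try exact: measurableI; try exact: subIsetr.
have H : (\int[mu]_(x in D) g (1 + n)%N x)%E = (\int[mu]_(x in `]0, b]) (\1_(`[b / n.+2%:R, b]) x * f x))%R%:E.
  by rewrite /Rintegral fineK //; exact: integrable_fin_num fin.
rewrite -[X in (X <= _)%E]/(\int[mu]_(x in D) g (1 + n)%N x)%E H Rint_indic_sub //.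
have -> : \int[mu]_(x in `[b / n.+2%:R, b]) f x = F b - F (b / n.+2%:R).
  apply: Rint_FTC.
  - by rewrite ltr_pdivrMr ?ltr0n // ltr_pMr // ltr1n.
  - by move=> x /andP[h1 h2]; apply: dF; rewrite h2 (lt_le_trans _ h1).
  - exact: within_cc.
rewrite lee_fin (le_trans (ler_norm _)) // (le_trans (ler_normB _ _)) // lerD // FB ?bn ?b0 ?lexx //=.
by rewrite ler_pdivrMr ?ltr0n // ler_peMr ?ler1n // ltW.
Unshelve. all: by end_near. Qed.

(** By uniqueness of Lebesgue measure it is enough to compare half-open intervals. *)
Lemma scale_measure (c : R) : 0 < c -> forall A : set (measurableTypeR R), measurable A ->
  pushforward mu (fun x : measurableTypeR R => (c * x : measurableTypeR R)) A = (c^-1%:E * mu A)%E.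
Proof.
move=> c0 A mA.
pose c' : {nonneg R} := NngNum (ltW c0).
have H : mu A = mscale c' (pushforward mu (fun x : measurableTypeR R => (c * x : measurableTypeR R))) A.
  move=> mc; apply: lebesgue_measure_unique => //= ? [[a b]] _ <-.
  rewrite /mscale /= /pushforward.
  have -> : (fun x : measurableTypeR R => (c * x : measurableTypeR R)) @^-1` `]a, b]%classic = `](a / c), (b / c)]%classic.
    by apply/seteqP; split => x /=; rewrite !in_itv /= ltr_pdivrMr // ler_pdivlMr // mulrC.
  rewrite !lebesgue_measure_itv /= !lte_fin ltr_pM2r ?invr_gt0 //.
  case: ifP => _; last by rewrite mule0.
  by rewrite -!EFinB -EFinM -mulrBl mulrC divfK // gt_eqF.
have mc : measurable_fun setT (fun x : measurableTypeR R => (c * x : measurableTypeR R)) by exact: mulrl_measurable.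
rewrite (H mc) /mscale /= muleA -EFinM mulVf ?gt_eqF // mul1e //.
Qed.

Lemma ge0_scale (c : R) (D : set (measurableTypeR R)) (g : measurableTypeR R -> \bar R) : 0 < c ->
  measurable D -> measurable_fun setT g -> (forall x, 0 <= g x)%E ->
  (\int[mu]_(x in (fun x : measurableTypeR R => ((c * x)%R : measurableTypeR R)) @^-1` D) g (c * x)%R =
   (c^-1)%R%:E * \int[mu]_(x in D) g x)%E.
Proof.
move=> c0 mD mg g0.
have mc : measurable_fun setT (fun x : measurableTypeR R => (c * x : measurableTypeR R)) by exact: mulrl_measurable.
have c1 : 0 <= c^-1 by rewrite invr_ge0 ltW.
have := @ge0_integral_pushforward _ _ _ _ R _ mc mu D g mD (measurable_funTS mg) (fun x _ => g0 x).
rewrite /comp => <-.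
transitivity (\int[mscale (NngNum c1) mu]_(x in D) g x)%E.
  by apply: eq_measure_integral => A mA _; exact: scale_measure.
by rewrite ge0_integral_mscale //; exact: measurable_funTS.
Qed.

Lemma preimage_scale (c b : R) : 0 < c ->
  (fun x : measurableTypeR R => (c * x : measurableTypeR R)) @^-1` (`]0, b]%classic : set (measurableTypeR R)) =
  `]0, b / c]%classic.
Proof.
by move=> c0; apply/seteqP; split => x /=; rewrite !in_itv /= ler_pdivlMr // (mulrC x) pmulr_rgt0.
Qed.

(** Change of variable for the positive and the negative part; integrability is transferred from the
    scaled side. *)
Lemma scale_eq (c b : R) f : 0 < c ->
  measurable_fun (setT : set (measurableTypeR R)) f -> itg `]0, b / c] (fun x => f (c * x)) ->
  itg `]0, b] f /\ \int[mu]_(x in `]0, b]) f x = c * \int[mu]_(x in `]0, b / c]) f (c * x).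
Proof.
move=> c0 mf fi; pose D : set (measurableTypeR R) := `]0, b]%classic.
have mD : measurable D by exact: measurable_itv.
have mfE : measurable_fun (setT : set (measurableTypeR R)) (EFin \o f) by exact/measurable_EFinP.
have K (g : measurableTypeR R -> \bar R) : measurable_fun setT g -> (forall x, 0 <= g x)%E ->
  (\int[mu]_(x in D) g x = c%:E * \int[mu]_(x in `]0%R, (b / c)%R]) g (c * x)%R)%E.
  move=> mg g0; rewrite -(preimage_scale b c0) ge0_scale // muleA -EFinM divff ?gt_eqF // mul1e //.
have fi' : itg D f.
  apply/integrableP; split; first exact: measurable_funTS.
  have /integrableP[_ h] := fi.
  by rewrite (K (fun x => `|(EFin \o f) x|)%E) ?lte_mul_pinfty // ?lee_fin ?(ltW c0) //; exact: measurableT_comp.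
split => //.
rewrite /Rintegral integralE.
rewrite (K (EFin \o f)^\+%E); [|exact: measurable_funepos|by []].
rewrite (K (EFin \o f)^\-%E); [|exact: measurable_funeneg|by []].
rewrite [in RHS]integralE.
have mI : measurable (`]0, b / c]%classic : set (measurableTypeR R)) by exact: measurable_itv.
have f1 := integrable_pos_fin_num mI fi.
have f2 := integrable_neg_fin_num mI fi.
set P := (\int[_]_(x in _) _)%E in f1; set N := (\int[_]_(x in _) _)%E in f2.
have EP : (\int[mu]_(x in `]0%R, (b / c)%R]) (EFin \o f)^\+ (c * x)%R)%E = P.
  by apply: eq_integral => x _; rewrite !funeposE.
have EN : (\int[mu]_(x in `]0%R, (b / c)%R]) (EFin \o f)^\- (c * x)%R)%E = N.
  by apply: eq_integral => x _; rewrite !funenegE.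
rewrite EP EN.
transitivity (c * fine (P - N)%E); last reflexivity.
by clear EP EN; clearbody P N; move: P N f1 f2 => [P| |] [N| |] //= _ _; rewrite mulrBr.
Qed.
End Rint.

(** * Complex powers of positive real numbers *)

Section Cexp.
Variable R : realType.
Local Notation C := R[i].
Local Notation nc := (@normc R).
Local Notation Re := (@complex.Re R).
Local Notation Im := (@complex.Im R).
Implicit Types (s z w : C) (x y : R).

Definition cexp z : C := Complex (expR (Re z) * cos (Im z)) (expR (Re z) * sin (Im z)).

Lemma cReD z w : Re (z + w) = Re z + Re w. Proof. by case: z; case: w. Qed.
Lemma cImD z w : Im (z + w) = Im z + Im w. Proof. by case: z; case: w. Qed.
Lemma cReN z : Re (- z) = - Re z. Proof. by case: z. Qed.
Lemma cImN z : Im (- z) = - Im z. Proof. by case: z. Qed.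
Lemma cReM z w : Re (z * w) = Re z * Re w - Im z * Im w. Proof. by case: z; case: w. Qed.
Lemma cImM z w : Im (z * w) = Re z * Im w + Im z * Re w. Proof. by case: z => a b; case: w => c d /=; ring. Qed.
Lemma Re_real x : Re x%:C = x. Proof. by []. Qed.
Lemma Im_real x : Im x%:C = 0. Proof. by []. Qed.
Lemma complex_eq z w : Re z = Re w -> Im z = Im w -> z = w.
Proof. by case: z; case: w => a b c d /= -> ->. Qed.

Lemma cexpD z w : cexp (z + w) = cexp z * cexp w.
Proof.
apply: complex_eq; rewrite ?cReM ?cImM /= cReD cImD expRD ?cosD ?sinD; ring.
Qed.

Lemma cexp0 : cexp 0 = 1.
Proof. by apply: complex_eq; rewrite /= expR0 ?cos0 ?sin0 mul1r. Qed.

Lemma nc_cexp z : nc (cexp z) = expR (Re z).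
Proof.
rewrite /= !exprMn -mulrDr cos2Dsin2 mulr1 sqrtr_sqr ger0_norm // expR_ge0.
Qed.

Lemma cexp_real x : cexp x%:C = (expR x)%:C.
Proof. by apply: complex_eq; rewrite /= ?cos0 ?sin0 ?mulr1 ?mulr0. Qed.

Definition cpow x s : C := cexp (s * (ln x)%:C).

Lemma cpowD x s (t : C) : cpow x (s + t) = cpow x s * cpow x t.
Proof. by rewrite /cpow mulrDl cexpD. Qed.

Lemma cpow_real x (a : R) : 0 < x -> cpow x a%:C = (x `^ a)%:C.
Proof. by move=> x0; rewrite /cpow -rmorphM cexp_real /powR gt_eqF. Qed.

Lemma cpow_nat x n : 0 < x -> cpow x n%:R = (x ^+ n)%:C.
Proof.
by move=> x0; rewrite (_ : n%:R = n%:R%:C) ?cpow_real ?powR_mulrn ?ltW // rmorph_nat.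
Qed.

Lemma cpow1n s : cpow 1 s = 1.
Proof. by rewrite /cpow ln1 mulr0 cexp0. Qed.

Lemma cpowN1 x s : 0 < x -> cpow x (s - 1) = cpow x s * (x^-1)%:C.
Proof.
move=> x0; rewrite cpowD; congr (_ * _).
by rewrite (_ : -1 = (- 1)%:C) ?cpow_real // ?powR_inv1 ?ltW // rmorphN rmorph1.
Qed.

Lemma cpow1s x s : 0 < x -> x%:C * cpow x (s - 1) = cpow x s.
Proof. by move=> x0; rewrite cpowN1 // mulrCA -rmorphM divff ?gt_eqF // rmorph1 mulr1. Qed.

Lemma cpowM x y s : 0 < x -> 0 < y -> cpow (x * y) s = cpow x s * cpow y s.
Proof. by move=> x0 y0; rewrite /cpow lnM ?posrE // rmorphD mulrDr cexpD. Qed.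

Lemma nc_cpow x s : 0 < x -> nc (cpow x s) = x `^ Re s.
Proof. by move=> x0; rewrite nc_cexp cReM Re_real Im_real mulr0 subr0 /powR gt_eqF. Qed.

Definition cderiv (F : R -> C) (x : R) (f : C) : Prop :=
  is_derive x (1:R) (fun t : R => Re (F t)) (Re f) /\ is_derive x (1:R) (fun t : R => Im (F t)) (Im f).

Lemma cderiv_eq (F : R -> C) x f g : cderiv F x f -> f = g -> cderiv F x g.
Proof. by move=> ? <-. Qed.

Lemma cderivM (F G : R -> C) x f g : cderiv F x f -> cderiv G x g ->
  cderiv (fun t => F t * G t) x (f * G x + F x * g).
Proof.
move=> [F1 F2] [G1 G2]; split.
  rewrite (_ : (fun t => _) = (fun t => Re (F t) * Re (G t) - Im (F t) * Im (G t))); last first.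
    by apply/funext => t; rewrite cReM.
  by apply: is_derive_eq (dvB (dvM F1 G1) (dvM F2 G2)) _; rewrite cReD !cReM; ring.
rewrite (_ : (fun t => _) = (fun t => Re (F t) * Im (G t) + Im (F t) * Re (G t))); last first.
  by apply/funext => t; rewrite cImM.
by apply: is_derive_eq (dvD (dvM F1 G2) (dvM F2 G1)) _; rewrite cImD !cImM; ring.
Qed.

Lemma cderivD (F G : R -> C) x f g : cderiv F x f -> cderiv G x g ->
  cderiv (fun t => F t + G t) x (f + g).
Proof.
move=> [F1 F2] [G1 G2]; split.
  rewrite (_ : (fun t => _) = (fun t => Re (F t) + Re (G t))); last by apply/funext => t; rewrite cReD.
  by rewrite cReD; exact: dvD.
rewrite (_ : (fun t => _) = (fun t => Im (F t) + Im (G t))); last by apply/funext => t; rewrite cImD.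
by rewrite cImD; exact: dvD.
Qed.

Lemma cderiv_cst (c : C) x : cderiv (fun=> c) x 0.
Proof. by split; exact: dvcst. Qed.

Lemma cderivZ (c : C) (F : R -> C) x f : cderiv F x f -> cderiv (fun t => c * F t) x (c * f).
Proof. by move=> dF; apply: cderiv_eq (cderivM (cderiv_cst c x) dF) _; rewrite mul0r add0r. Qed.

Lemma cderiv_real (h : R -> R) x (a : R) : is_derive x (1:R) h a -> cderiv (fun t => (h t)%:C) x a%:C.
Proof. by move=> dh; split => //=; exact: dvcst. Qed.

Lemma cderiv_cexp (h : R -> R) s x (a : R) : is_derive x (1:R) h a ->
  cderiv (fun t => cexp (s * (h t)%:C)) x (s * a%:C * cexp (s * (h x)%:C)).
Proof.
move=> dh; have K (b : R) : is_derive x (1:R) (fun t => b * h t) (b * a) by exact: dvZ.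
have dE : is_derive x (1:R) (fun t => expR (Re s * h t)) (expR (Re s * h x) * (Re s * a)).
  by apply: dvcomp (K _).
have dC : is_derive x (1:R) (fun t => cos (Im s * h t)) (- sin (Im s * h x) * (Im s * a)).
  by apply: dvcomp (K _).
have dS : is_derive x (1:R) (fun t => sin (Im s * h t)) (cos (Im s * h x) * (Im s * a)).
  by apply: dvcomp (K _).
have E1 y : Re (s * y%:C) = Re s * y by rewrite cReM Re_real Im_real mulr0 subr0.
have E2 y : Im (s * y%:C) = Im s * y by rewrite cImM Re_real Im_real mulr0 add0r.
have Ec : cexp (s * (h x)%:C) = Complex (expR (Re s * h x) * cos (Im s * h x)) (expR (Re s * h x) * sin (Im s * h x)).
  by rewrite /cexp E1 E2.
rewrite Ec; split => /=.
  under eq_fun do rewrite E1 E2.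
  by apply: is_derive_eq (dvM dE dC) _; rewrite cReM E1 E2 /=; ring.
under eq_fun do rewrite E1 E2.
by apply: is_derive_eq (dvM dE dS) _; rewrite cImM E1 E2 /=; ring.
Qed.

Lemma cderiv_cpow x s : 0 < x -> cderiv (fun t => cpow t s) x (s * cpow x (s - 1)).
Proof.
move=> x0; apply: cderiv_eq (cderiv_cexp s (is_derive1_ln x0)) _.
by rewrite cpowN1 // /cpow mulrAC mulrA.
Qed.

End Cexp.

(** * Complex-valued integrals on the real line *)

Section Cint.
Variable R : realType.
Local Notation C := R[i].
Local Notation nc := (@normc R).
Local Notation Re := (@complex.Re R).
Local Notation Im := (@complex.Im R).
Local Notation mu := (@lebesgue_measure R).
Local Notation itg D f := (mu.-integrable D (EFin \o f)).
Implicit Types (D : set (measurableTypeR R)) (f g : R -> C) (h : R -> R).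

Definition Cint D f : C := Complex (\int[mu]_(x in D) Re (f x)) (\int[mu]_(x in D) Im (f x)).
Definition citg D f : Prop := itg D (fun x => Re (f x)) /\ itg D (fun x => Im (f x)).
Definition cmeas D f : Prop := measurable_fun D (fun x => Re (f x)) /\ measurable_fun D (fun x => Im (f x)).

Lemma eq_Cint D f g : (forall x, D x -> f x = g x) -> Cint D f = Cint D g.
Proof. by move=> H; congr Complex; apply: eq_Rint => x /H ->. Qed.

Lemma eq_citg D f g : measurable D -> (forall x, D x -> f x = g x) -> citg D f -> citg D g.
Proof. by move=> mD H [f1 f2]; split; [apply: eq_itg f1|apply: eq_itg f2] => // x /H ->. Qed.

Lemma citg_le D f h : measurable D -> cmeas D f -> itg D h ->
  (forall x, D x -> nc (f x) <= h x) -> citg D f.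
Proof.
move=> mD [m1 m2] ih H; split; apply: (@itg_le _ _ _ h) => // x Dx.
  exact: le_trans (nc_Re _) (H _ Dx).
exact: le_trans (nc_Im _) (H _ Dx).
Qed.

(** The factor 2 comes from estimating the real and the imaginary part separately. *)
Lemma Cint_le D f h : measurable D -> citg D f -> itg D h ->
  (forall x, D x -> nc (f x) <= h x) -> nc (Cint D f) <= 2 * \int[mu]_(x in D) h x.
Proof.
move=> mD [f1 f2] ih H; rewrite (le_trans (nc_le_ReIm _)) // mulrDl mul1r lerD //;
  apply: Rint_norm_le => // x Dx; apply: le_trans (H _ Dx).
  exact: nc_Re.
exact: nc_Im.
Qed.

Lemma citgD D f g : measurable D -> citg D f -> citg D g -> citg D (fun x => f x + g x).
Proof.
move=> mD [f1 f2] [g1 g2]; split.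
  by apply: eq_itg (itgD mD f1 g1) => // x _; rewrite cReD.
by apply: eq_itg (itgD mD f2 g2) => // x _; rewrite cImD.
Qed.

Lemma CintD D f g : measurable D -> citg D f -> citg D g ->
  Cint D (fun x => f x + g x) = Cint D f + Cint D g.
Proof.
move=> mD [f1 f2] [g1 g2]; apply: complex_eq; rewrite ?cReD ?cImD /= -RintegralD //;
  by apply: eq_Rint => x _; rewrite ?cReD ?cImD.
Qed.

Lemma citgZ D (c : C) f : measurable D -> citg D f -> citg D (fun x => c * f x).
Proof.
move=> mD [f1 f2]; split.
  by apply: eq_itg (itgB mD (itgZ (Re c) mD f1) (itgZ (Im c) mD f2)) => // x _; rewrite cReM.
by apply: eq_itg (itgD mD (itgZ (Re c) mD f2) (itgZ (Im c) mD f1)) => // x _; rewrite cImM.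
Qed.

Lemma CintZ D (c : C) f : measurable D -> citg D f -> Cint D (fun x => c * f x) = c * Cint D f.
Proof.
move=> mD [f1 f2]; apply: complex_eq; rewrite ?cReM ?cImM /= -!RintegralZl //.
  by rewrite -RintegralB //; [apply: eq_Rint => x _; rewrite cReM|exact: itgZ|exact: itgZ].
by rewrite -RintegralD //; [apply: eq_Rint => x _; rewrite cImM|exact: itgZ|exact: itgZ].
Qed.

Lemma citgB D f g : measurable D -> citg D f -> citg D g -> citg D (fun x => f x - g x).
Proof.
move=> mD fi gi; apply: eq_citg (citgD mD fi (citgZ (-1) mD gi)) => // x _.
by rewrite mulN1r.
Qed.

Lemma CintB D f g : measurable D -> citg D f -> citg D g ->
  Cint D (fun x => f x - g x) = Cint D f - Cint D g.
Proof.
move=> mD fi gi; rewrite -mulN1r -CintZ // -CintD //; last exact: citgZ.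
by apply: eq_Cint => x _; rewrite mulN1r.
Qed.

Lemma citg_sum D I (s : seq I) (F : I -> R -> C) : measurable D ->
  (forall i, citg D (F i)) -> citg D (fun x => \sum_(i <- s) F i x).
Proof.
move=> mD H; split.
  by apply: eq_itg (itg_sum s mD (fun i => (H i).1)) => // x _; rewrite raddf_sum.
by apply: eq_itg (itg_sum s mD (fun i => (H i).2)) => // x _; rewrite raddf_sum.
Qed.

Lemma Cint_sum D I (s : seq I) (F : I -> R -> C) : measurable D ->
  (forall i, citg D (F i)) -> Cint D (fun x => \sum_(i <- s) F i x) = \sum_(i <- s) Cint D (F i).
Proof.
move=> mD H; apply: complex_eq; rewrite raddf_sum /=.
  by rewrite -Rint_sum //; [apply: eq_Rint => x _; rewrite raddf_sum|move=> i; exact: (H i).1].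
by rewrite -Rint_sum //; [apply: eq_Rint => x _; rewrite raddf_sum|move=> i; exact: (H i).2].
Qed.

Lemma cmeasM D f g : cmeas D f -> cmeas D g -> cmeas D (fun x => f x * g x).
Proof.
move=> [f1 f2] [g1 g2]; split.
  under eq_fun do rewrite cReM.
  by apply: measurable_funB; apply: measurable_funM.
under eq_fun do rewrite cImM.
by apply: measurable_funD; apply: measurable_funM.
Qed.

Lemma cmeas_real D h : measurable_fun D h -> cmeas D (fun x => (h x)%:C).
Proof. by move=> mh; split => //=; exact: measurable_cst. Qed.

Lemma cmeas_cst D (c : C) : cmeas D (fun=> c).
Proof. by split; exact: measurable_cst. Qed.

Lemma cmeas_cexp D f : measurable D -> cmeas D f -> cmeas D (fun x => cexp (f x)).
Proof.
move=> mD [f1 f2]; split => /=; apply: measurable_funM.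
- exact: measurableT_comp.
- by apply: measurableT_comp f2; exact: continuous_measurable_fun (@continuous_cos R).
- exact: measurableT_comp.
- by apply: measurableT_comp f2; exact: continuous_measurable_fun (@continuous_sin R).
Qed.

Lemma cmeas_cpow D (s : C) : measurable D -> cmeas D (fun x => cpow x s).
Proof.
move=> mD; apply: cmeas_cexp => //; apply: cmeasM; first exact: cmeas_cst.
by apply: cmeas_real; apply: measurable_funTS; exact: measurable_ln.
Qed.

Lemma Cint_FTC f (F : R -> C) (a b : R) : a < b ->
  (forall x, a <= x <= b -> cderiv F x (f x)) ->
  {within `[a, b], continuous (fun x => Re (f x))} -> {within `[a, b], continuous (fun x => Im (f x))} ->
  Cint `[a, b] f = F b - F a.
Proof.
move=> ab dF c1 c2; apply: complex_eq; rewrite ?cReD ?cImD ?cReN ?cImN /=.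
  by apply: (@Rint_FTC _ _ (fun x => Re (F x))) => // x /dF [].
by apply: (@Rint_FTC _ _ (fun x => Im (F x))) => // x /dF [].
Qed.

Lemma Cint_FTC0 f (F : R -> C) (b : R) (l : C) : 0 < b ->
  (forall x, 0 < x <= b -> cderiv F x (f x)) ->
  (forall x, 0 < x <= b -> {for x, continuous (fun x => Re (f x))}) ->
  (forall x, 0 < x <= b -> {for x, continuous (fun x => Im (f x))}) ->
  citg `]0, b] f -> (fun n => nc (F (b / n.+1%:R) - l)) @ \oo --> (0 : R) ->
  Cint `]0, b] f = F b - l.
Proof.
move=> b0 dF c1 c2 [f1 f2] Fl; have K (u : nat -> R) (v : R) :
    (forall n, `|u n - v| <= nc (F (b / n.+1%:R) - l)) -> u @ \oo --> v.
  move=> H; apply: cvg_zero; apply/norm_cvg0P; apply: squeeze_cvgr (cvg_cst _) Fl.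
  by near=> n; rewrite normr_ge0 /=; exact: H.
apply: complex_eq; rewrite ?cReD ?cImD ?cReN ?cImN /=.
  apply: (@Rint_FTC0 _ _ (fun x => Re (F x))) => //; first by move=> x /dF [].
  by apply: K => n; rewrite -cReN -cReD nc_Re.
apply: (@Rint_FTC0 _ _ (fun x => Im (F x))) => //; first by move=> x /dF [].
by apply: K => n; rewrite -cImN -cImD nc_Im.
Unshelve. all: by end_near. Qed.

Lemma citg_cc f (a b : R) : {within `[a, b], continuous (fun x => Re (f x))} ->
  {within `[a, b], continuous (fun x => Im (f x))} -> citg `[a, b] f.
Proof. by move=> c1 c2; split; exact: itg_cc. Qed.

Lemma cpow_cont (s : C) x : 0 < x -> {for x, continuous (fun x => Re (cpow x s))} /\
  {for x, continuous (fun x => Im (cpow x s))}.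
Proof.
move=> x0; have [[d1 _] [d2 _]] := cderiv_cpow s x0; split.
  by move/derivable1_diffP: d1; exact: differentiable_continuous.
by move/derivable1_diffP: d2; exact: differentiable_continuous.
Qed.

Lemma cvg0M (c : R) (u : nat -> R) : u @ \oo --> (0:R) -> (fun n => c * u n) @ \oo --> (0:R).
Proof. by move=> h; rewrite -(mulr0 c); apply: cvgMr. Qed.

Lemma cvg_powR_seq (a b : R) : 0 < a -> 0 < b -> (fun n : nat => (b / n.+1%:R) `^ a) @ \oo --> (0:R).
Proof.
move=> a0 b0.
have : (fun n : nat => b * n.+1%:R^-1 : R) @ \oo --> b * 0 by apply: cvgMr; exact: cvg_invn.
rewrite mulr0 => H.
apply/cvgrPdist_lt => e e0; have : 0 < e `^ a^-1 by rewrite powR_gt0.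
move=> /(cvgr_lt _ H); apply: filterS => n h; rewrite sub0r normrN ger0_norm ?powR_ge0 //.
have := gt0_ltr_powR a0 _ _ h; rewrite -powRrM mulVf ?gt_eqF // powRr1 ?ltW //; apply.
  by rewrite nnegrE divr_ge0 // ltW.
by rewrite nnegrE powR_ge0.
Qed.

Lemma powR_cont (r x : R) : 0 < x -> {for x, continuous (fun t : R => t `^ r)}.
Proof.
move=> x0; have d := is_derive1_powR r x0.
by apply: differentiable_continuous; apply/derivable1_diffP; exact: ex_derive.
Qed.

Lemma powR_prim (a x : R) : -1 < a -> 0 < x ->
  is_derive x (1:R) (fun t => (a + 1)^-1 * t `^ (a + 1)) (x `^ a).
Proof.
move=> a1 x0; have a0 : 0 < a + 1 by rewrite -ltrBlDr sub0r.
apply: is_derive_eq (dvZ _ (is_derive1_powR (a + 1) x0)) _.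
by rewrite mulrA mulVf ?gt_eqF // mul1r addrK.
Qed.

Lemma itg_powR (a b : R) : -1 < a -> 0 < b -> itg `]0, b] (fun x => x `^ a).
Proof.
move=> a1 b0; have a0 : 0 < a + 1 by rewrite -ltrBlDr sub0r.
apply: (itg_FTC0 (B := (a + 1)^-1 * b `^ (a + 1)) b0 (F := fun x => (a + 1)^-1 * x `^ (a + 1))).
- by move=> x /andP[x0 _]; exact: powR_prim.
- by move=> x /andP[x0 _]; exact: powR_cont.
- by move=> x _; rewrite powR_ge0.
- move=> x /andP[x0 xb]; rewrite ger0_norm ?mulr_ge0 ?invr_ge0 ?powR_ge0 ?(ltW a0) //.
  by rewrite ler_wpM2l ?invr_ge0 ?(ltW a0) // ge0_ler_powR ?nnegrE ?(ltW a0) ?(ltW x0) ?(ltW b0).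
Qed.

Lemma Rint_powR (a b : R) : -1 < a -> 0 < b ->
  \int[mu]_(x in `]0, b]) x `^ a = b `^ (a + 1) / (a + 1).
Proof.
move=> a1 b0; have a0 : 0 < a + 1 by rewrite -ltrBlDr sub0r.
rewrite mulrC -[RHS]subr0.
apply: (Rint_FTC0 b0 (F := fun x => (a + 1)^-1 * x `^ (a + 1))).
- by move=> x /andP[x0 _]; exact: powR_prim.
- by move=> x /andP[x0 _]; exact: powR_cont.
- exact: itg_powR.
- by rewrite -(mulr0 (a + 1)^-1); apply: cvgMr; exact: cvg_powR_seq.
Qed.

End Cint.

(** * Mellin transforms and the zeta function *)

Section Mellin.
Variable R : realType.
Local Notation C := R[i].
Local Notation nc := (@normc R).
Local Notation Re := (@complex.Re R).
Local Notation Im := (@complex.Im R).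
Local Notation mu := (@lebesgue_measure R).
Local Notation itg D f := (mu.-integrable D (EFin \o f)).
Local Notation mT f := (measurable_fun (setT : set (measurableTypeR R)) f).
Implicit Types (s z w : C) (x y : R) (a b : R -> R).

Definition I01 : set (measurableTypeR R) := `]0, 1]%classic.
Lemma mI01 : measurable I01. Proof. exact: measurable_itv. Qed.

Lemma in_I01 x : I01 x -> 0 < x <= 1. Proof. by rewrite /I01 /= in_itv. Qed.

Lemma pwD x (r t : R) : 0 < x -> x `^ (r + t) = x `^ r * x `^ t.
Proof. by move=> x0; rewrite powRD // (gt_eqF x0) implybT. Qed.

Lemma pwN1 x : 0 < x -> x `^ (-1) = x^-1.
Proof. by move=> x0; rewrite powR_inv1 // ltW. Qed.

(** The integral stops at 1 because [M1i] and lambda vanish beyond 1, and functions of the Beurling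
    space are multiples of 1/x there. *)
Definition Mel a s : C := Cint I01 (fun x => (a x)%:C * cpow x (s - 1)).

Lemma cmeas_mel a s : measurable_fun I01 a -> cmeas I01 (fun x => (a x)%:C * cpow x (s - 1)).
Proof. by move=> ma; apply: cmeasM; [exact: cmeas_real|apply: cmeas_cpow; exact: mI01]. Qed.

Lemma mel_bound a s (A k : R) x : 0 < x -> `|a x| <= A * x `^ (- k) ->
  nc ((a x)%:C * cpow x (s - 1)) <= A * x `^ (Re s - 1 - k).
Proof.
move=> x0 H; rewrite normcM nc_real nc_cpow // cReD cReN /=.
rewrite (_ : Re s - 1 - k = - k + (Re s - 1)); last ring.
by rewrite (pwD (- k) (Re s - 1) x0) mulrA ler_wpM2r ?powR_ge0.
Qed.

Lemma itg_pw (A r : R) : -1 < r -> itg I01 (fun x => A * x `^ r).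
Proof. by move=> r1; apply: itgZ; [exact: mI01|exact: itg_powR]. Qed.

Lemma mel_itg a s (A k : R) : measurable_fun I01 a -> k < Re s ->
  (forall x, 0 < x <= 1 -> `|a x| <= A * x `^ (- k)) ->
  citg I01 (fun x => (a x)%:C * cpow x (s - 1)).
Proof.
move=> ma ks H; apply: (@citg_le _ _ _ (fun x => A * x `^ (Re s - 1 - k))).
- exact: mI01.
- exact: cmeas_mel.
- by apply: itg_pw; lra.
- by move=> x /in_I01 hx; apply: mel_bound; [case/andP: hx|exact: H].
Qed.

Lemma mel_le a s (A k : R) : measurable_fun I01 a -> k < Re s ->
  (forall x, 0 < x <= 1 -> `|a x| <= A * x `^ (- k)) ->
  nc (Mel a s) <= 2 * (A / (Re s - k)).
Proof.
move=> ma ks H; have := @Cint_le _ I01 _ (fun x => A * x `^ (Re s - 1 - k)) mI01 (mel_itg ma ks H).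
have r1 : -1 < Re s - 1 - k by lra.
move=> /(_ (itg_pw _ r1)) K; apply: (le_trans (K _)).
  by move=> x /in_I01 hx; apply: mel_bound; [case/andP: hx|exact: H].
rewrite RintegralZl; [|exact: mI01|exact: itg_powR].
by rewrite Rint_powR // powR1 (_ : Re s - 1 - k + 1 = Re s - k) ?mul1r //; ring.
Qed.

(** Dominated convergence for sequences that are eventually constant at each point, as sums of
    dilates truncated at N are. *)
Lemma mel_dct (a_ : nat -> R -> R) a s (A k : R) : (forall n, measurable_fun I01 (a_ n)) ->
  measurable_fun I01 a -> k < Re s ->
  (forall n x, 0 < x <= 1 -> `|a_ n x| <= A * x `^ (- k)) ->
  (forall x, 0 < x <= 1 -> \forall n \near \oo, a_ n x = a x) ->
  (fun n => nc (Mel (a_ n) s - Mel a s)) @ \oo --> (0 : R).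
Proof.
move=> ma_ ma ks H E.
have Ha x : 0 < x <= 1 -> `|a x| <= A * x `^ (- k).
  move=> hx; have [n _ Hn] := E x hx; rewrite -(Hn n) ?H //=.
have K (h : C -> R) : (forall z, `|h z| <= nc z) ->
   (forall n, measurable_fun I01 (fun x => h ((a_ n x)%:C * cpow x (s - 1)))) ->
   measurable_fun I01 (fun x => h ((a x)%:C * cpow x (s - 1))) ->
  (fun n => \int[mu]_(x in I01) h ((a_ n x)%:C * cpow x (s - 1))) @ \oo -->
   \int[mu]_(x in I01) h ((a x)%:C * cpow x (s - 1)).
  move=> hn m1 m2; apply: (@Rint_dct _ _ _ _ (fun x => A * x `^ (Re s - 1 - k))) => //.
  - exact: mI01.
  - by apply: itg_pw; lra.
  - by move=> x n /in_I01 hx; apply: (le_trans (hn _)); apply: mel_bound; [case/andP: hx|exact: H].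
  - by move=> x /in_I01 hx; apply: cvg_near_cst; near=> n; rewrite (near (E x hx) n).
have C1 := K Re (@nc_Re _) (fun n => (cmeas_mel s (ma_ n)).1) (cmeas_mel s ma).1.
have C2 := K Im (@nc_Im _) (fun n => (cmeas_mel s (ma_ n)).2) (cmeas_mel s ma).2.
have C3 : (fun n => `|Re (Mel (a_ n) s) - Re (Mel a s)| + `|Im (Mel (a_ n) s) - Im (Mel a s)|) @ \oo --> (0 + 0 : R).
  apply: cvgD; apply/norm_cvg0P.
    by rewrite -(subrr (Re (Mel a s))); apply: cvgB; [exact: C1|exact: cvg_cst].
  by rewrite -(subrr (Im (Mel a s))); apply: cvgB; [exact: C2|exact: cvg_cst].
rewrite addr0 in C3; apply: squeeze_cvgr (cvg_cst _) C3; near=> n.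
by apply/andP; split; [exact: nc_ge0|rewrite (le_trans (nc_le_ReIm _)) // !cReD !cReN !cImD !cImN].
Unshelve. all: by end_near. Qed.

Lemma in_oc (t x : R) : (`]0, t]%classic : set (measurableTypeR R)) x -> 0 < x <= t.
Proof. by rewrite /= in_itv. Qed.

Lemma itg_cpow (t : R) s : 0 < t -> 0 < Re s -> citg `]0, t] (fun x => cpow x (s - 1)).
Proof.
move=> t0 s0; apply: (@citg_le _ _ _ (fun x => x `^ (Re s - 1))) => //.
- exact: cmeas_cpow.
- by apply: itg_powR => //; lra.
- by move=> x /in_oc/andP[x0 _]; rewrite nc_cpow // cReD cReN.
Qed.

Lemma Re_neq0 s (k : R) : k < Re s -> s - k%:C != 0.
Proof. by apply: contraTneq => /eqP; rewrite subr_eq0 => /eqP ->; rewrite ltxx. Qed.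

Lemma Cint_cpow0 (t : R) s : 0 < t -> 0 < Re s -> Cint `]0, t] (fun x => cpow x (s - 1)) = cpow t s / s.
Proof.
move=> t0 s0; have sn0 : s != 0 by have := Re_neq0 s0; rewrite subr0.
rewrite -[RHS]subr0 [cpow t s / s]mulrC; apply: (@Cint_FTC0 _ _ (fun x => s^-1 * cpow x s)) => //.
- move=> x /andP[x0 _]; apply: cderiv_eq (cderivZ s^-1 (cderiv_cpow s x0)) _.
  by rewrite mulKf.
- by move=> x /andP[x0 _]; have [] := cpow_cont (s - 1) x0.
- by move=> x /andP[x0 _]; have [] := cpow_cont (s - 1) x0.
- exact: itg_cpow.
have -> : (fun n : nat => nc (s^-1 * cpow (t / n.+1%:R) s - 0)) = (fun n => nc s^-1 * (t / n.+1%:R) `^ Re s).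
  by apply/funext => n; rewrite subr0 normcM nc_cpow // divr_gt0 // ltr0n.
by apply: cvg0M; exact: cvg_powR_seq.
Qed.

Lemma mel_cst1 s : 0 < Re s -> Mel (fun=> 1) s = s^-1.
Proof.
move=> s0; transitivity (cpow 1 s / s); last by rewrite cpow1n mul1r.
rewrite -Cint_cpow0 //; by apply: eq_Cint => x _; rewrite rmorph1 mul1r.
Qed.

Lemma pw_le1 x (r : R) : 0 <= r -> 0 < x -> x <= 1 -> x `^ r <= 1.
Proof. by move=> r0 x0 x1; have := ge0_ler_powR r0 _ _ x1; rewrite powR1 !nnegrE ler01 (ltW x0); apply. Qed.

(** From log u <= u - 1 at u = x^(-r). *)
Lemma ln_le_pw x (r : R) : 0 < r -> 0 < x <= 1 -> `|ln x| <= r^-1 * x `^ (- r).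
Proof.
move=> r0 /andP[x0 x1]; rewrite ler0_norm ?ln_le0 //.
rewrite -(ler_pM2l r0) mulVKf ?gt_eqF // mulrN -mulNr -ln_powR.
have := @le_ln1Dx R (x `^ (- r) - 1); rewrite (_ : 1 + (x `^ (- r) - 1) = x `^ (- r)); last ring.
move=> h.
apply: (le_trans (h _)); last by rewrite lerBlDr lerDl.
by rewrite ltrBrDr addrC subrr powR_gt0.
Qed.

Lemma meas_ln : measurable_fun I01 (@ln R).
Proof. exact: measurable_funTS (@measurable_ln R). Qed.

Lemma mel_ln s : 0 < Re s -> Mel (@ln R) s = - (s ^- 2).
Proof.
move=> s0; have sn0 : s != 0 by have := Re_neq0 s0; rewrite subr0.
(* The primitive obtained by parts; near 0 it is O(x^(Re s / 2)), half of the exponent being spent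
   on the logarithm. *)
pose F x := s^-1 * ((ln x)%:C * cpow x s) - s ^- 2 * cpow x s.
have dF x : 0 < x -> cderiv F x ((ln x)%:C * cpow x (s - 1)).
  move=> x0.
  have d1 := cderivM (cderiv_real (is_derive1_ln x0)) (cderiv_cpow s x0).
  have := cderivD (cderivZ s^-1 d1) (cderivZ (- s ^- 2) (cderiv_cpow s x0)).
  rewrite /F; under [X in _ -> cderiv X _ _]eq_fun do rewrite -mulNr.
  move=> d; apply: cderiv_eq d _.
  have -> : (x^-1)%:C * cpow x s = cpow x (s - 1) by rewrite cpowN1 // mulrC.
  by field.
rewrite -[RHS]add0r (_ : 0 - s ^- 2 = F 1 - 0); last first.
  by rewrite /F ln1 mul0r mulr0 cpow1n mulr1 subr0 add0r.
apply: (@Cint_FTC0 _ _ F) => //.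
- by move=> x /andP[x0 _]; exact: dF.
- move=> x /andP[x0 _].
  have -> : (fun x => Re ((ln x)%:C * cpow x (s - 1))) = (fun x => ln x * Re (cpow x (s - 1))).
    by apply/funext => y; rewrite Re_realM.
  have [c1 _] := cpow_cont (s - 1) x0.
  by apply: (@cvgM _ _ _ _ (@ln R)); [exact: continuous_ln|exact: c1].
- move=> x /andP[x0 _].
  have -> : (fun x => Im ((ln x)%:C * cpow x (s - 1))) = (fun x => ln x * Im (cpow x (s - 1))).
    by apply/funext => y; rewrite cImM Re_real Im_real mul0r addr0.
  have [_ c1] := cpow_cont (s - 1) x0.
  by apply: (@cvgM _ _ _ _ (@ln R)); [exact: continuous_ln|exact: c1].
- apply: (@mel_itg _ _ (Re s / 2)^-1 (Re s / 2)); first exact: meas_ln.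
    by lra.
  by move=> x hx; apply: ln_le_pw => //; lra.
pose B := nc s^-1 * (Re s / 2)^-1 + nc (s ^- 2).
have s2 : 0 < Re s / 2 by lra.
have Fb x : 0 < x <= 1 -> nc (F x - 0) <= B * x `^ (Re s / 2).
  move=> /andP[x0 x1]; rewrite subr0 /F (le_trans (ncB _ _)) // mulrDl lerD //.
    rewrite !normcM nc_real nc_cpow // -mulrA ler_wpM2l ?nc_ge0 //.
    have E : Re s = Re s / 2 + Re s / 2 by lra.
    rewrite [in X in _ * X]E pwD // mulrA ler_wpM2r ?powR_ge0 //.
    have := ln_le_pw s2 (_ : 0 < x <= 1); rewrite x0 x1 => /(_ isT) h.
    rewrite (le_trans (ler_wpM2r _ h)) ?powR_ge0 // -mulrA -pwD // addNr powRr0 mulr1 //.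
  rewrite normcM ler_wpM2l ?nc_ge0 // nc_cpow //.
  have E : Re s = Re s / 2 + Re s / 2 by lra.
  by rewrite [in leLHS]E pwD // ler_piMl ?powR_ge0 // pw_le1 // ?(ltW s2).
have H := cvg0M B (cvg_powR_seq s2 ltr01); apply: squeeze_cvgr (cvg_cst _) H; near=> n.
rewrite nc_ge0 /=; apply: Fb; rewrite divr_gt0 ?ltr0n //= ler_pdivrMr ?ltr0n // mul1r ler1n //.
Unshelve. all: by end_near. Qed.

Lemma meas_truncn (g : nat -> R) : mT (fun x : R => g (Num.truncn x)).
Proof.
pose E (i : nat) : set (measurableTypeR R) := [set x | Num.truncn (x : R) = i].
have mE i : measurable (E i).
  case: i => [|i].
    rewrite (_ : E 0 = `]-oo, 1[%classic); first exact: measurable_itv.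
    apply/seteqP; split => x; rewrite /E /= in_itv /=.
      by move=> /truncn0Pn; rewrite -ltNge.
    by move=> h; apply/truncn0Pn; rewrite -ltNge.
  rewrite (_ : E i.+1 = `[i.+1%:R, i.+2%:R[%classic); first exact: measurable_itv.
  apply/seteqP; split => x; rewrite /E /= in_itv /=.
    move=> h; have x1 : 1 <= (x : R) by rewrite -truncn_gt0 h.
    by have := truncn_itv (le_trans ler01 x1); rewrite h.
  by move=> h; apply: truncn_def.
have -> : (setT : set (measurableTypeR R)) = \bigcup_i E i.
  by apply/seteqP; split => x // _; exists (Num.truncn (x : R)).
apply/measurable_fun_bigcup => // i.
apply: eq_measurable_fun (measurable_cst (g i)) => x /set_mem.
by rewrite /E /= => ->.
Qed.

Lemma measT01 a : mT a -> measurable_fun I01 a.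
Proof. exact: measurable_funTS. Qed.

(** The inverse as a real power, whose measurability on the whole line is [measurable_powR]. *)
Definition ivt x : R := x `^ (-1).
Lemma ivtE x : 0 < x -> ivt x = x^-1. Proof. exact: pwN1. Qed.
Lemma meas_ivt : mT ivt. Proof. exact: measurable_powR. Qed.

Lemma meas_fun_ivt (g : nat -> R) : mT (fun x : R => g (Num.truncn (ivt x))).
Proof. exact: (measurableT_comp (meas_truncn g) meas_ivt). Qed.

(* Dilation of a function supported in ]0, 1]. *)
Definition dil a (t x : R) : R := if x <= t then a (x / t) else 0.

Lemma meas_scale a (c : R) : mT a -> mT (fun x : R => a (c * x)).
Proof. by move=> ma; apply: measurableT_comp ma _; exact: mulrl_measurable. Qed.

Lemma meas_dil a (t : R) : mT a -> mT (dil a t).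
Proof.
move=> ma; apply: measurable_fun_if.
- by [].
- by apply: measurable_fun_ler => //; exact: measurable_cst.
- by apply: measurable_funTS; under eq_fun do rewrite mulrC; exact: meas_scale.
- exact: measurable_cst.
Qed.

(** The substitution x = t u carries ]0, 1] to ]0, t], and the dilate vanishes on the rest of ]0,
    1]. *)
Lemma mel_dil a s (A k t : R) : mT a -> k < Re s -> 0 < t <= 1 ->
  (forall x, 0 < x <= 1 -> `|a x| <= A * x `^ (- k)) ->
  citg I01 (fun x => (dil a t x)%:C * cpow x (s - 1)) /\ Mel (dil a t) s = cpow t s * Mel a s.
Proof.
move=> ma ks /andP[t0 t1] H.
have ai := mel_itg (measT01 ma) ks H.
pose f x : C := (a (x / t))%:C * cpow x (s - 1).
pose D : set (measurableTypeR R) := `]0, t]%classic.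
have mD : measurable D by exact: measurable_itv.
have DI : D `<=` I01.
  by move=> x /in_oc/andP[h1 h2]; rewrite /I01 /= in_itv /= h1 (le_trans h2).
have E1 x : 0 < x -> f (t * x) = cpow t (s - 1) * ((a x)%:C * cpow x (s - 1)).
  by move=> x0; rewrite /f mulrAC divff ?gt_eqF // mul1r cpowM // mulrCA.
have mf : cmeas (setT : set (measurableTypeR R)) f.
  apply: cmeasM; last exact: cmeas_cpow.
  by apply: cmeas_real; under eq_fun do rewrite mulrC; exact: meas_scale.
have tt : `]0, t / t]%classic = I01 by rewrite divff ?gt_eqF.
have gi : citg I01 (fun x => f (t * x)).
  apply: eq_citg (citgZ (cpow t (s - 1)) mI01 ai); first exact: mI01.
  by move=> x /in_I01/andP[x0 _]; rewrite E1.
have gi1 : itg `]0, t / t] (fun x => Re (f (t * x))) by rewrite tt; exact: gi.1.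
have gi2 : itg `]0, t / t] (fun x => Im (f (t * x))) by rewrite tt; exact: gi.2.
have [r1 r2] := @scale_eq R t t (fun x => Re (f x)) t0 mf.1 gi1.
have [i1 i2] := @scale_eq R t t (fun x => Im (f x)) t0 mf.2 gi2.
have EC : Cint D f = cpow t s * Mel a s.
  transitivity (t%:C * Cint I01 (fun x => f (t * x))).
    by apply: complex_eq; rewrite /= ?r2 ?i2 tt /=; ring.
  rewrite -(cpow1s _ t0) -mulrA; congr (_ * _).
  rewrite -CintZ; [|exact: mI01|exact: ai].
  by apply: eq_Cint => x /in_I01/andP[x0 _]; rewrite E1.
have K (h : C -> R) : h 0 = 0 ->
   (fun x => h ((dil a t x)%:C * cpow x (s - 1))) \_ I01 = (fun x => h (f x)) \_ D.
  move=> h0; apply/funext => x; rewrite !patchE; case: (boolP (x \in D)) => xD.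
    have xI : x \in I01 by move: xD; rewrite !inE => /DI.
    by rewrite xI /dil /f; move/set_mem: xD => /in_oc/andP[_ ->].
  case: ifPn => // xI; rewrite /dil; case: ifPn => xt; last by rewrite mul0r.
  exfalso; move/negP: xD; apply; apply/mem_set; rewrite /D /= in_itv /= xt andbT.
  by move/set_mem: xI => /in_I01/andP[].
have Ki (h : C -> R) : h 0 = 0 -> itg D (fun x => h (f x)) ->
   itg I01 (fun x => h ((dil a t x)%:C * cpow x (s - 1))).
  move=> h0 hi; apply/(integrable_mkcond _ mI01).
  by rewrite restrict_EFin K // -restrict_EFin; apply/(integrable_mkcond _ mD).
split; first by split; apply: Ki.
rewrite -EC; apply: complex_eq.
  transitivity (\int[mu]_(x in I01) Re ((dil a t x)%:C * cpow x (s - 1))); first reflexivity.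
  by rewrite [LHS]Rintegral_mkcond (K Re erefl) -Rintegral_mkcond.
transitivity (\int[mu]_(x in I01) Im ((dil a t x)%:C * cpow x (s - 1))); first reflexivity.
by rewrite [LHS]Rintegral_mkcond (K Im erefl) -Rintegral_mkcond.
Qed.

End Mellin.

(** * The functions zeta(s)/s and 1/(s zeta(s)) as Mellin transforms *)

Section Zeta.
Variable R : realType.
Local Notation C := R[i].
Local Notation nc := (@normc R).
Local Notation Re := (@complex.Re R).
Local Notation Im := (@complex.Im R).
Local Notation mu := (@lebesgue_measure R).
Local Notation itg D f := (mu.-integrable D (EFin \o f)).
Local Notation mT f := (measurable_fun (setT : set (measurableTypeR R)) f).
Local Notation I1 := (@I01 R).
Local Notation mI1 := (@mI01 R).
Implicit Types (s z : C) (x y : R) (a b : R -> R).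

Lemma melD a b s : citg I1 (fun x => (a x)%:C * cpow x (s - 1)) ->
  citg I1 (fun x => (b x)%:C * cpow x (s - 1)) ->
  Mel (fun x => a x + b x) s = Mel a s + Mel b s.
Proof.
move=> ia ib; rewrite /Mel -CintD //; last exact: mI1.
by apply: eq_Cint => x _; rewrite rmorphD mulrDl.
Qed.

Lemma eq_mel a b s : (forall x, 0 < x <= 1 -> a x = b x) -> Mel a s = Mel b s.
Proof. by move=> H; apply: eq_Cint => x /in_I01 /H ->. Qed.

Lemma Cint_tail (f : R -> C) (t : R) : 0 < t <= 1 -> citg `[t, 1] f ->
  citg I1 (fun x => if x <= t then 0 else f x) /\
  Cint I1 (fun x => if x <= t then 0 else f x) = Cint `[t, 1] f.
Proof.
move=> /andP[t0 t1] fi.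
pose D : set (measurableTypeR R) := `]t, 1]%classic.
have mD : measurable D by exact: measurable_itv.
have DS : D `<=` `[t, 1]%classic by apply: subset_itvr; rewrite bnd_simp.
have fD : citg D f.
  by have [f1 f2] := fi; split; [apply: integrableS f1|apply: integrableS f2] => //; exact: measurable_itv.
have K (h : C -> R) : h 0 = 0 ->
   (fun x => h (if x <= t then 0 else f x)) \_ I1 = (fun x => h (f x)) \_ D.
  move=> h0; apply/funext => x; rewrite !patchE; case: (boolP (x \in D)) => xD.
    have := xD; rewrite inE /D /= in_itv /= => /andP[tx x1].
    have xI : x \in I1 by rewrite inE /I01 /= in_itv /= x1 (lt_trans t0 tx).
    by rewrite xI leNgt tx.
  case: ifPn => // xI; case: ifPn => // xt.
  exfalso; move/negP: xD; apply; apply/mem_set; rewrite /D /= in_itv /= ltNge xt.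
  by move/set_mem: xI => /in_I01/andP[].
have Ki (h : C -> R) : h 0 = 0 -> itg D (fun x => h (f x)) ->
   itg I1 (fun x => h (if x <= t then 0 else f x)).
  move=> h0 hi; apply/(integrable_mkcond _ mI1).
  by rewrite restrict_EFin K // -restrict_EFin; apply/(integrable_mkcond _ mD).
split; first by split; apply: Ki => //; [exact: fD.1|exact: fD.2].
apply: complex_eq.
  transitivity (\int[mu]_(x in I1) Re (if x <= t then 0 else f x)); first reflexivity.
  rewrite [LHS]Rintegral_mkcond (K Re erefl) -Rintegral_mkcond.
  by rewrite Rintegral_itv_obnd_cbnd //; exact: fD.1.
transitivity (\int[mu]_(x in I1) Im (if x <= t then 0 else f x)); first reflexivity.
rewrite [LHS]Rintegral_mkcond (K Im erefl) -Rintegral_mkcond.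
by rewrite Rintegral_itv_obnd_cbnd //; exact: fD.2.
Qed.

Lemma Cint_cpow_cc (t : R) s : 0 < t <= 1 -> s != 1 ->
  citg `[t, 1] (fun x => cpow x (s - 1 - 1)) /\
  Cint `[t, 1] (fun x => cpow x (s - 1 - 1)) = (1 - cpow t (s - 1)) / (s - 1).
Proof.
move=> /andP[t0 t1] s1; have s10 : s - 1 != 0 by rewrite subr_eq0.
have W : {within `[t, 1], continuous (fun x => Re (cpow x (s - 1 - 1)))} /\
         {within `[t, 1], continuous (fun x => Im (cpow x (s - 1 - 1)))}.
  split; apply: within_cc => // x /andP[x0 _]; have [] // := cpow_cont (s - 1 - 1) x0.
split; first by apply: citg_cc; [exact: W.1|exact: W.2].
move: t1; rewrite le_eqVlt => /predU1P[->|t1].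
  rewrite cpow1n subrr mul0r; apply: complex_eq; rewrite /= set_itv1 Rintegral_set1 //.
rewrite (@Cint_FTC _ _ (fun x => (s - 1)^-1 * cpow x (s - 1))) //.
- by rewrite cpow1n mulr1 mulrBl mul1r [cpow t _ * _]mulrC.
- move=> x /andP[tx _]; have x0 := lt_le_trans t0 tx.
  by apply: cderiv_eq (cderivZ (s - 1)^-1 (cderiv_cpow (s - 1) x0)) _; rewrite mulKf.
- exact: W.1.
- exact: W.2.
Qed.

(* rho(1/x), so that rho(theta/x) is rhoi (x / theta); flr and M1i below are
   likewise [1/x] and M(1/x). *)
Definition rhoi x : R := ivt x - (Num.truncn (ivt x))%:R.

Lemma ivt_gt0 x : 0 < x -> 0 < ivt x. Proof. by move=> x0; rewrite powR_gt0. Qed.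

Lemma rhoi_itv x : 0 < x -> 0 <= rhoi x <= 1.
Proof.
move=> x0; have /andP[h1 h2] := truncn_itv (ltW (ivt_gt0 x0)).
by rewrite /rhoi subr_ge0 h1 lerBlDr -natr1 addrC in h2 *; rewrite ltW.
Qed.

Lemma rhoiE x : 0 < x -> rhoi x = frac_part (1 / x).
Proof.
move=> x0; rewrite /rhoi /frac_part ivtE // div1r; congr (_ - _).
by rewrite truncn_floor invr_ge0 ltW // -[RHS]/((_)%:~R) -{2}(gez0_abs (_ : 0 <= Num.floor x^-1)) // floor_ge0 invr_ge0 ltW.
Qed.

Lemma rhoi_big x : 1 < x -> rhoi x = x^-1.
Proof.
move=> x1; have x0 := lt_trans ltr01 x1.
by rewrite /rhoi ivtE // (@truncn_def _ _ 0) ?subr0 // invr_ge0 ltW //= invf_lt1.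
Qed.

Lemma meas_rhoi : mT rhoi.
Proof.
apply: measurable_funB; first exact: meas_ivt.
exact: (meas_fun_ivt (fun n => n%:R)).
Qed.

Lemma rhoi_bd x : 0 < x <= 1 -> `|rhoi x| <= 1 * x `^ (- 0).
Proof.
by move=> /andP[x0 _]; have /andP[h1 h2] := rhoi_itv x0; rewrite oppr0 powRr0 mulr1 ger0_norm.
Qed.

Definition Zf s := Mel rhoi s.
(* zeta(s)/s, continued to Re s > 0 by the Mellin transform of rho(1/x). *)
Definition zt s := (s - 1)^-1 - Zf s.

Lemma Zf_le s : 0 < Re s -> nc (Zf s) <= 2 / Re s.
Proof.
move=> s0; have := mel_le (measT01 meas_rhoi) s0 (rhoi_bd).
by rewrite subr0 mul1r.
Qed.

(** On ]0, t] the function is a dilate of rho(1/x); on ]t, 1] the fractional part of t/x is t/x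
    itself, which contributes (t - t^s) / (s - 1). *)
Lemma mel_rho (t : R) s : 0 < t <= 1 -> 0 < Re s -> s != 1 ->
  citg I1 (fun x => (rhoi (x / t))%:C * cpow x (s - 1)) /\
  Mel (fun x => rhoi (x / t)) s = t%:C / (s - 1) - cpow t s * zt s.
Proof.
move=> ht s0 s1; have /andP[t0 t1] := ht.
have s10 : s - 1 != 0 by rewrite subr_eq0.
have [d1 d2] := mel_dil meas_rhoi s0 ht rhoi_bd.
have [c1 c2] := Cint_cpow_cc ht s1.
have [b1 b2] := Cint_tail ht (citgZ t%:C (measurable_itv _) c1).
have E x : I1 x -> (dil rhoi t x)%:C * cpow x (s - 1) +
   (if x <= t then 0 else t%:C * cpow x (s - 1 - 1)) = (rhoi (x / t))%:C * cpow x (s - 1).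
  move=> /in_I01/andP[x0 x1]; rewrite /dil; case: ifPn => xt; first by rewrite addr0.
  rewrite mul0r add0r rhoi_big; last by rewrite ltr_pdivlMr // mul1r ltNge.
  by rewrite invf_div cpowN1 // rmorphM /=; ring.
split; first by apply: eq_citg (citgD mI1 d1 b1) => //; exact: mI1.
transitivity (Mel (dil rhoi t) s + t%:C * ((1 - cpow t (s - 1)) / (s - 1))).
  rewrite /Mel -(eq_Cint E) CintD //; last exact: mI1.
  by rewrite b2 CintZ ?c2.
rewrite d2 -/(Zf s) /zt -(cpow1s s t0); field; exact: s10.
Qed.

Lemma mel_rho_sum n (c th : 'I_n -> R) s : (forall j, 0 < th j <= 1) -> 0 < Re s -> s != 1 ->
  citg I1 (fun x => (\sum_(j < n) c j * rhoi (x / th j))%:C * cpow x (s - 1)) /\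
  Mel (fun x => \sum_(j < n) c j * rhoi (x / th j)) s =
    (\sum_(j < n) c j * th j)%:C / (s - 1) - zt s * \sum_(j < n) (c j)%:C * cpow (th j) s.
Proof.
move=> hth s0 s1.
have E x : I1 x -> \sum_(j < n) (c j)%:C * ((rhoi (x / th j))%:C * cpow x (s - 1)) =
    (\sum_(j < n) c j * rhoi (x / th j))%:C * cpow x (s - 1).
  by move=> _; rewrite rmorph_sum mulr_suml; apply: eq_bigr => j _; rewrite rmorphM mulrA.
have K j : citg I1 (fun x => (c j)%:C * ((rhoi (x / th j))%:C * cpow x (s - 1))).
  by apply: citgZ; [exact: mI1|exact: (mel_rho (hth j) s0 s1).1].
split; first by exact: eq_citg mI1 E (citg_sum _ mI1 K).
rewrite /Mel -(eq_Cint E) Cint_sum //; last exact: mI1.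
rewrite rmorph_sum mulr_suml mulr_sumr -sumrB; apply: eq_bigr => j _.
rewrite CintZ; [|exact: mI1|exact: (mel_rho (hth j) s0 s1).1].
by rewrite -/(Mel (fun x => rhoi (x / th j)) s) (mel_rho (hth j) s0 s1).2 rmorphM; ring.
Qed.

Definition flr x : R := (Num.truncn (ivt x))%:R.
Definition M1i x : R := (mertensn (Num.truncn (ivt x)))%:~R.

Lemma M1iE x : 0 < x -> M1i x = (mertens1 x)%:~R.
Proof. by move=> x0; rewrite /M1i ivtE // -div1r. Qed.

Lemma meas_flr : mT flr. Proof. exact: (meas_fun_ivt (fun n => n%:R)). Qed.
Lemma meas_M1i : mT M1i. Proof. exact: (meas_fun_ivt (fun n => (mertensn n)%:~R)). Qed.

Lemma flr_le x : 0 < x -> 0 <= flr x <= x^-1.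
Proof.
by move=> x0; rewrite /flr ler0n ivtE //=; have /andP[] := truncn_itv (ltW (ivt_gt0 x0)); rewrite ivtE.
Qed.

Lemma mertensn_leR n : `|(mertensn n)%:~R : R| <= n%:R.
Proof. by rewrite -intr_norm -[n%:R]/((Posz n)%:~R) ler_int mertensn_le. Qed.

Lemma M1i_le x : 0 < x -> `|M1i x| <= x^-1.
Proof. by move=> x0; have /andP[_] := flr_le x0; apply: le_trans; exact: mertensn_leR. Qed.

(** [1/x] = 1/x - rho(1/x), and 1/x has Mellin transform 1 / (s - 1). *)
Lemma zt_flr s : 1 < Re s -> zt s = Mel flr s.
Proof.
move=> s1; have s11 : 0 < Re (s - 1) by rewrite cReD cReN subr_gt0.
have mi : measurable_fun I1 (@ivt R) by exact: measT01 (@meas_ivt R).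
have iv : citg I1 (fun x => (ivt x)%:C * cpow x (s - 1)).
  apply: (@mel_itg _ _ _ 1 1) => // x /andP[x0 _].
  by rewrite mul1r ger0_norm ?(ltW (ivt_gt0 x0)).
have rb x : 0 < x <= 1 -> `|rhoi x| <= 1 * x `^ (- 1).
  move=> /andP[x0 x1]; have /andP[h1 h2] := rhoi_itv x0; rewrite mul1r ger0_norm // (le_trans h2) //.
  by rewrite -/(ivt x) ivtE // invf_ge1.
have ir := mel_itg (measT01 meas_rhoi) s1 rb.
have fb x : 0 < x <= 1 -> `|flr x| <= 1 * x `^ (- 1).
  by move=> /andP[x0 x1]; have /andP[h1 h2] := flr_le x0; rewrite mul1r ger0_norm // -/(ivt x) ivtE.
have if_ := mel_itg (measT01 meas_flr) s1 fb.
have : Mel (@ivt R) s = Mel rhoi s + Mel flr s.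
  by rewrite -melD //; apply: eq_mel => x _; rewrite /rhoi /flr subrK.
rewrite /zt /Zf => E; rewrite -[Mel flr s](addrK (Mel rhoi s)) [Mel flr s + _]addrC -E; congr (_ - _).
transitivity (Cint I1 (fun x => cpow x (s - 1 - 1))).
  by rewrite (Cint_cpow0 ltr01 s11) cpow1n mul1r.
apply: eq_Cint => x /in_I01/andP[x0 _].
by rewrite ivtE // cpowN1 // mulrC.
Qed.

Lemma truncn_div y n : 0 <= y -> Num.truncn (y / n.+1%:R) = (Num.truncn y %/ n.+1)%N.
Proof.
move=> y0; have /andP[h1 h2] := truncn_itv y0; set K := Num.truncn y in h1 h2 *.
apply: truncn_def; rewrite ler_pdivlMr ?ltr0n // ltr_pdivrMr ?ltr0n // -!natrM; apply/andP; split.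
  by apply: le_trans h1; rewrite ler_nat leq_divM.
by apply: lt_le_trans h2 _; rewrite ler_nat -ltn_divLR.
Qed.

(** A partial sum of the Dirichlet series of zeta; under the Mellin transform, the sum of dilates
    [SN] becomes multiplication by it. *)
Definition DN N s : C := \sum_(n < N) cpow (n.+1%:R^-1) s.
Definition SN a N x : R := \sum_(n < N) dil a (n.+1%:R^-1) x.

Lemma inv_itv n : 0 < (n.+1%:R^-1 : R) <= 1.
Proof. by rewrite invr_gt0 ltr0n /= invf_le1 ?ltr0n // ler1n. Qed.

Lemma mel_SN a N s (A k : R) : mT a -> k < Re s ->
  (forall x, 0 < x <= 1 -> `|a x| <= A * x `^ (- k)) -> Mel (SN a N) s = DN N s * Mel a s.
Proof.
move=> ma ks H; rewrite /DN mulr_suml.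
have K (n : 'I_N) := mel_dil ma ks (inv_itv n) H.
transitivity (Cint I1 (fun x => \sum_(n < N) (dil a (n.+1%:R^-1) x)%:C * cpow x (s - 1))).
  by apply: eq_Cint => x _; rewrite rmorph_sum mulr_suml.
rewrite Cint_sum; [|exact: mI1|by move=> n; exact: (K n).1].
by apply: eq_bigr => n _; rewrite -(K n).2.
Qed.

Lemma meas_SN a N : mT a -> mT (SN a N).
Proof. by move=> ma; apply: measurable_sum => n; exact: meas_dil. Qed.

Lemma le_inv_truncn x n : 0 < x -> (x <= n.+1%:R^-1) = (n < Num.truncn (ivt x))%N.
Proof.
by move=> x0; rewrite truncn_gt_nat ivtE // -[RHS]lef_pV2 ?posrE ?invr_gt0 ?ltr0n // invrK.
Qed.

Lemma dil_cst1 n x : 0 < x -> dil (fun=> 1) (n.+1%:R^-1) x = (n < Num.truncn (ivt x))%N%:R.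
Proof. by move=> x0; rewrite /dil le_inv_truncn //; case: ifP. Qed.

Lemma dil_M1i n x : 0 < x -> dil M1i (n.+1%:R^-1) x = (mertensn (Num.truncn (ivt x) %/ n.+1))%:~R.
Proof.
move=> x0; rewrite /dil le_inv_truncn //; case: ifPn => h.
  rewrite /M1i invrK ivtE ?mulr_gt0 ?ltr0n // invfM -truncn_div ?ivtE // invr_ge0 ltW //.
by rewrite divn_small /mertensn ?big_geq // ltnS leqNgt.
Qed.

Lemma SN_cst1 x N : 0 < x -> SN (fun=> 1) N x = (minn N (Num.truncn (ivt x)))%:R.
Proof.
move=> x0; rewrite /SN; under eq_bigr do rewrite dil_cst1 //.
rewrite -natr_sum; congr (_%:R); set K := Num.truncn _.
rewrite -(big_mkord xpredT (fun n => nat_of_bool (n < K)%N)).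
elim: N => [|N IH]; first by rewrite big_geq // min0n.
rewrite big_nat_recr //= IH; case: (ltnP N K) => h.
  by rewrite (minn_idPl h) addn1.
by rewrite (minn_idPr (leqW h)) addn0.
Qed.

Lemma SN_M1i x N : 0 < x <= 1 -> (Num.truncn (ivt x) <= N)%N -> SN M1i N x = 1.
Proof.
move=> /andP[x0 x1] KN; rewrite /SN; under eq_bigr do rewrite dil_M1i //.
have K0 : (0 < Num.truncn (ivt x))%N by rewrite truncn_gt0 ivtE // invf_ge1.
set K := Num.truncn _ in KN K0 *.
rewrite -(big_mkord xpredT (fun n => (mertensn (K %/ n.+1))%:~R)) -(rmorph_sum (intmul 1)) /=.
rewrite (@big_cat_nat _ _ _ K) //= [X in _ + X]big1_seq ?addr0; last first.
  move=> n /=; rewrite mem_index_iota => /andP[h _].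
  by rewrite divn_small ?ltnS // /mertensn big_geq.
rewrite -(@big_add1 _ _ _ 0 K.+1 xpredT (fun n => mertensn (K %/ n))) /= sum_mertensn_div //.
Qed.

Lemma pwN2 x : 0 < x -> x `^ (- 2) = x^-1 * x^-1.
Proof. by move=> x0; rewrite -{1}[2]/(1 + 1) opprD pwD // pwN1. Qed.

(** At most [1/x] terms are nonzero, and each is at most 1/x. The bound x^(-2) accounts for the
    restriction to Re s >= 3 below. *)
Lemma SN_bd a N x : 0 < x <= 1 ->
  (forall n, `|dil a (n.+1%:R^-1) x| <= (n < Num.truncn (ivt x))%N%:R * x^-1) ->
  `|SN a N x| <= 1 * x `^ (- 2).
Proof.
move=> /andP[x0 x1] H; rewrite mul1r pwN2 // (le_trans (ler_norm_sum _ _ _)) //.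
rewrite (le_trans (ler_sum _ (fun (i : 'I_N) _ => H i))) // -mulr_suml ler_wpM2r ?invr_ge0 ?(ltW x0) //.
have := SN_cst1 N x0; rewrite /SN; under eq_bigr do rewrite dil_cst1 //.
move=> ->; have /andP[_] := flr_le x0; apply: le_trans; rewrite /flr ler_nat geq_minr //.
Qed.


(** [s * zt s] is zeta(s). The dilates of 1 add up to min(N, [1/x]), which is [1/x] for large N;
    dominated convergence then leads from [DN N s] / s to the transform of [1/x]. *)
Lemma DN_cvg s : 3 <= Re s -> (fun N => nc (DN N s - s * zt s)) @ \oo --> (0 : R).
Proof.
move=> s3; have s0 : 0 < Re s by lra.
have s2 : 2 < Re s by lra.
have sn0 : s != 0 by have := Re_neq0 s0; rewrite subr0.
have b1 x : 0 < x <= 1 -> `|(fun=> 1 : R) x| <= 1 * x `^ (- 0).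
  by rewrite oppr0 powRr0 normr1 mulr1.
have m1 : mT (fun=> 1 : R) by exact: measurable_cst.
have bS N x : 0 < x <= 1 -> `|SN (fun=> 1) N x| <= 1 * x `^ (- 2).
  move=> hx; have /andP[x0 x1] := hx; apply: SN_bd => // n.
  rewrite dil_cst1 // ger0_norm ?ler0n // ler_peMr ?ler0n // invf_ge1 //.
have E x : 0 < x <= 1 -> \forall N \near \oo, SN (fun=> 1) N x = flr x.
  move=> /andP[x0 _]; near=> N; rewrite SN_cst1 // (minn_idPr _) //.
  by near: N; exact: nbhs_infty_ge.
have := mel_dct (fun N => measT01 (meas_SN N m1)) (measT01 meas_flr) s2 bS E.
have F N : nc (DN N s - s * zt s) = nc s * nc (Mel (SN (fun=> 1) N) s - Mel flr s).
  rewrite (mel_SN N m1 s0 b1) mel_cst1 // -zt_flr; last by lra.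
  rewrite -normcM; congr (nc _); rewrite [RHS]mulrBr; congr (_ - _).
  by rewrite mulrCA mulfV // mulr1.
under [in X in _ -> X]eq_fun do rewrite F.
by move=> H; exact: cvg0M.
Unshelve. all: by end_near. Qed.

Lemma le_cvg_seq (u : nat -> R) (c l : R) : u @ \oo --> l ->
  (\forall n \near \oo, c <= u n) -> c <= l.
Proof.
move=> ul H; rewrite -(cvg_lim _ ul) //; apply: limr_ge => //.
by apply/cvg_ex; exists l.
Qed.

(* Equal to 1 / (s zeta(s)) for Re s > 1. *)
Definition w s := Mel M1i s.

(** By [sum_mertensn_div] the dilates of M(1/x) add up to 1 as soon as N >= [1/x], and 1 has
    transform 1/s. *)
Lemma zt_w s : 3 <= Re s -> s * zt s * w s = s^-1.
Proof.
move=> s3; have s0 : 0 < Re s by lra.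
have s2 : 2 < Re s by lra.
have s1 : 1 < Re s by lra.
have bM x : 0 < x <= 1 -> `|M1i x| <= 1 * x `^ (- 1).
  by move=> /andP[x0 _]; rewrite mul1r pwN1 // M1i_le.
have bS N x : 0 < x <= 1 -> `|SN M1i N x| <= 1 * x `^ (- 2).
  move=> hx; have /andP[x0 x1] := hx; apply: SN_bd => // n.
  rewrite dil_M1i //; case: ltnP => h; last by rewrite divn_small ?ltnS // /mertensn big_geq // normr0 mul0r.
  rewrite mul1r (le_trans (mertensn_leR _)) //.
  by have /andP[_ ] := flr_le x0; apply: le_trans; rewrite ler_nat leq_div.
have E x : 0 < x <= 1 -> \forall N \near \oo, SN M1i N x = (fun=> 1) x.
  move=> hx; near=> N; rewrite SN_M1i //.
  by near: N; exact: nbhs_infty_ge.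
have m1 : mT (fun=> 1 : R) by exact: measurable_cst.
have C1 := mel_dct (fun N => measT01 (meas_SN N meas_M1i)) (measT01 m1) s2 bS E.
have C2 := cvg0M (nc (w s)) (DN_cvg s3).
have C3 : (fun n => nc (Mel (SN M1i n) s - Mel (fun=> 1) s) + nc (w s) * nc (DN n s - s * zt s)) @ \oo --> (0 + 0 : R).
  exact: cvgD.
rewrite addr0 in C3.
apply/eqP; rewrite -subr_eq0 -nc_eq0 eq_le nc_ge0 andbT.
apply: (le_cvg_seq C3); near=> N.
rewrite (mel_SN N meas_M1i s1 bM) -/(w s) (mel_cst1 s0) -normcM.
have -> : s * zt s * w s - s^-1 = (DN N s * w s - s^-1) - w s * (DN N s - s * zt s) by ring.
exact: ncB.
Unshelve. all: by end_near. Qed.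

Lemma zt_sub1 s : 3 <= Re s -> nc (s * zt s - 1) <= 2^-1.
Proof.
move=> s3.
(* Telescoping: (N + 2)^(-3) <= 1 / (2 (N + 1) (N + 2)), and the right side is the difference of
   consecutive terms 1 / (2 (N + 1)). *)
have B N : nc (DN N.+1 s - 1) <= 2^-1 - (2 * N.+1%:R)^-1.
  elim: N => [|N IH].
    by rewrite /DN big_ord1 invr1 cpow1n subrr normc0 mulr1 subrr.
  rewrite /DN big_ord_recr /= -/(DN N.+1 s) addrAC (le_trans (ncD _ _)) //.
  have P : nc (cpow N.+2%:R^-1 s) <= (2 * N.+1%:R)^-1 - (2 * N.+2%:R)^-1.
    have v0 : 0 < (N.+2%:R^-1 : R) by rewrite invr_gt0 ltr0n.
    rewrite nc_cpow //; have := @ler_powR R (N.+2%:R^-1 : R).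
    have /andP[_ v1] := inv_itv N.+1.
    have -> : (N.+2%:R^-1 : R) `^ Re s = (N.+2%:R^-1 : R) `^ (Re s - 3) * (N.+2%:R^-1 : R) ^+ 3.
      by rewrite -powR_mulrn ?(ltW v0) // -pwD // subrK.
    move=> _; apply: (@le_trans _ _ ((N.+2%:R^-1 : R) ^+ 3)).
      by rewrite ler_piMl ?exprn_ge0 ?(ltW v0) // pw_le1 // subr_ge0.
    have n1 : 1 <= (N.+1%:R : R) by rewrite ler1n.
    rewrite -[N.+2%:R]natr1; set y := (N.+1%:R : R) in n1 *.
    have -> : (2 * y)^-1 - (2 * (y + 1))^-1 = (2 * y * (y + 1))^-1 by field; apply/andP; split; lra.
    rewrite exprVn lef_pV2 ?posrE; [nra| |]; nra.
  by rewrite (le_trans (lerD IH P)) // addrA subrK.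
have C := DN_cvg s3; rewrite nc_dist -[2^-1]addr0.
have C3 : (fun N => 2^-1 + nc (DN N s - s * zt s)) @ \oo --> (2^-1 + 0 : R).
  by apply: cvgD C; exact: cvg_cst.
rewrite addr0 in C3 *; apply: (le_cvg_seq C3); near=> N; have N0 : (0 < N)%N by near: N; exact: nbhs_infty_gt.
rewrite -(prednK N0); set n := N.-1.
rewrite (_ : 1 - s * zt s = (1 - DN n.+1 s) + (DN n.+1 s - s * zt s)); last by ring.
rewrite (le_trans (ncD _ _)) // lerD2r nc_dist (le_trans (B n)) //.
by rewrite gerBl invr_ge0 mulr_ge0 ?ler0n.
Unshelve. all: by end_near. Qed.

Lemma zt_up s : 0 < Re s -> 8^-1 <= nc (s - 1) -> nc (zt s) <= 8 + 2 / Re s.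
Proof.
move=> s0 h; rewrite /zt (le_trans (ncB _ _)) // lerD ?Zf_le // normcV.
by rewrite -[8]invrK lef_pV2 ?posrE ?invr_gt0 ?ltr0n // (lt_le_trans _ h) ?invr_gt0 ?ltr0n.
Qed.

(** Near the pole, [(s - 1) * zt s] is 1 - (s - 1) [Zf s], and |s - 1| |[Zf s]| <= 1/8 * 16/7. *)
Lemma zt_low1 s : nc (s - 1) <= 8^-1 -> s != 1 -> 2^-1 <= nc ((s - 1) * zt s).
Proof.
move=> h s1; have s10 : s - 1 != 0 by rewrite subr_eq0.
have r1 : 7 / 8 <= Re s.
  have := le_trans (nc_Re _) h; rewrite cReD cReN /= ler_norml => /andP[]; lra.
have r0 : 0 < Re s by lra.
have Z := Zf_le r0.
have Z' : nc (Zf s) <= 16 / 7.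
  by apply: (le_trans Z); rewrite ler_pdivrMr //; lra.
rewrite /zt mulrBr mulfV //; apply: le_trans (nc_subl _ _).
rewrite normc1 normcM; have := nc_ge0 (s - 1); have := nc_ge0 (Zf s); nra.
Qed.

End Zeta.

(** * Exponential sums approximating 1/(s zeta(s)) *)

Section Approx.
Variable R : realType.
Local Notation C := R[i].
Local Notation nc := (@normc R).
Local Notation Re := (@complex.Re R).
Local Notation Im := (@complex.Im R).
Local Notation mu := (@lebesgue_measure R).
Local Notation itg D f := (mu.-integrable D (EFin \o f)).
Local Notation mT f := (measurable_fun (setT : set (measurableTypeR R)) f).
Local Notation I1 := (@I01 R).
Local Notation mI1 := (@mI01 R).
Local Notation hl := (half_line R : set (measurableTypeR R)).
Implicit Types (s z : C) (x y : R) (a b : R -> R).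

Lemma mhl : measurable hl. Proof. exact: measurable_itv. Qed.

Lemma in_hl x : hl x -> 0 < x. Proof. by rewrite /half_line /= in_itv /= andbT. Qed.

Lemma meas_pow (D : set (measurableTypeR R)) (g : R -> R) (r : R) : measurable_fun D g ->
  measurable_fun D (fun x => g x `^ r).
Proof. by move=> mg; exact: (measurableT_comp (measurable_powR r) mg). Qed.

Lemma LpC_pow (p : R) (h : R -> C) : p != 0 ->
  (LpC_norm p%:E h `^ p = \int[mu]_(x in hl) (nc (h x) `^ p)%:E)%E.
Proof.
move=> p0; rewrite /LpC_norm (poweR_Lnorm _ _ p0) [RHS]integral_mkcond.
apply: eq_integral => x _; rewrite /= !patchE; case: ifP => _.
  by rewrite /= ger0_norm ?nc_ge0.
by rewrite /= normr0 powR0.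
Qed.

Lemma LpC_norm_ge0 (p : \bar R) (h : R -> C) : (0 <= LpC_norm p h)%E.
Proof. exact: Lnorm_ge0. Qed.

Lemma LpC_norm_lt (p e : R) (h : R -> C) : 0 < p -> 0 < e -> (LpC_norm p%:E h < e%:E)%E ->
  (\int[mu]_(x in hl) (nc (h x) `^ p)%:E <= (e `^ p)%:E)%E.
Proof.
move=> p0 e0 H; rewrite -LpC_pow ?gt_eqF // -poweR_EFin.
apply: gt0_ler_poweR; rewrite ?(ltW p0) ?(ltW H) //.
- by rewrite itv_boundlr /= ?bnd_simp LpC_norm_ge0 leey.
- by rewrite itv_boundlr /= ?bnd_simp lee_fin (ltW e0) leey.
Qed.

Lemma lt_LpC_norm (p e : R) (h : R -> C) : 0 < p -> 0 < e ->
  (\int[mu]_(x in hl) (nc (h x) `^ p)%:E < (e `^ p)%:E)%E -> (LpC_norm p%:E h < e%:E)%E.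
Proof.
move=> p0 e0; apply: contraTT; rewrite -!leNgt => H.
rewrite -LpC_pow ?gt_eqF // -poweR_EFin.
apply: gt0_ler_poweR; rewrite ?(ltW p0) //.
- by rewrite itv_boundlr /= ?bnd_simp lee_fin (ltW e0) leey.
- by rewrite itv_boundlr /= ?bnd_simp LpC_norm_ge0 leey.
Qed.

Lemma LpC_norm_fin (p : R) (h : R -> C) : 0 < p ->
  (LpC_norm p%:E h < +oo)%E <-> (\int[mu]_(x in hl) (nc (h x) `^ p)%:E < +oo)%E.
Proof.
move=> p0; rewrite -LpC_pow ?gt_eqF //; split; first exact: poweR_lty.
by apply: lty_poweRy; rewrite gt_eqF.
Qed.

Lemma itg_of_le (D : set (measurableTypeR R)) (g : R -> R) (b : R) : measurable D ->
  measurable_fun D g -> (forall x, D x -> 0 <= g x) ->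
  (\int[mu]_(x in D) (g x)%:E <= b%:E)%E -> itg D g /\ \int[mu]_(x in D) g x <= b.
Proof.
move=> mD mg g0 H.
have gi : itg D g.
  apply/integrableP; split; first exact/measurable_EFinP.
  apply: le_lt_trans (ltry b); apply: le_trans H.
  rewrite le_eqVlt; apply/orP; left; apply/eqP; apply: eq_integral => x /set_mem Dx.
  by rewrite /= ger0_norm ?g0.
split => //; rewrite -lee_fin /Rintegral fineK //.
by apply: integrable_fin_num gi.
Qed.

Lemma meas_lambda : mT (@lambda R).
Proof.
apply: measurable_funM; last exact: measurable_ln.
by apply: measurable_indic; exact: measurable_itv.
Qed.

Lemma lambda_I01 x : 0 < x <= 1 -> lambda x = ln x.
Proof. by move=> hx; rewrite /lambda indicE mem_set ?mul1r //= in_itv. Qed.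

Lemma lambda_big x : 1 < x -> lambda x = 0.
Proof.
move=> hx; rewrite /lambda indicE memNset ?mul0r //= in_itv /= => /andP[_].
by rewrite leNgt hx.
Qed.

Definition Bsum n (c th : 'I_n -> R) x : R := \sum_(j < n) c j * rhoi (x / th j).

Lemma meas_Bsum n (c th : 'I_n -> R) : mT (Bsum c th).
Proof.
apply: measurable_sum => j; apply: measurable_funM; first exact: measurable_cst.
under eq_fun do rewrite mulrC; apply: meas_scale; exact: meas_rhoi.
Qed.

Lemma frac_rhoi (t x : R) : 0 < t -> 0 < x -> frac_part (t / x) = rhoi (x / t).
Proof. by move=> t0 x0; rewrite rhoiE ?divr_gt0 // div1r invf_div. Qed.

Lemma Beurling_meas (f : R -> C) : Beurling_space R f ->
  measurable_fun hl (fun x => Re (f x)) /\ measurable_fun hl (fun x => Im (f x)).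
Proof.
move=> [n [c [th [hth E]]]].
have K (h : C -> R) : (h =1 Re \/ h =1 Im) -> measurable_fun hl (fun x => h (f x)).
  move=> hh; apply: (@eq_measurable_fun _ _ _ _ _ (Bsum (fun j => h (c j)) th)).
    move=> x /set_mem/in_hl x0; rewrite E // /Bsum.
    have hs (z : C) (y : R) : h z * y = h (z * y%:C).
      by case: hh => hh; rewrite !hh ?cReM ?cImM Re_real Im_real ?mulr0 ?subr0 ?add0r // addr0.
    rewrite (_ : h (\sum_(k < n) _) = \sum_(k < n) h (c k * (frac_part (th k / x))%:C)).
      by apply: eq_bigr => j _; rewrite -hs frac_rhoi //; have /andP[] := hth j.
    elim/big_rec2: _ => [|i y1 y2 _ <-]; first by case: hh => ->.
    by case: hh => hh; rewrite !hh ?cReD ?cImD.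
  exact: measurable_funTS (meas_Bsum _ _).
by split; apply: K; [left|right].
Qed.

Lemma cmeas_nc (D : set (measurableTypeR R)) (f : R -> C) : cmeas D f -> measurable_fun D (fun x => nc (f x)).
Proof.
move=> [m1 m2].
have E : (fun x => nc (f x)) = (fun x => (Re (f x) ^+ 2 + Im (f x) ^+ 2) `^ 2^-1).
  by apply/funext => x; rewrite powR12_sqrt ?addr_ge0 ?sqr_ge0 //; case: (f x).
rewrite E; apply: meas_pow.
by apply: measurable_funD; apply: measurable_funX.
Qed.

(** Since lambda and rho are real, taking real parts of the coefficients does not increase the
    distance. *)
Lemma closure_real (p eta : R) : 0 < p -> 0 < eta ->
  LpC_closure p%:E (Beurling_space R) (fun x : R => (lambda x)%:C) ->
  exists n (c th : 'I_n -> R), (forall j, 0 < th j <= 1) /\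
    (\int[mu]_(x in hl) (`|lambda x - Bsum c th x| `^ p)%:E <= eta%:E)%E.
Proof.
move=> p0 eta0 [_ H]; have e0 : 0 < eta `^ p^-1 by rewrite powR_gt0.
have [f [n [c [th [hth E]]]] Hf] := H _ e0.
exists n, (fun j => Re (c j)), th; split => //.
have Ee : (eta `^ p^-1) `^ p = eta by rewrite -powRrM mulVf ?gt_eqF // powRr1 // ltW.
have := LpC_norm_lt p0 e0 Hf; rewrite Ee.
apply: le_trans; apply: ge0_le_integral.
- exact: mhl.
- by move=> x _; rewrite lee_fin powR_ge0.
- apply/measurable_EFinP; apply: meas_pow.
  apply: measurableT_comp => //; apply: measurable_funTS; apply: measurable_funB.
    exact: meas_lambda.
  exact: meas_Bsum.
- apply/measurable_EFinP; apply: meas_pow.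
  have [m1 m2] : measurable_fun hl (fun x => Re (f x)) /\ measurable_fun hl (fun x => Im (f x)).
    by apply: Beurling_meas; exists n, c, th.
  apply: cmeas_nc; split; first under eq_fun do rewrite cReD cReN.
    by apply: measurable_funB => //; apply: measurable_funTS; exact: meas_lambda.
  under eq_fun do rewrite cImD cImN Im_real add0r.
  exact: measurableT_comp.
move=> x /in_hl x0; rewrite lee_fin; apply: ge0_ler_powR; rewrite ?nnegrE ?nc_ge0 ?(ltW p0) //.
rewrite (_ : lambda x - _ = Re ((lambda x)%:C - f x)) ?nc_Re //.
rewrite cReD cReN Re_real; congr (_ - _); rewrite E // Re_sum; apply: eq_bigr => j _.
rewrite cReM Re_real Im_real mulr0 subr0 frac_rhoi //; have /andP[] := hth j => //.
Qed.

(** A weighted Young inequality without best constants: u lies below or above t v^(1/(p - 1)), and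
    one term suffices in each case. The weight t is fixed first to make the dual term small; the
    other one then only needs u small in L_p. *)
Lemma young (p t u v : R) : 1 < p -> 0 < t -> 0 <= u -> 0 < v ->
  u * v <= t * v `^ (p / (p - 1)) + t `^ (1 - p) * u `^ p.
Proof.
move=> p1 t0 u0 v0; have p10 : 0 < p - 1 by rewrite subr_gt0.
have [h|h] := leP u (t * v `^ (p - 1)^-1).
  apply: (@le_trans _ _ (t * v `^ (p / (p - 1)))); last by rewrite lerDl mulr_ge0 ?powR_ge0.
  have -> : p / (p - 1) = (p - 1)^-1 + 1 by field; rewrite gt_eqF.
  by rewrite pwD // powRr1 ?(ltW v0) // mulrA ler_wpM2r ?(ltW v0).
apply: (@le_trans _ _ (t `^ (1 - p) * u `^ p)); last by rewrite lerDr mulr_ge0 ?powR_ge0 ?(ltW t0).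
have u1 : 0 < u by rewrite (le_lt_trans _ h) // mulr_ge0 ?powR_ge0 ?(ltW t0).
have -> : 1 - p = - (p - 1) by ring.
have -> : u `^ p = u * u `^ (p - 1) by rewrite -{2}(powRr1 u0) -pwD // addrC subrK.
rewrite mulrCA ler_wpM2l //.
rewrite powRN mulrC ler_pdivlMr ?powR_gt0 //.
have := @ge0_ler_powR R (p - 1) (ltW p10) (v `^ (p - 1)^-1 * t) u.
rewrite !nnegrE mulr_ge0 ?powR_ge0 ?(ltW t0) // => /(_ isT u0).
rewrite mulrC (ltW h) => /(_ isT).
by rewrite powRM ?powR_ge0 ?(ltW t0) // -powRrM mulVf ?gt_eqF // powRr1 ?(ltW v0) // mulrC.
Qed.

Lemma approx_zt (p be ep : R) : 1 < p -> p^-1 < be < 1 -> 0 < ep ->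
  LpC_closure p%:E (Beurling_space R) (fun x : R => (lambda x)%:C) ->
  exists n (c th : 'I_n -> R), (forall j, 0 < th j <= 1) /\
    `|\sum_(j < n) c j * th j| <= ep /\
    forall s, be <= Re s -> s != 1 ->
     nc (zt s * (\sum_(j < n) (c j)%:C * cpow (th j) s) - s ^- 2 -
         (\sum_(j < n) c j * th j)%:C / (s - 1)) <= ep.
Proof.
move=> p1 /andP[be1 be2] ep0 Hc.
have p0 : 0 < p by lra.
have p10 : 0 < p - 1 by lra.
have be0 : 0 < be by rewrite (lt_trans _ be1) // invr_gt0.
(* p^-1 < be says exactly that x^(be - 1), raised to the dual exponent, is integrable at 0. *)
pose q := (be - 1) * (p / (p - 1)).
have q1 : -1 < q.
  have h : 1 < be * p by rewrite -ltr_pdivrMr // div1r.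
  rewrite /q mulrA ltr_pdivlMr //; lra.
pose Iq := \int[mu]_(x in I1) x `^ q.
have Iq0 : 0 <= Iq by apply: Rintegral_ge0 => x _; exact: powR_ge0.
pose t := ep / (4 * (Iq + 1)).
have t0 : 0 < t by rewrite divr_gt0 // mulr_gt0 ?ltr_wpDl.
pose K := t `^ (1 - p).
have K0 : 0 < K by rewrite powR_gt0.
(* The first bound serves the Mellin integral over ]0, 1], the second the sum of the [c j * th j],
   which is read off ]1, 2]. *)
pose eta := Num.min (ep / (4 * K)) ((ep / 2) `^ p).
have eta0 : 0 < eta by rewrite lt_min powR_gt0 ?divr_gt0 ?mulr_gt0.
have [n [c [th [hth H]]]] := closure_real p0 eta0 Hc.
exists n, c, th; split => //.
pose d x := lambda x - Bsum c th x.
pose g x := `|d x| `^ p.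
have md : mT d by apply: measurable_funB; [exact: meas_lambda|exact: meas_Bsum].
have mg : mT g by apply: meas_pow; exact: measurableT_comp.
have G (D : set (measurableTypeR R)) : measurable D -> D `<=` hl ->
    itg D g /\ \int[mu]_(x in D) g x <= eta.
  move=> mD Dh; apply: itg_of_le => //; first exact: measurable_funTS.
    by move=> x _; exact: powR_ge0.
  apply: le_trans H; apply: ge0_subset_integral => //; first exact: mhl.
    by apply/measurable_EFinP; exact: measurable_funTS.
  by move=> x _; rewrite lee_fin powR_ge0.
set e := \sum_(j < n) c j * th j.
have Bbig x : 1 < x -> Bsum c th x = e / x.
  move=> x1; rewrite /Bsum /e mulr_suml; apply: eq_bigr => j _.
  have /andP[h0 h1] := hth j.
  rewrite rhoi_big ?invf_div ?mulrA // ltr_pdivlMr // mul1r; exact: le_lt_trans x1.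
split.
  (* On ]1, 2], an interval of length 1, the difference is - e / x, of modulus at least |e| / 2. *)
  pose D : set (measurableTypeR R) := `]1, 2]%classic.
  have mD : measurable D by exact: measurable_itv.
  have Dh : D `<=` hl.
    by move=> x; rewrite /D /half_line /= !in_itv /= andbT => /andP[h _]; exact: lt_trans h.
  have [gi gle] := G D mD Dh.
  have mD1 : mu D = 1%:E by rewrite lebesgue_measure_itv /= lte_fin ltr1n -EFinD; congr (_%:E); ring.
  have ci : itg D (fun=> (`|e| / 2) `^ p).
    apply: (@integrableS _ _ _ mu `[1, 2]) => //; first by apply: subset_itvr; rewrite bnd_simp.
    by apply: itg_cc; apply: continuous_subspaceT => x; exact: cvg_cst.
  have RC : \int[mu]_(x in D) (`|e| / 2) `^ p = (`|e| / 2) `^ p.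
    transitivity ((`|e| / 2) `^ p * fine (mu D)); first exact: Rintegral_cst.
    by rewrite mD1 mulr1.
  have := le_Rintegral mD ci gi; rewrite RC => L.
  have L2 : (`|e| / 2) `^ p <= (ep / 2) `^ p.
    apply: (@le_trans _ _ eta); last by rewrite ge_min lexx orbT.
    apply: le_trans gle; apply: L => x; rewrite /D /= in_itv /= => /andP[x1 x2].
    apply: ge0_ler_powR; rewrite ?nnegrE ?divr_ge0 ?normr_ge0 ?(ltW p0) //.
    rewrite /d lambda_big // Bbig // sub0r normrN normrM normfV ler_wpM2l //.
    by rewrite gtr0_norm ?lef_pV2 ?posrE //; lra.
  rewrite leNgt; apply/negP => h; move: L2; rewrite leNgt => /negP; apply.
  by apply: gt0_ltr_powR; rewrite ?nnegrE ?divr_ge0 ?(ltW ep0) // ltr_pM2r.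
move=> s sb s1.
have s0 : 0 < Re s by lra.
have I1h : I1 `<=` hl by move=> x /in_I01/andP[h _]; rewrite /half_line /= in_itv /= h.
have [gi gle] := G I1 mI1 I1h.
have [b1 b2] := mel_rho_sum c hth s0 s1.
have li : citg I1 (fun x => (ln x)%:C * cpow x (s - 1)).
  apply: (@mel_itg _ _ _ (Re s / 2)^-1 (Re s / 2)); [exact: meas_ln|lra|].
  by move=> x hx; apply: ln_le_pw => //; lra.
have E x : I1 x -> (ln x)%:C * cpow x (s - 1) - (Bsum c th x)%:C * cpow x (s - 1) =
   (d x)%:C * cpow x (s - 1).
  by move=> /in_I01 hx; rewrite /d lambda_I01 // rmorphB mulrBl.
have di : citg I1 (fun x => (d x)%:C * cpow x (s - 1)).
  exact: eq_citg mI1 E (citgB mI1 li b1).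
have -> : zt s * (\sum_(j < n) (c j)%:C * cpow (th j) s) - s ^- 2 - e%:C / (s - 1) =
   Mel d s.
  transitivity (Mel (@ln R) s - Mel (Bsum c th) s).
    by rewrite mel_ln // b2 -/e; ring.
  by rewrite /Mel -(eq_Cint E); exact: esym (CintB mI1 li b1).
have qi : itg I1 (fun x => x `^ q) by apply: itg_powR.
pose h x := t * x `^ q + K * g x.
have hi : itg I1 h by apply: itgD; [exact: mI1|apply: itgZ => //; exact: mI1|apply: itgZ => //; exact: mI1].
apply: (le_trans (Cint_le mI1 di hi _)).
  move=> x /in_I01/andP[x0 x1]; rewrite normcM nc_real nc_cpow // cReD cReN /=.
  apply: (@le_trans _ _ (`|d x| * x `^ (be - 1))).
    rewrite ler_wpM2l // -(subrK (be - 1) (Re s - 1)) (pwD (Re s - 1 - (be - 1)) (be - 1) x0) ler_piMl ?powR_ge0 // pw_le1 //; lra.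
  have := young p1 t0 (normr_ge0 (d x)) (powR_gt0 (be - 1) x0).
  by rewrite -powRrM -/q -/K.
rewrite /h RintegralD //; [|exact: mI1|by apply: itgZ => //; exact: mI1|by apply: itgZ => //; exact: mI1].
rewrite !RintegralZl //; [|exact: mI1|exact: mI1].
rewrite -/Iq.
have A1 : t * Iq <= ep / 4.
  rewrite /t -mulrA ler_pM2l // invfM -mulrA ler_piMr // mulrC ler_pdivrMr ?ltr_wpDl // mul1r lerDl //.
have A2 : K * \int[mu]_(x in I1) g x <= ep / 4.
  apply: (@le_trans _ _ (K * (ep / (4 * K)))); last by rewrite le_eqVlt; apply/orP; left; apply/eqP; field; rewrite gt_eqF.
  by rewrite ler_wpM2l ?(ltW K0) // (le_trans gle) // ge_min lexx.
lra.
Qed.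

End Approx.

(** * Tails of the exponential series and polynomial approximation *)

Section Taylor.
Variable R : realType.
Local Notation C := R[i].
Local Notation nc := (@normc R).
Local Notation Re := (@complex.Re R).
Local Notation Im := (@complex.Im R).
Local Notation mu := (@lebesgue_measure R).
Local Notation itg D f := (mu.-integrable D (EFin \o f)).
Local Notation mT f := (measurable_fun (setT : set (measurableTypeR R)) f).
Local Notation I1 := (@I01 R).
Local Notation mI1 := (@mI01 R).
Implicit Types (s z u v : C) (x y t : R).

Definition etail m (b : R) : R := expR b - \sum_(k < m) b ^+ k / k`!%:R.
Definition ctail m u : C := cexp u - \sum_(k < m) u ^+ k / k`!%:R.

Lemma cderiv_sum n (F : 'I_n -> R -> C) x (f : 'I_n -> C) :
  (forall i, cderiv (F i) x (f i)) -> cderiv (fun t => \sum_(i < n) F i t) x (\sum_(i < n) f i).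
Proof.
elim: n F f => [|n IH] F f H.
  by under eq_fun do rewrite big_ord0; rewrite big_ord0; exact: cderiv_cst.
under eq_fun do rewrite big_ord_recr; rewrite big_ord_recr.
by apply: cderivD; [exact: IH|exact: H].
Qed.

Lemma fact_neq0 (K : numFieldType) n : (n`!%:R : K) != 0.
Proof. by rewrite pnatr_eq0 -lt0n fact_gt0. Qed.

Lemma cderiv_ctail m v x :
  cderiv (fun t => ctail m.+1 (t%:C * v)) x (v * ctail m (x%:C * v)).
Proof.
have d1 := cderiv_cexp v (dvid x).
have d2 (k : 'I_m.+1) := cderivZ (- (v ^+ k / k`!%:R)) (cderiv_real (dvX k x)).
have := cderivD d1 (cderiv_sum d2).
set F := (X in cderiv X); set G := (X in _ -> cderiv X _ _).
have -> : F = G.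
  apply/funext => t; rewrite /F /G /ctail mulrC -sumrN; congr (_ + _).
  by apply: eq_bigr => k _; rewrite exprMn rmorphXn mulNr mulrC mulrA.
move=> d; apply: cderiv_eq d _.
rewrite /ctail mulrBr rmorph1 mulr1 [x%:C * v]mulrC; congr (_ + _).
rewrite big_ord_recl /= mul0r rmorph0 mulr0 add0r mulr_sumr -sumrN; apply: eq_bigr => k _.
rewrite /bump /= add1n mulNr; congr (- _).
rewrite add0n exprMn rmorphM rmorphXn rmorph_nat factS natrM exprS.
have h1 := fact_neq0 C k; have h2 : (k.+1%:R : C) != 0 by rewrite pnatr_eq0.
move: h1 h2; set p := (k`!%:R : C); set q := (k.+1%:R : C) => h1 h2; clearbody p q.
by field; apply/andP.
Qed.

Lemma etailE m (b : R) : etail m b = Re (ctail m (b%:C * 1)).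
Proof.
rewrite mulr1 /ctail /etail cReD cReN cexp_real Re_real; congr (_ - _).
rewrite (_ : \sum_(k < m) b%:C ^+ k / k`!%:R = (\sum_(k < m) b ^+ k / k`!%:R)%:C) ?Re_real //.
rewrite rmorph_sum; apply: eq_bigr => k _.
by rewrite rmorphM rmorphXn fmorphV rmorph_nat.
Qed.

(** The choice c = conj(z) / |z| attains |z|. It reduces a complex mean value inequality to the real
    one. *)
Lemma nc_rot z (B : R) : (forall c, nc c <= 1 -> `|Re (c * z)| <= B) -> nc z <= B.
Proof.
move=> H; have [->|z0] := eqVneq z 0.
  by rewrite normc0; have := H 0; rewrite normc0 ler01 => /(_ isT); apply: le_trans.
have n0 : 0 < nc z by rewrite nc_gt0.
have E : nc ((z^*)%C) = nc z by case: (z) => a b; rewrite /= sqrrN.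
have := H ((nc z)^-1%:C * (z^*)%C).
rewrite normcM nc_real E normfV ger0_norm ?nc_ge0 // mulVf ?gt_eqF // lexx => /(_ isT).
rewrite -mulrA Re_realM; have -> : Re ((z^*)%C * z) = nc z ^+ 2.
  by rewrite nc_sqr; case: (z) => a b /=; ring.
by rewrite expr2 mulKf ?gt_eqF // ger0_norm // ltW.
Qed.

(** Induction on m: differentiating in b lowers m by one and multiplies the left side by v, of
    modulus at most 1. Both tails of positive order vanish at b = 0, so [derive_norm_le] compares
    them. *)
Lemma exp_tail0 m v (b : R) : nc v <= 1 -> 0 <= b -> nc (ctail m (b%:C * v)) <= etail m b.
Proof.
move=> v1; elim: m b => [|m IH] b b0.
  rewrite /ctail /etail !big_ord0 !subr0 nc_cexp ler_expR Re_realM.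
  by rewrite ler_piMr // (le_trans (ler_norm _)) // (le_trans (nc_Re _)).
apply: nc_rot => c c1.
have z0 (u : C) : ctail m.+1 (0%:C * u) = 0.
  rewrite /ctail mul0r cexp0 big_ord_recl /= expr0 fact0 divr1 big1 ?addr0 ?subrr // => i _.
  by rewrite expr0n /= mul0r.
pose f (t : R) := Re (c * ctail m.+1 (t%:C * v)).
pose g (t : R) := Re (ctail m.+1 (t%:C * 1)).
have df x (_ : 0 <= x <= b) := (cderivZ c (cderiv_ctail m v x)).1.
have dg x (_ : 0 <= x <= b) := (cderiv_ctail m 1 x).1.
have B x : 0 <= x <= b -> `|Re (c * (v * ctail m (x%:C * v)))| <= Re (1 * ctail m (x%:C * 1)).
  move=> /andP[x0 _]; rewrite mul1r -etailE (le_trans (nc_Re _)) // !normcM.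
  rewrite (le_trans _ (IH x x0)) // mulrA ler_piMl ?nc_ge0 //.
  by rewrite mulr_ile1 ?nc_ge0.
have f0 : f 0 = 0 by rewrite /f z0 mulr0.
have g0 : g 0 = 0 by rewrite /g z0.
have : `|f b - f 0| <= g b - g 0 by exact: derive_norm_le b0 df dg B.
by rewrite f0 g0 !subr0 etailE.
Qed.

Lemma exp_tail m u (b : R) : nc u <= b -> nc (ctail m u) <= etail m b.
Proof.
move=> ub; have b0 := le_trans (nc_ge0 u) ub.
move: b0; rewrite le_eqVlt => /predU1P[b0|b0].
  have u0 : u = 0 by apply/eqP; rewrite -nc_eq0 eq_le nc_ge0 b0 ub.
  have := @exp_tail0 m 0 b; rewrite mulr0 normc0 -{1}b0 u0 lexx ler01; exact.
have -> : u = b%:C * (u / b%:C) by rewrite mulrC divfK // -nc_eq0 nc_real normr_eq0 gt_eqF.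
apply: exp_tail0; rewrite ?(ltW b0) // nc_div nc_real gtr0_norm // ler_pdivrMr // mul1r //.
Qed.

Lemma etail_ge0 m (b : R) : 0 <= b -> 0 <= etail m b.
Proof. by move=> b0; rewrite (le_trans (nc_ge0 _) (exp_tail m (_ : nc b%:C <= b))) // nc_real ger0_norm. Qed.

Lemma etail_le m (b : R) : 0 <= b -> etail m b <= expR b.
Proof. by move=> b0; rewrite gerBl; apply: sumr_ge0 => i _; rewrite divr_ge0 ?exprn_ge0 ?ler0n. Qed.

Lemma etail_cvg (b : R) : (fun m => etail m b) @ \oo --> (0 : R).
Proof.
rewrite -(subrr (expR b)); apply: cvgB; first exact: cvg_cst.
have := is_cvg_series_exp_coeff b; rewrite /expR => /cvg_ex[l hl].
rewrite (cvg_lim _ hl) //.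
have -> : (fun m => \sum_(k < m) b ^+ k / k`!%:R) = series (exp_coeff b).
  by apply/funext => m; rewrite /series /= big_mkord.
exact: hl.
Qed.

Lemma exp_term_le k (b : R) : 0 <= b -> b ^+ k / k`!%:R <= expR b.
Proof.
move=> b0; have := etail_ge0 k.+1 b0; rewrite /etail subr_ge0 big_ord_recr /=; apply: le_trans.
by rewrite lerDr; apply: sumr_ge0 => i _; rewrite divr_ge0 ?exprn_ge0 ?ler0n.
Qed.

Definition approxp (F : C -> C) (r : R) := forall tau : R, 0 < tau ->
  exists T : {poly C}, forall z, nc z <= r -> nc (F z - T.[z]) <= tau.

(* Holomorphy is replaced by uniform approximation by polynomials with a
   prescribed coefficient, for which Cauchy's estimate is a finite sum. *)
Definition taylor (F : C -> C) (a : nat -> C) (r : R) := forall (tau : R) k, 0 < tau ->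
  exists T : {poly C}, T`_k = a k /\ forall z, nc z <= r -> nc (F z - T.[z]) <= tau.

Lemma taylor_approxp F a r : taylor F a r -> approxp F r.
Proof. by move=> H tau /(H tau 0)[T [_ HT]]; exists T. Qed.

Lemma taylor_cauchy F a (r B : R) k : 0 < r -> taylor F a r ->
  (forall z, nc z = r -> nc (F z) <= B) -> nc (a k) * r ^+ k <= B.
Proof.
move=> r0 H HB; apply/ler_addgt0Pr => tau tau0.
have [T [<- HT]] := H tau k tau0; apply: poly_cauchy => // z zr.
rewrite -[T.[z]](subKr (F z)) (le_trans (ncB _ _)) // lerD ?HB ?HT ?zr //.
Qed.

Lemma taylorB F G a b r : taylor F a r -> taylor G b r ->
  taylor (fun z => F z - G z) (fun k => a k - b k) r.
Proof.
move=> HF HG tau k tau0; have t2 : 0 < tau / 2 by rewrite divr_gt0.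
have [T [<- HT]] := HF _ k t2; have [U [<- HU]] := HG _ k t2.
exists (T - U); split; first by rewrite coefB.
move=> z zr; rewrite hornerD hornerN.
rewrite (_ : _ - _ - _ = (F z - T.[z]) - (G z - U.[z])); last by ring.
rewrite (le_trans (ncB _ _)) // [leRHS]splitr lerD ?HT ?HU //.
Qed.

Lemma approxp_mul_lin F s (r : R) : 0 <= r -> approxp F r -> approxp (fun z => (s + z) * F z) r.
Proof.
move=> r0 H tau tau0; have D0 : 0 < nc s + r + 1.
  by rewrite ltr_wpDl // addr_ge0 ?nc_ge0.
have [T HT] := H (tau / (nc s + r + 1)) (divr_gt0 tau0 D0).
exists ((s%:P + 'X) * T) => z zr; rewrite !hornerE -mulrBr normcM.
rewrite -[leRHS](@divfK _ (nc s + r + 1)) ?gt_eqF // mulrC ler_pM ?nc_ge0 ?HT //.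
by rewrite (le_trans (ncD _ _)) // -addrA lerD2l (le_trans zr) // lerDl.
Qed.

(** [two_circles] for a polynomial T close to G. An error of at most L1 / 2, L2 / 2 and U halves the
    lower bounds and gives |T(0)| <= 2U, whence the quotients 4U / L. *)
Lemma two_circles_fun (G : C -> C) (r1 r r2 L1 L2 U : R) K : 0 < r1 <= r -> r < r2 ->
  approxp G r2 -> 0 < L1 -> 0 < L2 -> 0 < U ->
  (forall z, nc z <= r2 -> L2 <= nc (G z)) ->
  (forall z, nc z = r1 -> L1 <= nc (G z)) -> nc (G 0) <= U ->
  forall z, nc z <= r -> ln (nc (G z)) <= ln (4 * U) +
    2 * ln (4 * U / L1) * K%:R * (r / r1) ^+ K + 2 * ln (4 * U / L2) * ((r / r2) ^+ K / (1 - r / r2)).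
Proof.
move=> /andP[r10 r1r] rr2 HG L10 L20 U0 H2 H1 HU z zr.
pose tau := Num.min (L1 / 2) (Num.min (L2 / 2) U).
have tau0 : 0 < tau by rewrite !lt_min U0 !divr_gt0.
have [T HT] := HG _ tau0.
have tau1 : tau <= L1 / 2 by rewrite /tau ge_min lexx.
have tau2 : tau <= L2 / 2 by rewrite /tau ge_min [X in _ || X]ge_min lexx orbT.
have tau3 : tau <= U by rewrite /tau ge_min [X in _ || X]ge_min lexx !orbT.
have Tl (y : C) : nc y <= r2 -> nc (G y) - tau <= nc T.[y].
  by move=> /HT h; have := nc_subl (G y) T.[y]; lra.
have Tu (y : C) : nc y <= r2 -> nc T.[y] <= nc (G y) + tau.
  by move=> /HT h; have := nc_subr (G y) T.[y]; lra.
have T2 (y : C) : nc y <= r2 -> L2 / 2 <= nc T.[y].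
  by move=> hy; have := Tl y hy; have := H2 y hy; lra.
have r20 : 0 <= r2 by lra.
have n0 : nc (0 : C) <= r2 by rewrite normc0.
have T0 : 0 < nc T.[0] by have := T2 0 n0; lra.
have T0U : nc T.[0] <= 2 * U by have := Tu 0 n0; lra.
have A (L : R) (y : C) : 0 < L -> L / 2 <= nc T.[y] -> 0 <= ln (4 * U / L) + ln (nc T.[y] / nc T.[0]).
  move=> L0 h; have h0 : 0 < nc T.[y] by rewrite (lt_le_trans _ h) // divr_gt0.
  rewrite -lnM ?posrE ?divr_gt0 ?mulr_gt0 // ln_ge0 //.
  rewrite mulrACA -invfM ler_pdivlMr ?mulr_gt0 // mul1r.
  have : L * nc T.[0] <= L * (2 * U) by rewrite ler_pM2l.
  have : U * (L / 2) <= U * nc T.[y] by rewrite ler_pM2l.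
  lra.
have r1r2 : r1 <= r2 by lra.
have := @two_circles R T r1 r r2 (ln (4 * U / L1)) (ln (4 * U / L2)) K.
rewrite r10 r1r => /(_ isT rr2) W.
have : ln (nc T.[z] / nc T.[0]) <= 2 * ln (4 * U / L1) * K%:R * (r / r1) ^+ K +
    2 * ln (4 * U / L2) * ((r / r2) ^+ K / (1 - r / r2)).
  apply: W => // y hy.
  - by rewrite -nc_gt0 (lt_le_trans _ (T2 y hy)) // divr_gt0.
  - apply: A => //; have hy2 : nc y <= r2 by rewrite hy.
    by have := Tl y hy2; have := H1 y hy; lra.
  - by apply: A => //; apply: T2; rewrite hy.
have zr2 : nc z <= r2 by lra.
have Tz0 : 0 < nc T.[z] by have := T2 z zr2; lra.
have E : ln (nc T.[z] / nc T.[0]) = ln (nc T.[z]) - ln (nc T.[0]) by rewrite ln_div ?posrE.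
have g1 : ln (nc (G z)) <= ln 2 + ln (nc T.[z]).
  rewrite -lnM ?posrE // ler_ln ?posrE ?mulr_gt0 //; last by have := H2 z zr2; lra.
  by have := Tl z zr2; have := T2 z zr2; lra.
have g2 : ln (nc T.[0]) <= ln (2 * U) by rewrite ler_ln ?posrE // mulr_gt0.
have g3 : ln (4 * U) = ln 2 + ln (2 * U).
  by rewrite -lnM ?posrE ?mulr_gt0 // mulrA -natrM.
rewrite E g3; set X := 2 * _ * _ * _; set Y := 2 * _ * _.
lra.
Qed.

Lemma taylor_poly F (a : nat -> C) r : (forall tau : R, 0 < tau -> exists N : nat, forall m, (N <= m)%N ->
    forall z, nc z <= r -> nc (F z - \sum_(k < m) a k * z ^+ k) <= tau) -> taylor F a r.
Proof.
move=> H tau k tau0; have [N HN] := H tau tau0.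
(* The length also exceeds k, so that the coefficient of index k is [a k] even when N is small. *)
exists (\poly_(i < maxn N k.+1) a i); split.
  by rewrite coef_poly leq_max ltnSn orbT.
by move=> z zr; rewrite horner_poly; apply: HN => //; rewrite leq_max leqnn.
Qed.

Lemma cvg_sum0 n (u : 'I_n -> nat -> R) : (forall j, u j @ \oo --> (0 : R)) ->
  (fun m => \sum_(j < n) u j m) @ \oo --> (0 : R).
Proof.
elim: n u => [|n IH] u H.
  by under eq_fun do rewrite big_ord0; exact: cvg_cst.
have K : (fun m => \sum_(j < n) u (widen_ord (leqnSn n) j) m + u ord_max m) @ \oo --> (0 + 0 : R).
  by apply: cvgD; [exact: IH|exact: H].
by rewrite addr0 in K; under eq_fun do rewrite big_ord_recr.
Qed.

Lemma taylor_expsum n (c : 'I_n -> C) (l : 'I_n -> R) (r : R) : 0 <= r ->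
  taylor (fun z => \sum_(j < n) c j * cexp (z * (l j)%:C))
    (fun k => \sum_(j < n) c j * ((l j)%:C ^+ k / k`!%:R)) r.
Proof.
move=> r0; apply: taylor_poly => tau tau0.
have : (fun m => \sum_(j < n) nc (c j) * etail m (r * `|l j|)) @ \oo --> (0 : R).
  apply: (cvg_sum0 (u := fun j m => nc (c j) * etail m (r * `|l j|))) => j.
  by apply: cvg0M; exact: etail_cvg.
move=> /cvgrPdist_le/(_ _ tau0)[N _ HN]; exists N => m Nm z zr.
have := HN m Nm; rewrite sub0r normrN; apply: le_trans; apply: le_trans (ler_norm _).
rewrite (_ : _ - _ = \sum_(j < n) c j * ctail m (z * (l j)%:C)); last first.
  rewrite /ctail; under [RHS]eq_bigr do rewrite mulrBr; rewrite sumrB; congr (_ - _).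
  under eq_bigr do rewrite mulr_suml; rewrite exchange_big; apply: eq_bigr => j _.
  by rewrite mulr_sumr; apply: eq_bigr => k _; rewrite exprMn; ring.
rewrite (le_trans (nc_sum _ _ _)) //; apply: ler_sum => j _; rewrite normcM ler_wpM2l ?nc_ge0 //.
by apply: exp_tail; rewrite normcM nc_real ler_wpM2r.
Qed.

End Taylor.

(** * Taylor coefficients of 1/(s zeta(s)) at 5 + it *)

Section Coef.
Variable R : realType.
Local Notation C := R[i].
Local Notation nc := (@normc R).
Local Notation Re := (@complex.Re R).
Local Notation Im := (@complex.Im R).
Local Notation mu := (@lebesgue_measure R).
Local Notation itg D f := (mu.-integrable D (EFin \o f)).
Local Notation mT f := (measurable_fun (setT : set (measurableTypeR R)) f).
Local Notation I1 := (@I01 R).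
Local Notation mI1 := (@mI01 R).
Implicit Types (s z u v : C) (x y t : R).

Definition s5 t : C := Complex 5 t.
Definition lnk k x : R := ln x ^+ k / k`!%:R.
(* The k-th Taylor coefficient of w at 5 + it. *)
Definition wk t k : C := Mel (fun x => M1i x * lnk k x) (s5 t).

(** This is one term of the series of exp |ln x| = 1/x; the bound is uniform in k. *)
Lemma lnk_le k x : 0 < x <= 1 -> `|lnk k x| <= x^-1.
Proof.
move=> /andP[x0 x1]; rewrite /lnk normrM normrX normfV (ger0_norm (ler0n _ _)).
rewrite (le_trans (exp_term_le k (normr_ge0 (ln x)))) // ler0_norm ?ln_le0 //.
by rewrite -lnV ?posrE // lnK // posrE invr_gt0.
Qed.

Lemma meas_lnk k : mT (lnk k).
Proof.
apply: measurable_funM; last exact: measurable_cst.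
by apply: measurable_funX; exact: measurable_ln.
Qed.

Lemma meas_wk k : mT (fun x => M1i x * lnk k x).
Proof. by apply: measurable_funM; [exact: meas_M1i|exact: meas_lnk]. Qed.

Lemma wk_dom k x : 0 < x <= 1 -> `|M1i x * lnk k x| <= 1 * x `^ (- 2).
Proof.
move=> hx; have /andP[x0 x1] := hx; rewrite mul1r pwN2 // normrM ler_pM // ?M1i_le ?lnk_le //.
Qed.

Lemma wk_citg t k : citg I1 (fun x => (M1i x * lnk k x)%:C * cpow x (s5 t - 1)).
Proof.
apply: (mel_itg (measT01 (meas_wk k)) _ (@wk_dom k)) => /=; lra.
Qed.

(** The integrand majorises the Taylor remainder of [w] at 5 + it on the disc of radius 2: x^3 is
    1/x, from |M(1/x)| <= 1/x, times |x^(4 + it)|, and - 2 ln x bounds |z ln x|. *)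
Lemma etail_int_cvg :
  (fun m => \int[mu]_(x in I1) (x `^ 3 * etail m (- (2 * ln x)))) @ \oo --> (0 : R).
Proof.
have b0 x : I1 x -> 0 <= - (2 * ln x).
  by move=> /in_I01/andP[x0 x1]; rewrite oppr_ge0 pmulr_rle0 // ln_le0.
rewrite (_ : (0 : R) = \int[mu]_(x in I1) 0); last by rewrite /Rintegral integral0.
apply: (@Rint_dct _ _ _ _ (fun x => x `^ 1)).
- exact: mI1.
- move=> m; apply: measurable_funM; first exact: measurable_funTS (measurable_powR _).
  have ml : measurable_fun I1 (fun x => - (2 * ln x)).
    apply: measurableT_comp => //; apply: measurable_funM; first exact: measurable_cst.
    exact: meas_ln.
  apply: measurable_funB; first exact: measurableT_comp ml.
  apply: measurable_sum => k; apply: measurable_funM; last exact: measurable_cst.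
  exact: measurable_funX.
- exact: measurable_cst.
- by apply: itg_powR => //; lra.
- move=> x m hx; have /andP[x0 x1] := in_I01 hx.
  rewrite ger0_norm ?mulr_ge0 ?powR_ge0 ?etail_ge0 ?b0 //.
  rewrite (_ : x `^ 1 = x `^ 3 * x `^ (-2)); last by rewrite -pwD //; congr (_ `^ _); ring.
  rewrite ler_wpM2l ?powR_ge0 // (le_trans (etail_le _ (b0 x hx))) //.
  by rewrite /powR (gt_eqF x0) mulNr.
move=> x _; apply: cvg0M; exact: etail_cvg.
Qed.

Lemma taylor_w t : taylor (fun z => w (s5 t + z)) (wk t) 2.
Proof.
apply: taylor_poly => tau tau0; have t4 : 0 < tau / 2 by lra.
have /cvgrPdist_le/(_ _ t4)[N _ HN] := etail_int_cvg.
exists N => m Nm z z2.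
have bM x : 0 < x <= 1 -> `|M1i x| <= 1 * x `^ (- 1).
  by move=> /andP[x0 _]; rewrite mul1r pwN1 // M1i_le.
have z2' : - 2 <= Re z by have := le_trans (nc_Re z) z2; rewrite ler_norml => /andP[].
have s1 : 1 < Re (s5 t + z) by rewrite cReD /=; lra.
have iw := mel_itg (measT01 (@meas_M1i R)) s1 bM.
have ik (k : 'I_m) := citgZ (z ^+ k) mI1 (wk_citg t k).
pose h x := x `^ 3 * etail m (- (2 * ln x)).
have E x : I1 x -> (M1i x)%:C * cpow x (s5 t + z - 1) -
    \sum_(k < m) z ^+ k * ((M1i x * lnk k x)%:C * cpow x (s5 t - 1)) =
    (M1i x)%:C * cpow x (s5 t - 1) * ctail m (z * (ln x)%:C).
  move=> _; rewrite /ctail mulrBr; congr (_ - _).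
    by rewrite -mulrA; congr (_ * _); rewrite -[cexp _]/(cpow x z) -cpowD addrAC.
  rewrite mulr_sumr; apply: eq_bigr => k _.
  by rewrite exprMn /lnk rmorphM rmorphM rmorphXn fmorphV rmorph_nat; ring.
have id1 := eq_citg mI1 E (citgB mI1 iw (citg_sum _ mI1 ik)).
have -> : w (s5 t + z) - \sum_(k < m) wk t k * z ^+ k =
    Cint I1 (fun x => (M1i x)%:C * cpow x (s5 t - 1) * ctail m (z * (ln x)%:C)).
  rewrite -(eq_Cint E) (CintB mI1 iw (citg_sum _ mI1 ik)) (Cint_sum _ mI1 ik).
  congr (_ - _); apply: eq_bigr => k _; rewrite mulrC; exact: esym (CintZ _ mI1 (wk_citg t k)).
have H0 x : I1 x -> 0 <= h x.
  move=> /in_I01/andP[x0 x1]; rewrite mulr_ge0 ?powR_ge0 // etail_ge0 //.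
  by rewrite oppr_ge0 pmulr_rle0 // ln_le0.
have hi : itg I1 h.
  apply: (@itg_le _ _ _ (fun x => x `^ 1)).
  - exact: mI1.
  - apply: measurable_funM; first exact: measurable_funTS (measurable_powR _).
    have ml : measurable_fun I1 (fun x => - (2 * ln x)).
      apply: measurableT_comp => //; apply: measurable_funM; first exact: measurable_cst.
      exact: meas_ln.
    apply: measurable_funB; first exact: measurableT_comp ml.
    apply: measurable_sum => k; apply: measurable_funM; last exact: measurable_cst.
    exact: measurable_funX.
  - by apply: itg_powR => //; lra.
  - move=> x hx; have /andP[x0 x1] := in_I01 hx.
    have b0 : 0 <= - (2 * ln x) by rewrite oppr_ge0 pmulr_rle0 // ln_le0.
    rewrite ger0_norm ?H0 //.
    rewrite (_ : x `^ 1 = x `^ 3 * x `^ (-2)); last by rewrite -pwD //; congr (_ `^ _); ring.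
    rewrite ler_wpM2l ?powR_ge0 // (le_trans (etail_le _ b0)) //.
    by rewrite /powR (gt_eqF x0) mulNr.
have L : nc (Cint I1 (fun x => (M1i x)%:C * cpow x (s5 t - 1) * ctail m (z * (ln x)%:C))) <=
    2 * \int[mu]_(x in I1) h x.
  apply: Cint_le => //; first exact: mI1.
  move=> x /in_I01/andP[x0 x1]; rewrite !normcM nc_real nc_cpow // cReD cReN /=.
  rewrite /h; have -> : x `^ 3 = x^-1 * x `^ (5 - 1).
    by rewrite -pwN1 // -pwD //; congr (_ `^ _); ring.
  apply: ler_pM; rewrite ?mulr_ge0 ?powR_ge0 ?nc_ge0 //.
    by rewrite ler_wpM2r ?powR_ge0 // M1i_le.
  apply: exp_tail; rewrite normcM nc_real ler0_norm ?ln_le0 // mulrN lerN2.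
  by rewrite ler_wnM2r // ln_le0.
apply: (le_trans L); have := HN m Nm; rewrite sub0r normrN => /(le_trans (ler_norm _)).
rewrite -/h; lra.
Qed.

Section Bounds.
Variables (p be : R).
Hypothesis be01 : 0 < be < 1.

(* The terms in \sum_j c j * th j come from ]1, +oo[, where rho(theta/x) is
   theta/x. *)
Definition approx (ep : R) n (c th : 'I_n -> R) : Prop := (forall j, 0 < th j <= 1) /\
    `|\sum_(j < n) c j * th j| <= ep /\
    forall s, be <= Re s -> s != 1 ->
     nc (zt s * (\sum_(j < n) (c j)%:C * cpow (th j) s) - s ^- 2 -
         (\sum_(j < n) c j * th j)%:C / (s - 1)) <= ep.

Definition Pf n (c th : 'I_n -> R) s : C := \sum_(j < n) (c j)%:C * cpow (th j) s.
(** The k-th Taylor coefficient of [Pf c th] at 5 + it. *)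
Definition pk n (c th : 'I_n -> R) t k : C :=
  \sum_(j < n) (c j)%:C * cpow (th j) (s5 t) * ((ln (th j))%:C ^+ k / k`!%:R).

Lemma taylor_P n (c th : 'I_n -> R) t (r : R) : 0 <= r ->
  taylor (fun z => Pf c th (s5 t + z)) (pk c th t) r.
Proof.
move=> r0; have -> : (fun z => Pf c th (s5 t + z)) =
   (fun z => \sum_(j < n) (c j)%:C * cpow (th j) (s5 t) * cexp (z * (ln (th j))%:C)).
  by apply/funext => z; apply: eq_bigr => j _; rewrite cpowD mulrA.
exact: taylor_expsum.
Qed.

Variables (ep : R) (n : nat) (c th : 'I_n -> R).
Hypothesis ap : approx ep c th.
Local Notation P := (Pf c th).

Lemma ap_ge0 : 0 <= ep. Proof. by have [_ [h _]] := ap; exact: le_trans h. Qed.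

Lemma be_gt0 s : be <= Re s -> 0 < Re s. Proof. by move=> h; have /andP[h1 _] := be01; lra. Qed.

(** Away from the pole 1 / |s - 1| <= 8, so that dropping the polar term costs 8 [ep] more. *)
Lemma zP_far s : be <= Re s -> 8^-1 <= nc (s - 1) -> nc (zt s * P s - s ^- 2) <= 9 * ep.
Proof.
move=> sb far; have [_ [he H]] := ap; have ep0 := ap_ge0.
have s1 : s - 1 != 0 by rewrite -nc_gt0 (lt_le_trans _ far) // invr_gt0.
have := H s sb; rewrite -subr_eq0 => /(_ s1) Hs.
set e := \sum_(j < n) c j * th j in he Hs.
rewrite -(subrK (e%:C / (s - 1)) (_ - s ^- 2)) (le_trans (ncD _ _)) //.
have K : nc (e%:C / (s - 1)) <= 8 * ep.
  rewrite nc_div nc_real ler_pdivrMr ?nc_gt0 //.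
  apply: (@le_trans _ _ (8 * ep * 8^-1)); first by rewrite mulrAC mulfV ?mul1r // lt0r_neq0.
  by rewrite ler_wpM2l // mulr_ge0.
rewrite (_ : 9 * ep = ep + 8 * ep); last by ring.
by rewrite lerD.
Qed.

Lemma s2_neq0 s : 0 < Re s -> s != 0.
Proof. by move=> h; have := Re_neq0 h; rewrite subr0. Qed.

Lemma zP_far1 s : be <= Re s -> 8^-1 <= nc (s - 1) -> 18 * ep * nc s ^+ 2 <= 1 ->
  nc (s * zt s * (s * P s) - 1) <= 2^-1.
Proof.
move=> sb far h; have s0 := s2_neq0 (be_gt0 sb).
have -> : s * zt s * (s * P s) - 1 = s ^+ 2 * (zt s * P s - s ^- 2).
  by rewrite [RHS]mulrBr divff ?expf_neq0 //; ring.
rewrite normcM ncX (le_trans (ler_wpM2l _ (zP_far sb far))) ?exprn_ge0 ?nc_ge0 //; lra.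
Qed.

(** The product of [s * zt s] and [s * P s] is within 1/2 of 1, and |[s * zt s]| = O(|s|). So P has
    no zero here, but the bound decays like 1/|s|, which the large circle has to absorb. *)
Lemma P_low s : be <= Re s -> 8^-1 <= nc (s - 1) -> 18 * ep * nc s ^+ 2 <= 1 ->
  (2 * (8 + 2 / be) * nc s)^-1 <= nc (s * P s).
Proof.
move=> sb far h; have s0 := s2_neq0 (be_gt0 sb); have /andP[be0 be1] := be01.
have ns0 : 0 < nc s by rewrite nc_gt0.
have H := zP_far1 sb far h.
have := nc_subr (s * zt s * (s * P s)) 1; rewrite normc1 => H2.
have H3 : 2^-1 <= nc (s * zt s * (s * P s)) by lra.
have A : nc (zt s) <= 8 + 2 / be.
  rewrite (le_trans (zt_up (be_gt0 sb) far)) // lerD2l ler_wpM2l // lef_pV2 ?posrE //.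
  exact: be_gt0.
have A0 : 0 < 8 + 2 / be by rewrite ltr_pwDl // divr_ge0 // ltW.
rewrite !normcM in H3 *; rewrite invfM ler_pdivrMr //.
rewrite -div1r ler_pdivrMr ?mulr_gt0 //.
have : nc s * nc (zt s) * (nc s * nc (P s)) <= nc s * (8 + 2 / be) * (nc s * nc (P s)).
  by rewrite ler_wpM2r ?mulr_ge0 ?nc_ge0 // ler_wpM2l ?nc_ge0.
nra.
Qed.

Lemma far3 s : 3 <= Re s -> 8^-1 <= nc (s - 1).
Proof. by move=> h; rewrite (le_trans _ (nc_Re _)) // cReD cReN /= ger0_norm; lra. Qed.

Lemma szt3 s : 3 <= Re s -> 2^-1 <= nc (s * zt s) <= 3 / 2.
Proof.
move=> h; have := zt_sub1 h; have := nc_subr (s * zt s) 1; have := nc_subl (s * zt s) 1.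
by rewrite normc1; move=> *; apply/andP; split; lra.
Qed.

Lemma be3 s : 3 <= Re s -> be <= Re s. Proof. by have /andP[_ h] := be01; lra. Qed.

(** Both [s * zt s] and its product with [s * P s] are within 1/2 of 1; 1/3 and 3 are the extreme
    quotients. *)
Lemma P_right s : 3 <= Re s -> 18 * ep * nc s ^+ 2 <= 1 -> 3^-1 <= nc (s * P s) <= 3.
Proof.
move=> s3 h; have H := zP_far1 (be3 s3) (far3 s3) h.
have /andP[h1 h2] := szt3 s3.
have := nc_subr (s * zt s * (s * P s)) 1; have := nc_subl (s * zt s * (s * P s)) 1.
rewrite normc1 (normcM (s * zt s)) => a1 a2; have := nc_ge0 (s * P s) => b0.
apply/andP; split.
  have : nc (s * zt s) * nc (s * P s) <= 3 / 2 * nc (s * P s) by rewrite ler_wpM2r.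
  lra.
have : 2^-1 * nc (s * P s) <= nc (s * zt s) * nc (s * P s) by rewrite ler_wpM2r.
lra.
Qed.

Lemma P_w s : 3 <= Re s -> nc (P s - w s) <= 18 * ep * nc s.
Proof.
move=> s3; have H := zP_far (be3 s3) (far3 s3).
have s0 := s2_neq0 (be_gt0 (be3 s3)).
have /andP[h1 h2] := szt3 s3.
have E : s * zt s * (P s - w s) = s * (zt s * P s - s ^- 2).
  have e1 : s * s ^- 2 = s^-1 by rewrite expr2 invfM mulVKf.
  by rewrite [RHS]mulrBr [LHS]mulrBr zt_w // e1; ring.
have : nc (s * zt s) * nc (P s - w s) <= nc s * (9 * ep).
  by rewrite -normcM E normcM ler_wpM2l ?nc_ge0.
have : 2^-1 * nc (P s - w s) <= nc (s * zt s) * nc (P s - w s) by rewrite ler_wpM2r ?nc_ge0.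
lra.
Qed.

Lemma nc_s5 t : nc (s5 t) <= 5 + `|t|.
Proof. by rewrite (le_trans (nc_le_ReIm _)) //= ger0_norm. Qed.

(** Cauchy's estimate for the difference on the circle of radius 2, which lies in the half-plane of
    [P_w]; 7 + |t| bounds |s| there. *)
Lemma pk_wk t k : nc (pk c th t k - wk t k) * 2 ^+ k <= 18 * ep * (7 + `|t|).
Proof.
have r2 : 0 <= (2 : R) by [].
have T := taylorB (taylor_P c th t r2) (taylor_w t).
have r20 : 0 < (2 : R) by [].
apply: (taylor_cauchy k r20 T) => // z z2.
apply: (le_trans (P_w _)).
  rewrite cReD /=; have := nc_Re z; rewrite z2 ler_norml => /andP[]; lra.
rewrite ler_wpM2l ?mulr_ge0 ?ap_ge0 // (le_trans (ncD _ _)) // z2.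
have := nc_s5 t; lra.
Qed.

Lemma nc_s5D t z (r : R) : nc z <= r -> `|t| - r <= nc (s5 t + z) <= 5 + `|t| + r.
Proof.
move=> zr; apply/andP; split; last by rewrite (le_trans (ncD _ _)) // lerD // nc_s5.
apply: (@le_trans _ _ (nc (s5 t) - nc z)).
  by rewrite lerB // (le_trans _ (nc_Im _)).
by have := nc_subl (s5 t) (- z); rewrite ncN opprK.
Qed.

Lemma s5_disc t z : nc z <= 5 - be -> be <= Re (s5 t + z).
Proof. by have := nc_Re z; rewrite cReD /= ler_norml => /andP[h _] h2; lra. Qed.

Lemma s5_far t z : 6 <= `|t| -> nc z <= 5 - be -> 8^-1 <= nc (s5 t + z - 1).
Proof.
move=> t6 zr; have /andP[b0 b1] := be01.
rewrite (le_trans _ (nc_Im _)) // cImD cImN cImD /= subr0.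
have := nc_Im z; have := lerB_normD t (Im z); lra.
Qed.

(** [two_circles_fun] for s P(s), on circles of radii 2 and 5 - be. The choice of K multiplies the
    logarithm of the lower bound on the large circle by eta; |t| >= 6 keeps the disc away from the
    pole. *)
Lemma P_big t (r eta : R) K : 2 <= r -> r < 5 - be -> 6 <= `|t| -> 18 * ep * (10 + `|t|) ^+ 2 <= 1 ->
  2 * ((r / (5 - be)) ^+ K / (1 - r / (5 - be))) <= eta ->
  forall z, nc z <= r -> ln (nc ((s5 t + z) * P (s5 t + z))) <=
    ln (4 * 3) + 2 * ln (4 * 3 / 3^-1) * K%:R * (r / 2) ^+ K
      + eta * ln (24 * (8 + 2 / be) * (10 + `|t|)).
Proof.
move=> r2 rr t6 he hK z zr; have /andP[b0 b1] := be01; have ep0 := ap_ge0.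
have A0 : 8 <= 8 + 2 / be by rewrite lerDl divr_ge0 // ltW.
have t10 : 0 < 10 + `|t| by lra.
have R0 : 0 <= 5 - be by lra.
have he2 z' : nc z' <= 5 - be -> 18 * ep * nc (s5 t + z') ^+ 2 <= 1.
  move=> h; apply: le_trans he; rewrite ler_wpM2l ?mulr_ge0 //.
  rewrite ler_pXn2r ?nnegrE ?nc_ge0 ?(ltW t10) //.
  by have /andP[_ h1] := nc_s5D t h; lra.
pose L2 : R := (2 * (8 + 2 / be) * (10 + `|t|))^-1.
have L20 : 0 < L2 by rewrite invr_gt0 !mulr_gt0 //; lra.
have L10 : 0 < (3^-1 : R) by rewrite invr_gt0.
have U0 : 0 < (3 : R) by [].
have r1r : 0 < (2 : R) <= r by rewrite r2 andbT.
have G := approxp_mul_lin (s5 t) R0 (taylor_approxp (taylor_P c th t R0)).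
have H2 z' : nc z' <= 5 - be -> L2 <= nc ((s5 t + z') * P (s5 t + z')).
  move=> h; have far := s5_far t6 h; have sb := s5_disc t h.
  apply: le_trans (P_low sb far (he2 z' h)).
  have s0 : 0 < nc (s5 t + z') by rewrite nc_gt0 s2_neq0 // be_gt0.
  rewrite /L2 lef_pV2 ?posrE ?mulr_gt0 //; try lra.
  by rewrite ler_wpM2l ?mulr_ge0 //; [lra|have /andP[_ h1] := nc_s5D t h; lra].
have H1 z' : nc z' = 2 -> 3^-1 <= nc ((s5 t + z') * P (s5 t + z')).
  move=> h; have s3 : 3 <= Re (s5 t + z').
    by rewrite cReD /=; have := nc_Re z'; rewrite h ler_norml => /andP[]; lra.
  have hz : nc z' <= 5 - be by rewrite h; lra.
  by have /andP[] := P_right s3 (he2 z' hz).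
have HU : nc ((s5 t + 0) * P (s5 t + 0)) <= 3.
  have s3 : 3 <= Re (s5 t + 0) by rewrite cReD /=; lra.
  have hz : nc (0 : C) <= 5 - be by rewrite normc0.
  by have /andP[] := P_right s3 (he2 0 hz).
have := two_circles_fun K r1r rr G L10 L20 U0 H2 H1 HU zr.
move=> /le_trans; apply; rewrite lerD2l -mulrA mulrCA.
have -> : 4 * 3 / L2 = 24 * (8 + 2 / be) * (10 + `|t|) by rewrite /L2 invrK; ring.
rewrite mulrC ler_wpM2r // ln_ge0 //; nra.
Qed.

(** Dividing by |s| turns the exponent eta into eta - 1. The constant 16 comes from |s| >= |t| - 5
    >= (10 + |t|) / 16 for |t| >= 6. *)
Lemma P_big_le t (r eta : R) K : 0 < eta < 1 -> 2 <= r -> r < 5 - be -> 6 <= `|t| ->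
  18 * ep * (10 + `|t|) ^+ 2 <= 1 ->
  2 * ((r / (5 - be)) ^+ K / (1 - r / (5 - be))) <= eta ->
  forall z, nc z <= r -> nc (P (s5 t + z)) <=
    16 * expR (ln (4 * 3) + 2 * ln (4 * 3 / 3^-1) * K%:R * (r / 2) ^+ K
      + eta * ln (24 * (8 + 2 / be))) * (10 + `|t|) `^ (eta - 1).
Proof.
move=> /andP[eta0 eta1] r2 rr t6 he hK z zr; have /andP[b0 b1] := be01.
have L := P_big r2 rr t6 he hK zr.
have zb : nc z <= 5 - be by rewrite (le_trans zr) // ltW.
have sb := s5_disc t zb.
have ep0 := ap_ge0.
have t10 : 0 < 10 + `|t| by rewrite ltr_pwDl.
have /andP[lo0 hi0] := nc_s5D t zb.
have hi : nc (s5 t + z) <= 10 + `|t| by lra.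
have lo : (10 + `|t|) / 16 <= nc (s5 t + z) by lra.
have A0 : 0 < 24 * (8 + 2 / be) by rewrite mulr_gt0 // ltr_pwDl // divr_ge0 // ltW.
have he2 : 18 * ep * nc (s5 t + z) ^+ 2 <= 1.
  apply: le_trans he; rewrite ler_wpM2l ?mulr_ge0 //.
  by rewrite ler_pXn2r ?nnegrE ?nc_ge0 ?(ltW t10).
have G0 : 0 < nc ((s5 t + z) * P (s5 t + z)).
  apply: lt_le_trans (P_low sb (s5_far t6 zb) he2).
  rewrite invr_gt0 mulr_gt0 //; last by rewrite nc_gt0 s2_neq0 // be_gt0.
  by rewrite mulr_gt0 // ltr_pwDl // divr_ge0 // ltW.
rewrite (lnM A0 t10) (mulrDr eta (ln _)) addrA in L.
set BL := expR _; have E : nc ((s5 t + z) * P (s5 t + z)) <= BL * (10 + `|t|) `^ eta.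
  by rewrite -[leLHS]lnK ?posrE // /BL /powR (gt_eqF t10) -expRD ler_expR.
set T := (10 + `|t|) `^ (eta - 1).
have TE : (10 + `|t|) `^ eta = T * (10 + `|t|).
  by rewrite /T -{3}(powRr1 (ltW t10)) -pwD // subrK.
rewrite normcM TE in E; rewrite -(ler_pM2r t10).
have F : (10 + `|t|) / 16 * nc (P (s5 t + z)) <= nc (s5 t + z) * nc (P (s5 t + z)).
  by rewrite ler_wpM2r ?nc_ge0.
by have := le_trans F E; clearbody BL T; lra.
Qed.

Lemma P_one : P 1 = (\sum_(j < n) c j * th j)%:C.
Proof.
have [hth _] := ap; rewrite /Pf rmorph_sum; apply: eq_bigr => j _.
by rewrite (cpow_nat 1) ?expr1 ?rmorphM //; have /andP[] := hth j.
Qed.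

(** Multiplication by s - 1 cancels the pole, and [zt_low1] permits division by (s - 1) zeta(s) / s.
    At s = 1, where [zt] has a default value, [P_one] gives P directly. *)
Lemma P_near1 s : ep <= 1 -> be <= Re s -> nc (s - 1) <= 8^-1 -> nc (P s) <= 4.
Proof.
move=> ep1 sb near; have [_ [he H]] := ap; have ep0 := ap_ge0.
have [->|s1] := eqVneq s 1; first by rewrite P_one nc_real; lra.
have s10 : s - 1 != 0 by rewrite subr_eq0.
have := H s sb s1; have := zt_low1 near s1; rewrite -/(P s).
set e := \sum_(j < n) c j * th j in he *.
set D := _ - _ / _ => h1 hD.
have sn : 7 / 8 <= nc s.
  have := nc_subr (s - 1) (-1); rewrite ncN normc1 opprK subrK; lra.
have sn2 : nc (s ^- 2) <= 2.
  rewrite normcV ncX invf_ple ?posrE ?exprn_gt0 //; [nra|lra].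
have E : (s - 1) * zt s * P s = (s - 1) * (D + s ^- 2) + e%:C.
  by rewrite /D; field; rewrite s10 s2_neq0 // be_gt0.
have : nc ((s - 1) * zt s * P s) <= 8^-1 * 3 + 1.
  rewrite E (le_trans (ncD _ _)) // lerD ?nc_real ?(le_trans he) // normcM.
  rewrite ler_pM ?nc_ge0 // (le_trans (ncD _ _)) //; lra.
rewrite normcM; have := nc_ge0 (P s); nra.
Qed.

Lemma P_far_small s (c0 : R) : ep <= 1 -> be <= Re s -> 8^-1 <= nc (s - 1) -> 0 < c0 -> c0 <= nc (zt s) ->
  nc (P s) <= (be ^- 2 + 9) / c0.
Proof.
move=> ep1 sb far c00 hc; have /andP[b0 b1] := be01.
rewrite ler_pdivlMr // mulrC; apply: (@le_trans _ _ (nc (zt s) * nc (P s))).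
  by rewrite ler_wpM2r ?nc_ge0.
rewrite -normcM -(subrK (s ^- 2) (zt s * P s)) (le_trans (ncD _ _)) // addrC lerD //.
  rewrite normcV ncX lef_pV2 ?posrE ?exprn_gt0 //; last by rewrite nc_gt0 s2_neq0 // be_gt0.
  by rewrite ler_pXn2r ?nnegrE ?nc_ge0 ?(ltW b0) // (le_trans sb) // (le_trans (ler_norm _)) // nc_Re.
by rewrite (le_trans (zP_far sb far)) // ler_piMr.
Qed.

Lemma P_le s : 0 <= Re s -> nc (P s) <= \sum_(j < n) `|c j|.
Proof.
move=> s0; rewrite (le_trans (nc_sum _ _ _)) //; apply: ler_sum => j _.
have [hth _] := ap; have /andP[t0 t1] := hth j.
by rewrite normcM nc_real ler_piMr // nc_cpow // pw_le1.
Qed.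

(** s^2 [zt s] P(s) is within 1/2 of 1 while |P(s)| is at most the sum of the |[c j]|. One fixed
    approximation thus bounds zeta from below in a bounded region, and through [P_far_small] this
    bounds every other approximation there. *)
Lemma zt_low s : ep <= (18 * 16 ^+ 2)^-1 -> be <= Re s -> 8^-1 <= nc (s - 1) -> nc s <= 16 ->
  (2 * 16 ^+ 2 * (\sum_(j < n) `|c j| + 1))^-1 <= nc (zt s).
Proof.
move=> he sb far s16; have ep0 := ap_ge0.
have S0 : 0 <= \sum_(j < n) `|c j| by apply: sumr_ge0.
have n2 : nc s ^+ 2 <= 16 ^+ 2 by rewrite ler_pXn2r ?nnegrE ?nc_ge0.
have h : 18 * ep * nc s ^+ 2 <= 1.
  apply: (@le_trans _ _ (18 * (18 * 16 ^+ 2)^-1 * 16 ^+ 2)).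
    by rewrite ler_pM ?mulr_ge0 ?exprn_ge0 ?nc_ge0 // ler_wpM2l.
  by rewrite le_eqVlt; apply/orP; left; apply/eqP; field.
have H := zP_far1 sb far h.
have := nc_subr (s * zt s * (s * P s)) 1; rewrite normc1 => H2.
have H3 : 2^-1 <= nc (s * zt s * (s * P s)) by lra.
have hP := P_le (ltW (be_gt0 sb)).
have D0 : 0 < 2 * 16 ^+ 2 * (\sum_(j < n) `|c j| + 1) by rewrite !mulr_gt0 ?ltr_wpDl.
rewrite -div1r ler_pdivrMr //.
have E : nc (s * zt s * (s * P s)) = nc s ^+ 2 * (nc (zt s) * nc (P s)).
  by rewrite !normcM; ring.
have : nc s ^+ 2 * (nc (zt s) * nc (P s)) <= 16 ^+ 2 * (nc (zt s) * (\sum_(j < n) `|c j| + 1)).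
  rewrite ler_pM ?mulr_ge0 ?nc_ge0 ?exprn_ge0 ?nc_ge0 //.
  by rewrite ler_wpM2l ?nc_ge0 // (le_trans hP) // lerDl.
by rewrite -E; lra.
Qed.

End Bounds.

Lemma geo_small (q eta : R) : 0 <= q < 1 -> 0 < eta -> exists K : nat, 2 * (q ^+ K / (1 - q)) <= eta.
Proof.
move=> /andP[q0 q1] eta0.
have H : (fun K : nat => q ^+ K) @ \oo --> (0 : R) by apply: cvg_expr; rewrite ger0_norm.
have e0 : 0 < eta / 2 * (1 - q) by rewrite mulr_gt0 ?divr_gt0 // subr_gt0.
have /cvgrPdist_le/(_ _ e0)[K _ HK] := H; exists K.
have := HK K (leqnn _); rewrite /= sub0r normrN ger0_norm ?exprn_ge0 // => h.
have : q ^+ K / (1 - q) <= eta / 2 by rewrite ler_pdivrMr // subr_gt0.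
lra.
Qed.

Lemma small_t_pow t (eta : R) : `|t| < 6 -> 0 < eta < 1 -> 16^-1 <= (10 + `|t|) `^ (eta - 1).
Proof.
move=> t6 /andP[eta0 eta1]; have t10 : 0 < 10 + `|t| by rewrite ltr_pwDl.
have e1 : 0 <= 1 - eta by rewrite subr_ge0 ltW.
apply: (@le_trans _ _ (16 `^ (eta - 1))).
  rewrite -pwN1 // ler_powR ?ler1n //; lra.
rewrite -(opprB 1 eta) !powRN lef_pV2 ?posrE ?powR_gt0 //.
by apply: ge0_ler_powR; rewrite ?nnegrE ?(ltW t10) //; lra.
Qed.

(** Each coefficient of [w] is a limit of coefficients of approximations chosen in terms of t and k,
    whereas the bound for P on the circle of radius 5 - be is the same for all of them. *)
Lemma wk_bound (p be eta : R) : 1 < p -> p^-1 < be < 1 -> 0 < eta < 1 ->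
  LpC_closure p%:E (Beurling_space R) (fun x : R => (lambda x)%:C) ->
  exists2 B : R, 0 < B & forall t k, nc (wk t k) * (5 - be) ^+ k <= B * (10 + `|t|) `^ (eta - 1).
Proof.
move=> p1 /andP[be1 be2] /andP[eta0 eta1] Hc.
(* The approximations are used up to Re s = b, so that the circle of radius 5 - b is strictly larger
   than that of radius 5 - be. *)
pose b := (p^-1 + be) / 2.
have p0 : 0 < p^-1 by rewrite invr_gt0; lra.
have eta01 : 0 < eta < 1 by rewrite eta0.
have pb : p^-1 < b < 1 by rewrite /b; apply/andP; split; lra.
have b01 : 0 < b < 1 by rewrite /b; apply/andP; split; lra.
have bbe : b < be by rewrite /b; lra.
have /andP[b0 b1] := b01.
have AP (ep : R) : 0 < ep -> exists n (c th : 'I_n -> R), approx b ep c th.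
  by move=> e0; have [n [c [th [h1 [h2 h3]]]]] := approx_zt p1 pb e0 Hc; exists n, c, th; split.
pose r := 5 - be.
have r2 : 2 <= r by rewrite /r; lra.
have rr : r < 5 - b by rewrite /r; lra.
have r0 : 0 < r by lra.
have q01 : 0 <= r / (5 - b) < 1.
  by rewrite divr_ge0 ?ltr_pdivrMr ?mul1r ?rr //=; lra.
have [K hK] := geo_small q01 eta0.
have e00 : 0 < ((18 * 16 ^+ 2)^-1 : R) by rewrite invr_gt0.
(* The approximation, fixed before t and k, that bounds zeta from below at low height. *)
have [n0 [c0 [th0 ap0]]] := AP _ e00.
pose z0 : R := (2 * 16 ^+ 2 * (\sum_(j < n0) `|c0 j| + 1))^-1.
have z00 : 0 < z0 by rewrite invr_gt0 !mulr_gt0 // ltr_wpDl // sumr_ge0.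
pose BS := (b ^- 2 + 9) / z0 + 4.
have BS0 : 0 < BS by rewrite /BS ltr_pwDr // divr_ge0 ?(ltW z00) // addr_ge0 // invr_ge0 exprn_ge0 // ltW.
pose BL := expR (ln (4 * 3) + 2 * ln (4 * 3 / 3^-1) * K%:R * (r / 2) ^+ K + eta * ln (24 * (8 + 2 / b))).
have BL0 : 0 < BL by exact: expR_gt0.
pose B := 16 * BS + 16 * BL.
have B0 : 0 < B by rewrite addr_gt0 ?mulr_gt0.
exists B => // t k.
have t10 : 0 < 10 + `|t| by rewrite ltr_pwDl.
set T := (10 + `|t|) `^ (eta - 1).
have T0 : 0 < T by rewrite powR_gt0.
apply/ler_addgt0Pr => tau tau0.
have rk0 : 0 < r ^+ k by rewrite exprn_gt0.
(* The three bounds serve the estimates at low height, the lower bounds for P at height t, and the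
   passage from [wk] to [pk] at order k. *)
pose ep := Num.min 1 (Num.min (18 * (10 + `|t|) ^+ 2)^-1 (tau / (18 * (10 + `|t|) * r ^+ k))).
have ep0 : 0 < ep.
  by rewrite !lt_min ltr01 invr_gt0 divr_gt0 ?mulr_gt0 ?exprn_gt0.
have ep1 : ep <= 1 by rewrite /ep ge_min lexx.
have ep2 : 18 * ep * (10 + `|t|) ^+ 2 <= 1.
  have : ep <= (18 * (10 + `|t|) ^+ 2)^-1 by rewrite /ep ge_min [X in _ || X]ge_min lexx orbT.
  by rewrite -div1r ler_pdivlMr ?mulr_gt0 ?exprn_gt0 // mulrA [ep * 18]mulrC.
have ep3 : 18 * ep * (10 + `|t|) * r ^+ k <= tau.
  have : ep <= tau / (18 * (10 + `|t|) * r ^+ k).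
    by rewrite /ep ge_min [X in _ || X]ge_min lexx !orbT.
  by rewrite ler_pdivlMr ?mulr_gt0 // => h; rewrite (le_trans _ h) // le_eqVlt; apply/orP; left; apply/eqP; ring.
have [n [c [th ap]]] := AP _ ep0.
have W := pk_wk b01 ap t k.
have Wr : nc (wk t k - pk c th t k) * r ^+ k <= tau.
  apply: le_trans ep3; rewrite ler_wpM2r ?(ltW rk0) //.
  apply: (@le_trans _ _ (18 * ep * (7 + `|t|))); last by rewrite ler_wpM2l ?mulr_ge0 ?(ltW ep0) // lerD2r ler_nat.
  apply: le_trans W; rewrite nc_dist ler_peMr ?nc_ge0 // exprn_ege1 // ler1n //.
rewrite -(subrK (pk c th t k) (wk t k)).
apply: (@le_trans _ _ ((nc (wk t k - pk c th t k) + nc (pk c th t k)) * r ^+ k)).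
  by rewrite ler_wpM2r ?(ltW rk0) // ncD.
rewrite mulrDl addrC lerD //.
apply: (taylor_cauchy k r0 (taylor_P c th t (ltW r0))) => z zr.
have zr' : nc z <= r by rewrite zr.
have zb : nc z <= 5 - b by rewrite zr ltW.
have sb := s5_disc t zb.
have [t6|t6] := leP 6 `|t|.
  apply: (le_trans (P_big_le b01 ap eta01 r2 rr t6 ep2 hK zr')); rewrite ler_wpM2r ?(ltW T0) //.
  by rewrite lerDr mulr_ge0 // ltW.
have s16 : nc (s5 t + z) <= 16 by have /andP[_ h1] := nc_s5D t zb; clear -h1 t6 b0; lra.
have PB : nc (Pf c th (s5 t + z)) <= BS.
  have [near|far] := leP (nc (s5 t + z - 1)) 8^-1.
    rewrite (le_trans (P_near1 b01 ap ep1 sb near)) // /BS lerDr divr_ge0 ?(ltW z00) //.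
    by rewrite addr_ge0 // invr_ge0 exprn_ge0 // ltW.
  have zl := zt_low b01 ap0 (lexx _) sb (ltW far) s16.
  rewrite (le_trans (P_far_small b01 ap ep1 sb (ltW far) z00 zl)) // /BS lerDl //.
have T16 : 16^-1 <= T by exact: small_t_pow.
apply: (le_trans PB); apply: (@le_trans _ _ (16 * BS * 16^-1)); first by rewrite mulrAC mulfV ?mul1r.
apply: ler_pM => //; [by rewrite mulr_ge0 // ltW|by rewrite lerDl mulr_ge0 // ltW].
Qed.

End Coef.

(** * Gaussian inversion and the pointwise bound on M *)

Section Gauss.
Variable R : realType.
Local Notation mu := (@lebesgue_measure R).
Local Notation itg D f := (mu.-integrable D (EFin \o f)).
Local Notation TT := (setT : set (measurableTypeR R)).
Local Notation mT f := (measurable_fun (setT : set (measurableTypeR R)) f).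
Implicit Types (x y t u v : R) (a l : R -> R).

Local Notation gs := (@gauss_fun R).

Lemma meas_gs : mT gs. Proof. exact: measurable_gauss_fun. Qed.
Lemma itg_gs : itg TT gs. Proof. exact: integrableT_gauss. Qed.

Lemma itg_gs_half : itg TT (fun u => gs (2^-1 * u)).
Proof.
have m : mT (fun u => gs (2^-1 * u)).
  by apply: measurableT_comp; [exact: meas_gs|exact: mulrl_measurable].
have c0 : 0 < (2^-1 : R) by rewrite invr_gt0.
have H := ge0_scale c0 measurableT (proj2 (measurable_EFinP _ _) meas_gs)
  (fun x => (_ : (0 <= (gs x)%:E)%E)).
apply/integrableP; split; first exact/measurable_EFinP.
rewrite (_ : (fun x => `|(EFin \o (fun u => gs (2^-1 * u))) x|)%E = (fun x => (gs (2^-1 * x))%:E)); last first.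
  by apply/funext => x /=; rewrite ger0_norm ?gauss_fun_ge0.
have := H (fun x => gauss_fun_ge0 x); rewrite preimage_setT => ->.
by rewrite integralT_gauss -EFinM ltry.
Qed.

Lemma gs_half u : `|u| * gs u <= gs (2^-1 * u).
Proof.
rewrite /gauss_fun (_ : - (2^-1 * u) ^+ 2 = (3 / 4 * u ^+ 2) + (- u ^+ 2)); last by field.
rewrite expRD ler_wpM2r ?expR_ge0 //; apply: le_trans (expR_ge1Dx _).
rewrite -(real_normK (num_real u)); have := sqr_ge0 (`|u| - 2 / 3); set y := `|u|; lra.
Qed.

Definition gauss_cos v : R := \int[mu]_(u in TT) (gs u * cos (v * u)).
Definition gauss_cos' v : R := \int[mu]_(u in TT) (gs u * (- sin (v * u) * u)).

Lemma meas_cos v : mT (fun u => cos (v * u)).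
Proof.
apply: measurableT_comp; last exact: mulrl_measurable.
by apply: continuous_measurable_fun; exact: continuous_cos.
Qed.

Lemma meas_sin v : mT (fun u => sin (v * u)).
Proof.
apply: measurableT_comp; last exact: mulrl_measurable.
by apply: continuous_measurable_fun; exact: continuous_sin.
Qed.

Lemma cos_le1 y : `|cos y| <= 1. Proof. by rewrite ler_norml cos_geN1 cos_le1. Qed.
Lemma sin_le1 y : `|sin y| <= 1. Proof. by rewrite ler_norml sin_geN1 sin_le1. Qed.

Lemma itg_gcos v : itg TT (fun u => gs u * cos (v * u)).
Proof.
apply: (itg_le _ _ itg_gs) => //.
  by apply: measurable_funM; [exact: meas_gs|exact: meas_cos].
by move=> u _; rewrite normrM (ger0_norm (gauss_fun_ge0 u)) ler_piMr ?gauss_fun_ge0 ?cos_le1.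
Qed.

Lemma gsin_dom v u : `|gs u * (- sin (v * u) * u)| <= gs (2^-1 * u).
Proof.
apply: le_trans (gs_half u); rewrite normrM (ger0_norm (gauss_fun_ge0 u)) mulrC.
by rewrite ler_wpM2r ?gauss_fun_ge0 // normrM normrN ler_piMl ?sin_le1.
Qed.

Lemma itg_gsin v : itg TT (fun u => gs u * (- sin (v * u) * u)).
Proof.
apply: (itg_le _ _ itg_gs_half) => //; last by move=> u _; exact: gsin_dom.
apply: measurable_funM; first exact: meas_gs.
apply: measurable_funM; last exact: measurable_id.
by apply: measurableT_comp => //; exact: meas_sin.
Qed.

Lemma d_gcos u v : is_derive v (1:R) (fun v => gs u * cos (v * u)) (gs u * (- sin (v * u) * u)).
Proof.
have d1 : is_derive v (1:R) (fun t => t * u) u.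
  by have := dvM (dvid v) (dvcst u v); rewrite mul1r mulr0 addr0.
exact: dvZ (@dvcomp R (@cos R) (fun t => t * u) v _ _ (is_derive_cos _) d1).
Qed.

Lemma d_gF v : is_derive v (1:R) gauss_cos (gauss_cos' v).
Proof.
have E x y : partial1of2 (fun v u => gs u * cos (v * u)) x y = gs y * (- sin (x * y) * y).
  by rewrite partial1of2E; have d := d_gcos y x; exact: derive_val.
have Iv : (`]v - 1, v + 1[%classic : set R) v by rewrite /= in_itv /=; apply/andP; split; lra.
have i1 x : (`]v - 1, v + 1[%classic : set R) x -> itg TT ((fun v u => gs u * cos (v * u)) x).
  by move=> _; exact: itg_gcos.
have i2 x y : (`]v - 1, v + 1[%classic : set R) x -> TT y -> derivable ((fun v u => gs u * cos (v * u)) ^~ y) x 1.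
  by move=> _ _; have d := d_gcos y x; exact: ex_derive.
have i3 (y : measurableTypeR R) : 0 <= gs (2^-1 * y) by exact: gauss_fun_ge0.
have i4 x y : (`]v - 1, v + 1[%classic : set R) x -> TT y ->
   `|partial1of2 (fun v u => gs u * cos (v * u)) x y| <= gs (2^-1 * y).
  by move=> _ _; rewrite E; exact: gsin_dom.
have mTT : measurable TT by [].
have D := @derivable_under_integral R _ _ mu (fun v u => gs u * cos (v * u)) TT mTT v (v - 1) (v + 1)
  Iv i1 i2 (fun u => gs (2^-1 * u)) i3 itg_gs_half i4.
have V := @differentiation_under_integral R _ _ mu (fun v u => gs u * cos (v * u)) TT mTT v (v - 1) (v + 1)
  Iv i1 i2 (fun u => gs (2^-1 * u)) i3 itg_gs_half i4.
rewrite (_ : gauss_cos' v = derive1 gauss_cos v).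
  by rewrite derive1E; apply: DeriveDef.
by rewrite [RHS]V; apply: eq_Rint => u _; rewrite E.
Qed.

Lemma d_gs u : is_derive u (1:R) gs (- (2 * u) * gs u).
Proof.
have d := @dvcomp R (@expR R) (fun t => -1 * t ^+ 2) u _ _ (is_derive_expR _) (dvZ (-1) (dvX 2 u)).
have E : gs = (fun t => expR (-1 * t ^+ 2)) by apply/funext => t; rewrite mulN1r.
rewrite {1}E; move: d; rewrite /= expr1 => d.
have -> // : - (2 * u) * gs u = expR (-1 * u ^+ 2) * (-1 * (2 * u)).
by rewrite E; ring.
Qed.

(** The integrand of 2 F' + v F is the derivative of exp(-u^2) sin(v u), which vanishes at both
    infinities. *)
Lemma gF_ibp v : 2 * gauss_cos' v = - v * gauss_cos v.
Proof.
pose F u := gs u * sin (v * u).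
pose f u := 2 * (gs u * (- sin (v * u) * u)) + v * (gs u * cos (v * u)).
have dF u : is_derive u (1:R) F (f u).
  have d1 : is_derive u (1:R) (fun t => v * t) v.
    by have := dvM (dvcst v u) (dvid u); rewrite mul0r mulr1 add0r.
  have d2 := dvM (d_gs u) (@dvcomp R (@sin R) (fun t => v * t) u _ _ (is_derive_sin _) d1).
  by rewrite (_ : f u = - (2 * u) * gs u * sin (v * u) + gs u * (cos (v * u) * v)) // /f; ring.
have fi : itg TT f.
  apply: itgD => //; apply: itgZ => //; [exact: itg_gsin|exact: itg_gcos].
suff H : \int[mu]_(u in TT) f u = 0.
  move: H; rewrite /f RintegralD //; last 2 first.
  - by apply: itgZ => //; exact: itg_gsin.
  - by apply: itgZ => //; exact: itg_gcos.
  rewrite RintegralZl //; last exact: itg_gsin.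
  rewrite RintegralZl //; last exact: itg_gcos.
  rewrite -/(gauss_cos' v) -/(gauss_cos v); lra.
have cf u : {for u, continuous f}.
  have cc (g : R -> R) dg : is_derive u (1:R) g dg -> {for u, continuous g}.
    by move=> d; apply: differentiable_continuous; apply/derivable1_diffP; exact: ex_derive.
  have d1 : is_derive u (1:R) (fun t => v * t) v.
    by have := dvM (dvcst v u) (dvid u); rewrite mul0r mulr1 add0r.
  have cs := cc _ _ (@dvcomp R (@sin R) (fun t => v * t) u _ _ (is_derive_sin _) d1).
  have cco := cc _ _ (@dvcomp R (@cos R) (fun t => v * t) u _ _ (is_derive_cos _) d1).
  have cg := cc _ _ (d_gs u).
  have ci : {for u, continuous (fun t : R => t)} by exact: cvg_id.
  apply: cvgD; apply: cvgM; try exact: cvg_cst; apply: cvgM => //.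
  by apply: cvgM => //; exact: cvgN.
have C : (fun n : nat => \int[mu]_(u in TT) (\1_(`[- n.+1%:R, n.+1%:R]) u * f u)) @ \oo --> \int[mu]_(u in TT) f u.
  apply: (@Rint_dct _ _ _ _ (fun u => `|f u|)) => //.
  - move=> n; apply: measurable_funM; last exact: itg_meas fi.
    by apply: measurable_indic; exact: measurable_itv.
  - exact: itg_meas fi.
  - exact: itg_norm fi.
  - by move=> u n _; rewrite normrM ler_piMl // indicE; case: (_ \in _); rewrite ?normr1 ?normr0.
  move=> u _; apply: cvg_near_cst; near=> n.
  rewrite indicE mem_set ?mul1r //= in_itv /= -ler_norml.
  rewrite (le_trans (_ : _ <= n%:R)) ?ler_nat //; near: n; exact: nbhs_infty_ger.
have E n : \int[mu]_(u in TT) (\1_(`[- n.+1%:R, n.+1%:R]) u * f u) = 2 * F n.+1%:R.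
  have -> : 2 * F n.+1%:R = F n.+1%:R - F (- n.+1%:R).
    by rewrite /F /gauss_fun sqrrN mulrN sinN; ring.
  have n0 : - n.+1%:R < (n.+1%:R : R) by rewrite gtrN ?ltr0n.
  have FT : \int[mu]_(x in `[- n.+1%:R, n.+1%:R]) f x = F n.+1%:R - F (- n.+1%:R).
    apply: (@Rint_FTC _ _ F) => //.
    by apply: continuous_subspaceT => x; exact: cf.
  rewrite -FT [RHS]Rintegral_mkcond; apply: eq_Rint => u _.
  by rewrite patchE indicE; case: (_ \in _); rewrite ?mul1r ?mul0r.
have L : (fun n : nat => 2 * F n.+1%:R) @ \oo --> (0 : R).
  have L1 : (fun n : nat => 2 * n.+1%:R^-1) @ \oo --> (0 : R) by apply: cvg0M; exact: cvg_invn.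
  apply/norm_cvg0P; apply: squeeze_cvgr (cvg_cst _) L1; near=> n.
  rewrite normr_ge0 /= normrM ger0_norm // ler_wpM2l // /F normrM (ger0_norm (gauss_fun_ge0 _)).
  apply: (@le_trans _ _ (gs n.+1%:R)); first by rewrite ler_piMr ?gauss_fun_ge0 ?sin_le1.
  rewrite /gauss_fun expRN lef_pV2 ?posrE ?expR_gt0 ?ltr0n //.
  apply: le_trans (expR_ge1Dx _); rewrite (@le_trans _ _ (n.+1%:R ^+ 2)) ?lerDr //.
  by rewrite expr2 ler_peMr ?ler0n // ler1n.
have C' : (fun n : nat => 2 * F n.+1%:R) @ \oo --> \int[mu]_(u in TT) f u.
  by under eq_fun do rewrite -E.
by have := cvg_unique _ C' L; apply.
Unshelve. all: by end_near. Qed.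

Lemma gF0 : gauss_cos 0 = Num.sqrt pi.
Proof.
rewrite /gauss_cos; transitivity (\int[mu]_(u in TT) gs u).
  by apply: eq_Rint => u _; rewrite mul0r cos0 mulr1.
by rewrite /Rintegral integralT_gauss.
Qed.

(** By [gF_ibp], the product with exp(v^2 / 4) has derivative 0. *)
Lemma gFE v : gauss_cos v = Num.sqrt pi * expR (- (v ^+ 2 / 4)).
Proof.
pose H v := gauss_cos v * expR (v ^+ 2 / 4).
have dH x : is_derive x (1:R) H 0.
  have d1 : is_derive x (1:R) (fun t : R => t ^+ 2 / 4) (x / 2).
    have := dvM (dvX 2 x) (dvcst 4^-1 x); rewrite /= expr1 mulr0 addr0.
    by rewrite (_ : 2 * x * 4^-1 = x / 2) //; field.
  have := dvM (d_gF x) (@dvcomp R (@expR R) _ x _ _ (is_derive_expR _) d1).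
  rewrite (_ : _ + _ = 0) //; have := gF_ibp x => h.
  have -> : gauss_cos' x = - x * gauss_cos x / 2 by lra.
  by field.
have K (y z : R) : y <= z -> H z = H y.
  move=> yz; have := @derive_norm_le R H (fun=> 0) (fun=> 0) (fun=> 0) y z yz.
  move=> /(_ (fun x _ => dH x) (fun x _ => dvcst 0 x)).
  rewrite subrr => h; have : `|H z - H y| <= 0 by apply: h => x _; rewrite normr0.
  by rewrite normr_le0 subr_eq0 => /eqP.
have HE : H v = H 0.
  by have [h|h] := leP 0 v; [exact: K|apply: esym; apply: K; exact: ltW].
have : gauss_cos v * expR (v ^+ 2 / 4) = Num.sqrt pi.
  by move: HE; rewrite /H expr0n /= mul0r expR0 mulr1 gF0.
by move=> <-; rewrite -mulrA -expRD subrr expR0 mulr1.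
Qed.

Lemma EFin_Rint (D : set (measurableTypeR R)) (g : R -> R) : measurable D -> itg D g ->
  (\int[mu]_(x in D) (g x)%:E = (\int[mu]_(x in D) g x)%R%:E)%E.
Proof. by move=> mD gi; rewrite /Rintegral fineK //; exact: integrable_fin_num gi. Qed.

(** The Gaussian average of the cosine transform of a is a itself integrated against a Gaussian,
    which takes the place of an inversion formula. *)
Lemma gauss_fubini a l : itg TT a -> mT l ->
  itg TT (fun u => gs u * \int[mu]_(x in TT) (a x * cos (l x * u))) /\
  \int[mu]_(u in TT) (gs u * \int[mu]_(x in TT) (a x * cos (l x * u))) =
  \int[mu]_(x in TT) (a x * gauss_cos (l x)).
Proof.
move=> ai ml.
pose f (z : measurableTypeR R * measurableTypeR R) : R := gs z.1 * (a z.2 * cos (l z.2 * z.1)).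
have ma := itg_meas ai.
have mf : measurable_fun setT (EFin \o f).
  apply/measurable_EFinP; apply: measurable_funM.
    by apply: measurableT_comp; [exact: meas_gs|exact: measurable_fst].
  apply: measurable_funM.
    by apply: measurableT_comp; [exact: ma|exact: measurable_snd].
  apply: measurableT_comp; first by apply: continuous_measurable_fun; exact: continuous_cos.
  apply: measurable_funM; last exact: measurable_fst.
  by apply: measurableT_comp; [exact: ml|exact: measurable_snd].
have fle u x : `|f (u, x)| <= gs u * `|a x|.
  rewrite /f /= normrM (ger0_norm (gauss_fun_ge0 u)) ler_wpM2l ?gauss_fun_ge0 // normrM.
  by rewrite ler_piMr ?cos_le1.
have ni := itg_norm measurableT ai.
have fi : (mu \x mu)%E.-integrable setT (EFin \o f).
  apply/(integrable12ltyP _ _ mf).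
  apply: (@le_lt_trans _ _ (\int[mu]_u (gs u * \int[mu]_(x in TT) `|a x|)%:E)%E).
    apply: ge0_le_integral => //.
    - by move=> u _; exact: integral_ge0.
    - apply: (measurable_fun_fubini_tonelli_F (abse \o (EFin \o f))) => //.
      - by apply: measurableT_comp.
      - by move=> z; exact: abse_ge0.
    - apply/measurable_EFinP; apply: measurable_funM; [exact: meas_gs|exact: measurable_cst].
    move=> u _; apply: (@le_trans _ _ (\int[mu]_x (gs u * `|a x|)%:E)%E).
      apply: ge0_le_integral => //.
      - apply: measurableT_comp => //.
        exact: (measurableT_comp mf (measurable_pair1 u)).
      - apply/measurable_EFinP; apply: measurable_funM; [exact: measurable_cst|exact: itg_meas ni].
      - by move=> x _; rewrite lee_fin fle.
    rewrite (EFin_Rint measurableT (itgZ (gs u) measurableT ni)) lee_fin.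
    by rewrite RintegralZl.
  rewrite (EFin_Rint measurableT) ?ltry //.
  by under eq_fun do rewrite mulrC; exact: itgZ itg_gs.
have ac u : itg TT (fun x => a x * cos (l x * u)).
  apply: (itg_le _ _ ni) => //.
    apply: measurable_funM => //; apply: measurableT_comp.
      by apply: continuous_measurable_fun; exact: continuous_cos.
    by apply: measurable_funM => //; exact: measurable_cst.
  by move=> x _; rewrite normrM ler_piMr ?cos_le1.
have E : (\int[mu]_u \int[mu]_x (f (u, x))%:E = \int[mu]_x \int[mu]_u (f (u, x))%:E)%E.
  exact: (Fubini fi).
have IE u : (\int[mu]_x (f (u, x))%:E)%E = (gs u * \int[mu]_(x in TT) (a x * cos (l x * u)))%:E.
  by rewrite (EFin_Rint measurableT (itgZ (gs u) measurableT (ac u))) RintegralZl.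
split.
  by apply: eq_integrable (integrable_fubini_F fi) => // u _; rewrite /= -IE.
transitivity (fine (\int[mu]_u \int[mu]_x (f (u, x))%:E)%E).
  by rewrite {1}/Rintegral; congr fine; apply: eq_integral => u _.
rewrite E /Rintegral; congr fine; apply: eq_integral => x _.
have fx u : f (u, x) = a x * (gs u * cos (l x * u)) by rewrite /f /= mulrCA.
under eq_integral do rewrite fx.
by rewrite (EFin_Rint measurableT (itgZ (a x) measurableT (itg_gcos (l x)))) RintegralZl //; exact: itg_gcos.
Qed.

End Gauss.

(** * Gaussian averages of M in the variable log x *)

Section Kernel.
Variable R : realType.
Local Notation C := R[i].
Local Notation nc := (@normc R).
Local Notation Re := (@complex.Re R).
Local Notation Im := (@complex.Im R).
Local Notation mu := (@lebesgue_measure R).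
Local Notation itg D f := (mu.-integrable D (EFin \o f)).
Local Notation mT f := (measurable_fun (setT : set (measurableTypeR R)) f).
Local Notation TT := (setT : set (measurableTypeR R)).
Local Notation I1 := (@I01 R).
Local Notation mI1 := (@mI01 R).
Local Notation hl := (half_line R : set (measurableTypeR R)).
Local Notation gs := (@gauss_fun R).
Implicit Types (x y t u v V h : R) (a : R -> R) (k : nat).

Lemma pw_ge1 (r y : R) : 0 <= r -> 1 <= y -> 1 <= y `^ r.
Proof.
move=> r0 y1; have := @ge0_ler_powR R r r0 1 y; rewrite powR1 !nnegrE ler01 y1.
by rewrite (le_trans ler01 y1); apply.
Qed.

(** For u > 0, (10 + u / h)^(eta - 1) <= h^(1 - eta) u^(eta - 1), as eta < 1. The power u^(eta - 1)
    integrates to 1 / eta on ]0, 1] and is at most 1 beyond. *)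
Lemma gs_pow_bound (eta h : R) : 0 < eta < 1 -> 0 < h -> itg TT (fun u => gs u * (10 + `|u| / h) `^ (eta - 1)) /\
  \int[mu]_(u in TT) (gs u * (10 + `|u| / h) `^ (eta - 1)) <=
    2 * (eta^-1 + Num.sqrt pi) * h `^ (1 - eta).
Proof.
move=> /andP[e0 e1] h0; set b := fun u => _.
have p0 (u : R) : 0 < 10 + `|u| / h by rewrite ltr_pwDl // divr_ge0 // ltW.
have b0 u : 0 <= b u by rewrite mulr_ge0 ?powR_ge0 ?gauss_fun_ge0.
have bE u : b u = gs u * expR ((eta - 1) * ln (10 + `|u| / h)).
  by rewrite /b /powR gt_eqF.
have cb : continuous b.
  rewrite (_ : b = (fun u => gs u * expR ((eta - 1) * ln (10 + `|u| / h)))); last exact/funext.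
  move=> u; apply: cvgM; first exact: continuous_gauss_fun.
  apply: (@continuous_comp _ _ _ (fun u : R => (eta - 1) * ln (10 + `|u| / h)) (@expR R)); last exact: continuous_expR.
  apply: cvgM; first exact: cvg_cst.
  apply: (@continuous_comp _ _ _ (fun u : R => 10 + `|u| / h) (@ln R)); last exact: continuous_ln.
  apply: cvgD; first exact: cvg_cst.
  by apply: cvgM; [exact: norm_continuous|exact: cvg_cst].
have mb : mT b by exact: continuous_measurable_fun.
have bi : itg TT b.
  apply: (itg_le _ mb (@itg_gs R)) => // u _; rewrite ger0_norm //.
  rewrite ler_piMr ?gauss_fun_ge0 // -(opprB 1 eta) powRN invf_le1 ?powR_gt0 //.
  apply: pw_ge1; first lra.
  have : 0 <= `|u| / h by rewrite divr_ge0 // ltW.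
  lra.
split => //.
have sb : b =1 b \o -%R by move=> u; rewrite /b /= /gauss_fun sqrrN normrN.
have S := ge0_symfun_integralT b0 cb sb.
have sE : [set x : R | 0 <= x] = `[0, +oo[%classic.
  by apply/seteqP; split => x /=; rewrite in_itv /= andbT.
rewrite sE -integral_itv_obnd_cbnd in S; last by apply/measurable_EFinP; exact: measurable_funTS.
have bh : itg hl b by apply: integrableS bi => //; exact: mhl.
rewrite (EFin_Rint measurableT bi) (EFin_Rint (@mhl R) bh) -EFinM in S; case: S => ->.
rewrite -!mulrA ler_pM2l //.
pose d u := h `^ (1 - eta) * ((\1_(I1) u * u `^ (eta - 1)) + gs u).
have i1 : itg hl (fun u => \1_(I1) u * u `^ (eta - 1)).
  apply/(integrable_mkcond _ (@mhl R)).
  rewrite (_ : _ \_ hl = (EFin \o (fun u => u `^ (eta - 1))) \_ I1).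
    by apply/(integrable_mkcond _ mI1); apply: itg_powR => //; lra.
  apply/funext => u; rewrite !patchE /= indicE; case: (boolP (u \in I1)) => uI; last first.
    by rewrite mul0r; case: ifP.
  have /in_I01/andP[u0 _] := set_mem uI.
  by rewrite mul1r ifT // inE /half_line /= in_itv /= u0.
have i2 : itg hl gs by apply: integrableS (@itg_gs R) => //; exact: mhl.
have i12 := itgD (@mhl R) i1 i2.
have di : itg hl d by apply: itgZ i12; exact: mhl.
apply: (@le_trans _ _ (\int[mu]_(u in hl) d u)).
  apply: le_Rintegral => //; first exact: mhl.
  move=> u /in_hl u0; rewrite /b /d.
  have hu : 0 < u / h by rewrite divr_gt0.
  have K : (10 + `|u| / h) `^ (eta - 1) <= h `^ (1 - eta) * u `^ (eta - 1).
    rewrite gtr0_norm // -(opprB 1 eta) !powRN -[h `^ _]invrK -invfM lef_pV2 ?posrE ?mulr_gt0 ?invr_gt0 ?powR_gt0 //.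
    rewrite -powRN -(_ : (u / h) `^ (1 - eta) = h `^ (- (1 - eta)) * u `^ (1 - eta)); last first.
      by rewrite powRM ?invr_ge0 ?(ltW u0) ?(ltW h0) // mulrC powRN -powR_inv1 ?(ltW h0) // -powRrM mulN1r powRN.
    apply: ge0_ler_powR; rewrite ?nnegrE ?(ltW hu) //; try lra.
    by rewrite ltr_pwDl // ltW.
  apply: (@le_trans _ _ (gs u * (h `^ (1 - eta) * u `^ (eta - 1)))).
    by rewrite ler_wpM2l ?gauss_fun_ge0.
  rewrite mulrCA ler_wpM2l ?powR_ge0 // indicE.
  have [u1|u1] := leP u 1.
    rewrite mem_set; last by rewrite /I01 /= in_itv /= u0.
    rewrite mul1r (@le_trans _ _ (u `^ (eta - 1))) ?lerDl ?gauss_fun_ge0 //.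
    by rewrite ler_piMl ?powR_ge0 // gauss_fun_le1.
  rewrite (@le_trans _ _ (gs u)) // ?lerDr ?mulr_ge0 ?powR_ge0 ?ler0n //.
  rewrite ler_piMr ?gauss_fun_ge0 // -(opprB 1 eta) powRN invf_le1 ?powR_gt0 //.
  by apply: pw_ge1; lra.
rewrite RintegralZl //; last exact: mhl.
rewrite mulrC ler_wpM2r ?powR_ge0 // RintegralD //; last exact: mhl.
apply: lerD.
  have -> : \int[mu]_(u in hl) (\1_(I1) u * u `^ (eta - 1)) = \int[mu]_(u in I1) u `^ (eta - 1).
    rewrite [LHS]Rintegral_mkcond [RHS]Rintegral_mkcond; apply: eq_Rint => u _.
    rewrite !patchE /= indicE; case: (boolP (u \in I1)) => uI; last by rewrite mul0r; case: ifP.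
    have /in_I01/andP[u0 _] := set_mem uI.
    by rewrite mul1r ifT // inE /half_line /= in_itv /= u0.
  rewrite Rint_powR //; last by lra.
  by rewrite powR1 subrK mul1r.
have GT := @integralT_gauss R.
rewrite (EFin_Rint measurableT (@itg_gs R)) in GT; case: GT => <-.
rewrite -lee_fin -(EFin_Rint (@mhl R) i2) -(EFin_Rint measurableT (@itg_gs R)).
apply: ge0_subset_integral => //; first exact: mhl.
  by apply/measurable_EFinP; exact: meas_gs.
by move=> u _; rewrite lee_fin gauss_fun_ge0.
Qed.

(** The integrand of [wk] at t = 0. *)
Definition phik k x : R := M1i x * lnk k x * x `^ 4.
(* Gaussian kernel of width h in log x, centred at x = e^(-V). *)
Definition ker h V x : R := expR (- (((ln x + V) / h) ^+ 2 / 4)).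

Lemma meas_arg h V : mT (fun x => (ln x + V) / h).
Proof.
apply: measurable_funM; last exact: measurable_cst.
by apply: measurable_funD; [exact: measurable_ln|exact: measurable_cst].
Qed.

Lemma meas_ker h V : mT (ker h V).
Proof.
apply: measurableT_comp => //; apply: measurableT_comp => //.
apply: measurable_funM; last exact: measurable_cst.
by apply: measurable_funX; exact: meas_arg.
Qed.

Lemma meas_phik k : mT (phik k).
Proof. by apply: measurable_funM; [exact: meas_wk|exact: measurable_powR]. Qed.

Lemma phik_le k x : 0 < x <= 1 -> `|phik k x| <= x `^ 2.
Proof.
move=> hx; have /andP[x0 x1] := hx; rewrite normrM (ger0_norm (powR_ge0 _ _)).
rewrite (_ : x `^ 2 = x `^ (- 2) * x `^ 4); last by rewrite -pwD //; congr (_ `^ _); ring.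
by rewrite ler_wpM2r ?powR_ge0 // (le_trans (wk_dom k hx)) // mul1r.
Qed.

Lemma itg_phik k : itg I1 (phik k).
Proof.
apply: (@itg_le _ _ _ (fun x => x `^ 2)); first exact: mI1.
- exact: measT01 (meas_phik k).
- by apply: itg_powR => //; lra.
- by move=> x /in_I01; exact: phik_le.
Qed.

(** The rotation exp(i u V / h) is what moves the window from x = 1 to x = exp(-V). *)
Lemma Re_wk h V u k :
  \int[mu]_(x in I1) (phik k x * cos ((ln x + V) / h * u)) = Re (cexp (Complex 0 (u / h * V)) * wk (u / h) k).
Proof.
rewrite /wk /Mel -CintZ; [|exact: mI1|exact: wk_citg].
apply: eq_Rint => x /in_I01/andP[x0 _].
rewrite mulrCA Re_realM /phik -[LHS]mulrA; congr (_ * _).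
rewrite /cpow -cexpD; set z := (X in cexp X).
have E : Im z = (ln x + V) / h * u by rewrite /z cImD cImM cImD cImN /=; ring.
rewrite /powR gt_eqF //; transitivity (expR (Re z) * cos (Im z)); last reflexivity.
by rewrite E; congr (expR _ * _); rewrite /z cReD cReM cReD cReN /=; ring.
Qed.

(** Up to the factor sqrt(pi), the kernel is the Gaussian average over u of the cosines in [Re_wk],
    and [wk_bound] is applied at t = u / h. *)
Lemma phik_kernel_bound (p be eta : R) : 1 < p -> p^-1 < be < 1 -> 0 < eta < 1 ->
  LpC_closure p%:E (Beurling_space R) (fun x : R => (lambda x)%:C) ->
  exists2 B : R, 0 < B & forall k V h, 0 < h ->
   `|\int[mu]_(x in I1) (phik k x * ker h V x)| <= B * h `^ (1 - eta) / (5 - be) ^+ k.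
Proof.
move=> p1 hbe he Hc; have [B B0 HB] := wk_bound p1 hbe he Hc; clear Hc.
have s0 : 0 < Num.sqrt (pi : R) by rewrite sqrtr_gt0 pi_gt0.
have /andP[be1 be2] := hbe; have /andP[e0 e1] := he.
exists (B * (2 * (eta^-1 + Num.sqrt pi)) / Num.sqrt pi).
  by rewrite divr_gt0 // mulr_gt0 // mulr_gt0 // addr_gt0 // invr_gt0.
move=> k V h h0.
have r0 : 0 < (5 - be) ^+ k by rewrite exprn_gt0 //; lra.
pose a := (phik k) \_ I1.
have ai : itg TT a.
  by rewrite /a -restrict_EFin; apply/(integrable_mkcond _ mI1); exact: itg_phik.
have EL u : \int[mu]_(x in TT) (a x * cos ((ln x + V) / h * u)) =
   Re (cexp (Complex 0 (u / h * V)) * wk (u / h) k).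
  rewrite -Re_wk [RHS]Rintegral_mkcond; apply: eq_Rint => x _.
  by rewrite /a !patchE; case: ifP => // _; rewrite mul0r.
have ER : \int[mu]_(x in TT) (a x * gauss_cos ((ln x + V) / h)) = Num.sqrt pi * \int[mu]_(x in I1) (phik k x * ker h V x).
  rewrite -RintegralZl; [|exact: mI1|].
    rewrite [RHS]Rintegral_mkcond; apply: eq_Rint => x _.
    rewrite /a !patchE; case: ifP => // _; last by rewrite mul0r.
    by rewrite gFE /ker; ring.
  apply: (@itg_le _ _ _ (fun x => `|phik k x|)); first exact: mI1.
  - by apply: measurable_funM; [exact: measT01 (meas_phik k)|exact: measT01 (meas_ker h V)].
  - by apply: itg_norm (itg_phik k); exact: mI1.
  - move=> x _; rewrite normrM ler_piMr // ger0_norm ?expR_ge0 // -expR0 ler_expR oppr_le0.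
    by rewrite divr_ge0 ?sqr_ge0.
have [bi bb] := gs_pow_bound he h0.
set b := fun u => _ in bi bb.
have W u : `|gs u * \int[mu]_(x in TT) (a x * cos ((ln x + V) / h * u))| <= B / (5 - be) ^+ k * b u.
  rewrite EL normrM (ger0_norm (gauss_fun_ge0 u)) mulrCA ler_wpM2l ?gauss_fun_ge0 //.
  rewrite (le_trans (nc_Re _)) // normcM nc_cexp expR0 mul1r.
  have := HB (u / h) k; rewrite normrM normfV (gtr0_norm h0) => H.
  by rewrite mulrAC ler_pdivlMr.
have [gi F] := gauss_fubini ai (meas_arg h V).
have := Rint_norm_le measurableT gi (itgZ (B / (5 - be) ^+ k) measurableT bi) (fun u _ => W u).
rewrite F ER RintegralZl; [|exact: measurableT|exact: bi].
clear F gi ER EL W; rewrite normrM (gtr0_norm s0) mulrC -ler_pdivlMr //; move=> /le_trans; apply.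
rewrite ler_pdivrMr //; apply: (@le_trans _ _ (B / (5 - be) ^+ k * (2 * (eta^-1 + Num.sqrt pi) * h `^ (1 - eta)))).
  by rewrite ler_wpM2l // divr_ge0 ?ltW.
rewrite le_eqVlt; apply/orP; left; apply/eqP; field.
by rewrite !gt_eqF //; lra.
Qed.

(** By completing the square. The linear decay at 0 compensates |M(1/x)| <= 1/x in
    [kernel_bound]. *)
Lemma ker_le h V x : 0 < h -> 0 < x -> ker h V x <= expR (h ^+ 2 + V) * x.
Proof.
move=> h0 x0; rewrite -{2}(lnK x0) -expRD /ker ler_expR.
set y := ln x + V; rewrite (_ : h ^+ 2 + V + ln x = h ^+ 2 + y); last by rewrite /y; ring.
rewrite -subr_ge0; have -> : h ^+ 2 + y - - ((y / h) ^+ 2 / 4) = (h + y / h / 2) ^+ 2.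
  by field; rewrite gt_eqF.
exact: sqr_ge0.
Qed.

Lemma ker_ge0 h V x : 0 <= ker h V x. Proof. exact: expR_ge0. Qed.

Definition expsum m (b : R) : R := \sum_(k < m) b ^+ k / k`!%:R.

Lemma expsum_le m (b : R) : 0 <= b -> 0 <= expsum m b <= expR b.
Proof.
move=> b0; have := etail_ge0 m b0; rewrite /etail subr_ge0 -/(expsum m b) => ->.
by rewrite andbT; apply: sumr_ge0 => k _; rewrite divr_ge0 ?exprn_ge0.
Qed.

Lemma expsum_cvg (b : R) : (fun m => expsum m b) @ \oo --> expR b.
Proof.
have H : (fun m => expR b - etail m b) @ \oo --> expR b - 0 by apply: cvgB; [exact: cvg_cst|exact: etail_cvg].
rewrite subr0 in H; apply: cvg_trans H; apply: near_eq_cvg; near=> m.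
by rewrite /etail opprB addrC subrK.
Unshelve. all: by end_near. Qed.

Lemma geo_sum_le (q : R) m : 0 <= q < 1 -> \sum_(k < m) q ^+ k <= (1 - q)^-1.
Proof.
move=> /andP[q0 q1]; have q10 : 0 < 1 - q by rewrite subr_gt0.
rewrite -div1r ler_pdivlMr //.
have -> : (\sum_(k < m) q ^+ k) * (1 - q) = 1 - q ^+ m.
  elim: m => [|m IH]; first by rewrite big_ord0 expr0 mul0r subrr.
  by rewrite big_ord_recr /= mulrDl IH exprS; ring.
by rewrite gerBl exprn_ge0.
Qed.

(** On ]0, 1], x^(sg - 1) = x^4 exp((sg - 5) ln x), where the exponential series has nonnegative
    terms, hence dominated partial sums. The k-th term contributes at most a multiple of ((5 - sg) /
    (5 - be))^k, a convergent series since be < sg: this moves the abscissa from 5 to sg. *)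
Lemma kernel_bound (p be eta sg : R) : 1 < p -> p^-1 < be < 1 -> 0 < eta < 1 -> be < sg < 1 ->
  LpC_closure p%:E (Beurling_space R) (fun x : R => (lambda x)%:C) ->
  exists2 B : R, 0 < B & forall V h, 0 < h ->
   `|\int[mu]_(x in I1) (M1i x * x `^ (sg - 1) * ker h V x)| <= B * h `^ (1 - eta).
Proof.
move=> p1 hbe he /andP[sg1 sg2] Hc; have [B B0 HB] := phik_kernel_bound p1 hbe he Hc; clear Hc.
have /andP[be1 be2] := hbe.
have p0 : 0 < p^-1 by rewrite invr_gt0; lra.
pose q := (5 - sg) / (5 - be).
have q01 : 0 <= q < 1 by rewrite divr_ge0 ?ltr_pdivrMr ?mul1r /=; lra.
have q10 : 0 < 1 - q by have /andP[_ ?] := q01; rewrite subr_gt0.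
exists (B / (1 - q)); first by rewrite divr_gt0.
move=> V h h0.
pose L x := (sg - 5) * ln x.
have L0 x : 0 < x <= 1 -> 0 <= L x.
  by move=> /andP[x0 x1]; rewrite /L nmulr_rge0 ?ln_le0 //; lra.
pose f_ m x := M1i x * x `^ 4 * expsum m (L x) * ker h V x.
have ki k : itg I1 (fun x => phik k x * ker h V x).
  apply: (@itg_le _ _ _ (fun x => `|phik k x|)); first exact: mI1.
  - by apply: measurable_funM; [exact: measT01 (meas_phik k)|exact: measT01 (meas_ker h V)].
  - by apply: itg_norm (itg_phik k); exact: mI1.
  - move=> x _; rewrite normrM ler_piMr // ger0_norm ?ker_ge0 // /ker -expR0 ler_expR oppr_le0.
    by rewrite divr_ge0 ?sqr_ge0.
have E m : \int[mu]_(x in I1) f_ m x = \sum_(k < m) (sg - 5) ^+ k * \int[mu]_(x in I1) (phik k x * ker h V x).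
  transitivity (\int[mu]_(x in I1) \sum_(k < m) (sg - 5) ^+ k * (phik k x * ker h V x)).
    apply: eq_Rint => x _; rewrite /f_ /expsum mulr_sumr mulr_suml; apply: eq_bigr => k _.
    by rewrite /phik /lnk /L exprMn; ring.
  rewrite Rint_sum; [|exact: mI1|by move=> k; apply: itgZ (ki k); exact: mI1].
  by apply: eq_bigr => k _; rewrite RintegralZl //; exact: mI1.
have B1 m : `|\int[mu]_(x in I1) f_ m x| <= B / (1 - q) * h `^ (1 - eta).
  rewrite E (le_trans (ler_norm_sum _ _ _)) //.
  apply: (@le_trans _ _ (\sum_(k < m) B * h `^ (1 - eta) * q ^+ k)).
    apply: ler_sum => k _; rewrite normrM normrX ler0_norm; last by lra.
    rewrite opprB /q exprMn mulrCA ler_wpM2l ?exprn_ge0 //; first by lra.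
    by rewrite exprVn; exact: HB.
  by rewrite -mulr_sumr [leRHS]mulrAC ler_wpM2l ?mulr_ge0 ?powR_ge0 ?(ltW B0) // geo_sum_le.
have CV : (fun m => \int[mu]_(x in I1) f_ m x) @ \oo --> \int[mu]_(x in I1) (M1i x * x `^ (sg - 1) * ker h V x).
  apply: (@Rint_dct _ _ _ _ (fun x => expR (h ^+ 2 + V) * x `^ (sg - 1))).
  - exact: mI1.
  - move=> m; apply: measT01; apply: measurable_funM; last exact: meas_ker.
    apply: measurable_funM.
      by apply: measurable_funM; [exact: meas_M1i|exact: measurable_powR].
    apply: measurable_sum => k; apply: measurable_funM; last exact: measurable_cst.
    apply: measurable_funX; apply: measurable_funM; [exact: measurable_cst|exact: measurable_ln].
  - apply: measT01; apply: measurable_funM; last exact: meas_ker.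
    by apply: measurable_funM; [exact: meas_M1i|exact: measurable_powR].
  - by apply: itgZ; [exact: mI1|apply: itg_powR => //; lra].
  - move=> x m /in_I01 hx; have /andP[x0 x1] := hx.
    have /andP[s1 s2] := expsum_le m (L0 x hx).
    rewrite /f_ !normrM (ger0_norm (powR_ge0 _ _)) (ger0_norm s1) (ger0_norm (ker_ge0 _ _ _)).
    have -> : expR (h ^+ 2 + V) * x `^ (sg - 1) = x^-1 * x `^ 4 * x `^ (sg - 5) * (expR (h ^+ 2 + V) * x).
      rewrite [RHS]mulrCA; congr (_ * _).
      rewrite (_ : x^-1 * x `^ 4 * x `^ (sg - 5) * x = x `^ 4 * x `^ (sg - 5)); last by field; rewrite gt_eqF.
      by rewrite -pwD //; congr (_ `^ _); ring.
    apply: ler_pM; rewrite ?mulr_ge0 ?powR_ge0 ?ker_ge0 //; last exact: ker_le.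
    apply: ler_pM; rewrite ?mulr_ge0 ?powR_ge0 //; last by rewrite [leRHS]/powR gt_eqF.
    by rewrite ler_wpM2r ?powR_ge0 // M1i_le.
  - move=> x /in_I01 /andP[x0 x1].
    have -> : M1i x * x `^ (sg - 1) * ker h V x = M1i x * x `^ 4 * expR (L x) * ker h V x.
      rewrite -[X in _ * X * _ = _](_ : x `^ 4 * expR (L x) = _); first by ring.
      have -> : expR (L x) = x `^ (sg - 5) by rewrite /powR gt_eqF.
      by rewrite -pwD //; congr (_ `^ _); ring.
    by apply: cvgM; [apply: cvgM; [exact: cvg_cst|exact: expsum_cvg]|exact: cvg_cst].
have CN : (fun m => `|\int[mu]_(x in I1) f_ m x|) @ \oo --> `|\int[mu]_(x in I1) (M1i x * x `^ (sg - 1) * ker h V x)|.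
  exact: cvg_norm CV.
rewrite -(cvg_lim _ CN) //; apply: limr_le; first by apply/cvg_ex; eexists; exact: CN.
by near=> m; exact: B1.
Unshelve. all: by end_near. Qed.

End Kernel.

(** * From averages of M to values of M *)

Section Pointwise.
Variable R : realType.
Local Notation C := R[i].
Local Notation nc := (@normc R).
Local Notation mu := (@lebesgue_measure R).
Local Notation itg D f := (mu.-integrable D (EFin \o f)).
Local Notation mT f := (measurable_fun (setT : set (measurableTypeR R)) f).
Local Notation I1 := (@I01 R).
Local Notation mI1 := (@mI01 R).
Local Notation hl := (half_line R : set (measurableTypeR R)).
Implicit Types (x y t u v V h : R) (a : R -> R) (k : nat).

Lemma indic_sub (D E : set (measurableTypeR R)) (f : R -> R) : measurable D -> measurable E ->
  D `<=` E -> itg D f ->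
  itg E (fun x => \1_D x * f x) /\ \int[mu]_(x in E) (\1_D x * f x) = \int[mu]_(x in D) f x.
Proof.
move=> mD mE DE fi.
have K : (fun x => \1_D x * f x) \_ E = f \_ D.
  apply/funext => x; rewrite !patchE /= indicE; case: (boolP (x \in D)) => xD.
    by rewrite mul1r ifT // inE; apply: DE; exact: set_mem.
  by rewrite mul0r; case: ifP.
split; last by rewrite [LHS]Rintegral_mkcond K -Rintegral_mkcond.
apply/(integrable_mkcond _ mE); rewrite restrict_EFin K -restrict_EFin.
exact/(integrable_mkcond _ mD).
Qed.

Lemma expR_sub1 (w : R) : `|expR w - 1| <= `|w| * expR `|w|.
Proof.
have [h|h] := leP 0 w.
  rewrite (ger0_norm h) ger0_norm; last by rewrite subr_ge0 -expR0 ler_expR.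
  have := expR_ge1Dx (- w); rewrite expRN => K.
  have e0 := expR_gt0 w.
  have : (1 - w) * expR w <= (expR w)^-1 * expR w by rewrite ler_wpM2r // ltW.
  by rewrite mulVf ?gt_eqF //; lra.
rewrite (ltr0_norm h) ler0_norm; last by rewrite subr_le0 -expR0 ler_expR ltW.
have := expR_ge1Dx w; have : - w * 1 <= - w * expR (- w).
  by rewrite ler_wpM2l // ?oppr_ge0 ?(ltW h) // -expR0 ler_expR oppr_ge0 ltW.
lra.
Qed.

Lemma le_expR (w : R) : w <= expR w.
Proof. by have := expR_ge1Dx w; lra. Qed.

(** With y = n |v|, - y^2 / 4 <= 1 - y, while the first factor grows at most like exp(3y / 4), since
    n >= 8 makes |v| at most y / 4. A decay exp(- y / 4) remains. *)
Lemma ker_dom (n v : R) : 8 <= n ->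
  (n * `|expR (- v) - 1| + 1) * expR (- ((v * n) ^+ 2 / 4)) <= 3 * expR 1 * expR (- (n / 4 * `|v|)).
Proof.
move=> n8; have n0 : 0 < n by lra.
set y := n * `|v|.
have y0 : 0 <= y by rewrite mulr_ge0 // ltW.
have k1 : expR (- ((v * n) ^+ 2 / 4)) <= expR 1 * expR (- y).
  rewrite -expRD ler_expR.
  have -> : (v * n) ^+ 2 = y ^+ 2 by rewrite /y !exprMn real_normK ?num_real //; ring.
  by have := sqr_ge0 (y / 2 - 1); lra.
have v8 : `|v| <= y / 4.
  have : 8 * `|v| <= n * `|v| by rewrite ler_wpM2r.
  by rewrite -/y; have := normr_ge0 v; lra.
have k2 : n * `|expR (- v) - 1| <= 2 * expR (y * (3 / 4)).
  have := expR_sub1 (- v); rewrite normrN => H.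
  apply: (@le_trans _ _ (n * (`|v| * expR `|v|))); first by rewrite ler_wpM2l // ltW.
  have -> : expR (y * (3 / 4)) = expR (y / 2) * expR (y / 4) by rewrite -expRD; congr expR; field.
  rewrite mulrA -/y mulrA; apply: ler_pM; rewrite ?expR_ge0 ?ler_expR //.
  by rewrite -/y; have := le_expR (y / 2); lra.
have k3 : 1 <= expR (y * (3 / 4)) by have := expR_ge1Dx (y * (3 / 4)); lra.
apply: (@le_trans _ _ (3 * expR (y * (3 / 4)) * (expR 1 * expR (- y)))).
  by apply: ler_pM; rewrite ?expR_ge0 ?addr_ge0 ?mulr_ge0 ?(ltW n0) //; lra.
have -> : n / 4 * `|v| = y / 4 by rewrite /y; ring.
have -> : expR (- (y / 4)) = expR (y * (3 / 4)) * expR (- y) by rewrite -expRD; congr expR; field.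
by rewrite le_eqVlt; apply/orP; left; apply/eqP; ring.
Qed.

(** The exponential is a power of n x on either side of x = 1/n, and G adds the two pieces. n >= 8
    keeps n / 4 - sg above n / 8, so that both integrals gain a factor 1/n. *)
Lemma tent_int (n sg : R) : 8 <= n -> 0 < sg < 1 ->
  exists2 G : R -> R, itg I1 G /\ \int[mu]_(x in I1) G x <= 12 * n `^ (- sg - 1) &
    forall x, 0 < x <= 1 -> x `^ (sg - 1) * expR (- (n / 4 * `|ln x + ln n|)) <= G x.
Proof.
move=> n8 /andP[s0 s1]; have n0 : 0 < n by lra.
have in0 : 0 < n^-1 by rewrite invr_gt0.
have in1 : n^-1 < 1 by rewrite invf_lt1 //; lra.
pose a := n / 4; have a2 : 2 <= a by rewrite /a; lra.
have e1 : -1 < sg - 1 + a by lra.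
have sa : sg - a < 0 by lra.
have as0 : 0 < a - sg by lra.
pose D1 : set (measurableTypeR R) := `]0, n^-1]%classic.
pose D2 : set (measurableTypeR R) := `[n^-1, 1]%classic.
have m1 : measurable D1 by exact: measurable_itv.
have m2 : measurable D2 by exact: measurable_itv.
have D1I : D1 `<=` I1 by apply: subset_itvl; rewrite bnd_simp ltW.
have D2I : D2 `<=` I1 by apply: subset_itvr; rewrite bnd_simp.
have i1 : itg D1 (fun x => x `^ (sg - 1 + a)) by exact: itg_powR.
have W2 : {within `[n^-1, 1], continuous (fun x : R => x `^ (sg - 1 - a))}.
  by apply: (@within_cc _ 1) => // x /andP[x0 _]; exact: powR_cont.
have i2 : itg D2 (fun x => x `^ (sg - 1 - a)) by apply: itg_cc.
have [j1 J1] := indic_sub m1 mI1 D1I i1.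
have [j2 J2] := indic_sub m2 mI1 D2I i2.
pose G x := n `^ a * (\1_D1 x * x `^ (sg - 1 + a)) + n `^ (- a) * (\1_D2 x * x `^ (sg - 1 - a)).
have g1 := itgZ (n `^ a) mI1 j1; have g2 := itgZ (n `^ (- a)) mI1 j2.
exists G; first split.
- exact: (itgD mI1 g1 g2).
- rewrite RintegralD //; last exact: mI1.
  rewrite !RintegralZl //; try exact: mI1.
  rewrite J1 J2 Rint_powR //.
  have -> : \int[mu]_(x in D2) x `^ (sg - 1 - a) = (sg - a)^-1 * 1 `^ (sg - a) - (sg - a)^-1 * n^-1 `^ (sg - a).
    apply: (@Rint_FTC _ _ (fun x => (sg - a)^-1 * x `^ (sg - a))) => // x /andP[nx _].
    have x0 : 0 < x by exact: lt_le_trans nx.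
    have d := dvZ (sg - a)^-1 (is_derive1_powR (sg - a) x0).
    have -> // : x `^ (sg - 1 - a) = (sg - a)^-1 * ((sg - a) * x `^ (sg - a - 1)).
    rewrite mulKf ?lt_eqF //.
    by congr (_ `^ _); ring.
  have P (r : R) : n^-1 `^ r = n `^ (- r) by rewrite -powR_inv1 ?(ltW n0) // -powRrM mulN1r.
  rewrite !P powR1 mulr1.
  have A1 : n `^ a * (n `^ (- (sg - 1 + a + 1)) / (sg - 1 + a + 1)) <= 4 * n `^ (- sg - 1).
    rewrite mulrA -pwD //.
    have -> : a + - (sg - 1 + a + 1) = (- sg - 1) + 1 by ring.
    rewrite pwD // powRr1 ?(ltW n0) // -mulrA [leRHS]mulrC ler_wpM2l ?powR_ge0 //.
    by clear -a2 s0 s1 n0 n8; rewrite ler_pdivrMr; rewrite /a in a2 *; lra.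
  have A2 : n `^ (- a) * ((sg - a)^-1 - (sg - a)^-1 * n `^ (- (sg - a))) <= 8 * n `^ (- sg - 1).
    have -> : (sg - a)^-1 - (sg - a)^-1 * n `^ (- (sg - a)) = (n `^ (- (sg - a)) - 1) / (a - sg).
      by field; rewrite gt_eqF ?lt_eqF.
    apply: (@le_trans _ _ (n `^ (- a) * (n `^ (- (sg - a)) / (a - sg)))).
      by rewrite ler_wpM2l ?powR_ge0 // ler_wpM2r ?invr_ge0 ?(ltW as0) // gerBl.
    rewrite mulrA -pwD //.
    have -> : - a + - (sg - a) = (- sg - 1) + 1 by ring.
    rewrite pwD // powRr1 ?(ltW n0) // -mulrA [leRHS]mulrC ler_wpM2l ?powR_ge0 //.
    by clear -a2 s0 s1 n0 n8; rewrite ler_pdivrMr; rewrite /a in a2 *; lra.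
  have -> : 12 * n `^ (- sg - 1) = 4 * n `^ (- sg - 1) + 8 * n `^ (- sg - 1) by ring.
  exact: lerD.
move=> x /andP[x0 x1].
have L : ln x + ln n = ln (x * n) by rewrite lnM ?posrE.
have E r : (x * n) `^ r = expR (r * ln (x * n)) by rewrite /powR gt_eqF // mulr_gt0.
have [h|h] := leP x n^-1.
  have h1 : x * n <= 1 by rewrite -ler_pdivlMr // div1r.
  rewrite /G !indicE mem_set; last by rewrite /D1 /= in_itv /= x0.
  apply: (@le_trans _ _ (n `^ a * (x `^ (sg - 1 + a)))); last first.
    by rewrite mul1r lerDl !mulr_ge0 ?powR_ge0 ?ler0n.
  rewrite L ler0_norm ?ln_le0 // mulrN opprK -E powRM ?(ltW x0) ?(ltW n0) //.
  by rewrite (pwD (sg - 1) a x0) mulrA mulrC.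
have h1 : 1 <= x * n by rewrite -ler_pdivrMr // div1r ltW.
rewrite /G !indicE (@mem_set _ D2); last by rewrite /D2 /= in_itv /= x1 ltW.
apply: (@le_trans _ _ (n `^ (- a) * (x `^ (sg - 1 - a)))); last first.
  by rewrite mul1r lerDr !mulr_ge0 ?powR_ge0 ?ler0n.
rewrite L ger0_norm ?ln_ge0 // -mulNr -E powRM ?(ltW x0) ?(ltW n0) //.
by rewrite (pwD (sg - 1) (- a) x0) mulrA mulrC.
Qed.

Lemma kerE (n x : R) : ker n^-1 (ln n) x = expR (- (((ln x + ln n) * n) ^+ 2 / 4)).
Proof. by rewrite /ker invrK. Qed.

(** Only [1 / (n + 1), 1 / n] is counted: there |n ln (n x)| <= 1, so that the kernel is at least
    exp(-1/4) >= 3/4, and x^(sg - 1) >= n^(1 - sg). The length is at least 1 / (2 n^2). *)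
Lemma ker_mass_low (n sg : R) : 8 <= n -> 0 < sg < 1 ->
  itg I1 (fun x => x `^ (sg - 1) * ker n^-1 (ln n) x) ->
  3 / 8 * n `^ (- sg - 1) <= \int[mu]_(x in I1) (x `^ (sg - 1) * ker n^-1 (ln n) x).
Proof.
move=> n8 /andP[s1 s2] gI; have n0 : 0 < n by lra.
have in0 : 0 < n^-1 by rewrite invr_gt0.
have ln0 : 0 < (n + 1)^-1 by rewrite invr_gt0; lra.
have lnn : (n + 1)^-1 < n^-1 by clear -n0; rewrite ltf_pV2 ?posrE; lra.
pose K : set (measurableTypeR R) := `[(n + 1)^-1, n^-1]%classic.
have mK : measurable K by exact: measurable_itv.
have KI : K `<=` I1.
  move=> x; rewrite /K /I01 /= !in_itv /= => /andP[h1 h2]; rewrite (lt_le_trans ln0 h1) /=.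
  by rewrite (le_trans h2) // invf_le1 //; lra.
pose c := 3 / 4 * n `^ (1 - sg).
have ci : itg K (fun=> c).
  by apply: itg_cc; apply: continuous_subspaceT => x; exact: cvg_cst.
have [ki KE] := indic_sub mK mI1 KI ci.
have CE : \int[mu]_(x in K) c = c * (n^-1 - (n + 1)^-1).
  transitivity (c * n^-1 - c * (n + 1)^-1); last by ring.
  apply: (@Rint_FTC _ _ (fun x => c * x)) => //.
  - by move=> x _; have := dvZ c (dvid x); rewrite mulr1.
  - by apply: continuous_subspaceT => x; exact: cvg_cst.
apply: (@le_trans _ _ (\int[mu]_(x in I1) (\1_K x * c))); last first.
  apply: le_Rintegral => //; first exact: mI1.
  move=> x /in_I01/andP[x0 x1]; rewrite indicE; case: (boolP (x \in K)) => xK; last by rewrite mul0r mulr_ge0 ?powR_ge0 ?ker_ge0.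
  have := set_mem xK; rewrite /K /= in_itv /= => /andP[h1 h2].
  rewrite mul1r /c mulrC; apply: ler_pM; rewrite ?powR_ge0 //.
    have -> : n `^ (1 - sg) = n^-1 `^ (sg - 1).
      by rewrite -powR_inv1 ?(ltW n0) // -powRrM mulN1r opprB.
    rewrite -(opprB 1 sg) !powRN lef_pV2 ?posrE ?powR_gt0 //.
    by apply: ge0_ler_powR; rewrite ?nnegrE ?(ltW x0) ?(ltW in0) //; lra.
  rewrite kerE; apply: (@le_trans _ _ (expR (- (1 / 4)))).
    by have := expR_ge1Dx (- (1 / 4) : R); lra.
  rewrite ler_expR lerN2 ler_pM2r ?invr_gt0 //.
  rewrite -lnM ?posrE //.
  have xn0 : 0 < x * n by rewrite mulr_gt0.
  have xn1 : x * n <= 1 by rewrite -ler_pdivlMr // div1r.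
  have l0 := ln_le0 xn1.
  have l1 : - n^-1 <= ln (x * n).
    have q0 : 0 < n / (n + 1) by rewrite divr_gt0 //; lra.
    apply: (@le_trans _ _ (ln (n / (n + 1)))); last first.
      by rewrite ler_ln ?posrE // mulrC ler_wpM2r // ltW.
    have := @le_ln1Dx R n^-1 => /(_ _) h.
    have -> : n / (n + 1) = (1 + n^-1)^-1 by field; apply/andP; split; rewrite gt_eqF //; lra.
    rewrite lnV ?posrE; last by lra.
    by rewrite lerN2; apply: h; lra.
  have l2 : -1 <= ln (x * n) * n.
    have : - n^-1 * n <= ln (x * n) * n by rewrite ler_wpM2r // ltW.
    by rewrite mulNr mulVf // gt_eqF.
  have l3 : ln (x * n) * n <= 0 by rewrite mulr_le0_ge0 // ltW.
  nra.
rewrite KE CE /c.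
have -> : 1 - sg = (- sg - 1) + 2 by ring.
rewrite (pwD (- sg - 1) 2 n0); have -> : n `^ 2 = n ^+ 2 by rewrite -powR_mulrn ?ltW.
have q : 1 / 2 <= n ^+ 2 * (n^-1 - (n + 1)^-1).
  have -> : n ^+ 2 * (n^-1 - (n + 1)^-1) = n / (n + 1) by field; apply/andP; split; rewrite gt_eqF //; lra.
  by rewrite ler_pdivlMr; lra.
have := powR_gt0 (- sg - 1) n0; set T := n `^ (- sg - 1) => T0.
have : T * (1 / 2) <= T * (n ^+ 2 * (n^-1 - (n + 1)^-1)) by rewrite ler_pM2l.
lra.
Qed.

(** The product on the right is |1/x - N|. M changes by at most the number of integers passed, and
    rounding 1/x down adds at most 1. *)
Lemma M1i_dist N x : (0 < N)%N -> 0 < x <= 1 ->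
  `|M1i x - (mertensn N)%:~R| <= N%:R * `|expR (- (ln x + ln N%:R)) - 1| + 1.
Proof.
move=> N0 /andP[x0 x1]; set n : R := N%:R; have n0 : 0 < n by rewrite ltr0n.
have nE : x^-1 = n * expR (- (ln x + ln n)).
  by rewrite -lnM ?posrE // expRN lnK ?posrE ?mulr_gt0 // invfM mulrCA mulfV ?mulr1 // gt_eqF.
have -> : n * `|expR (- (ln x + ln n)) - 1| = `|x^-1 - n|.
  by rewrite nE -{1}(gtr0_norm n0) -normrM mulrBr mulr1.
have := truncn_itv (ltW (ivt_gt0 x0)); rewrite ivtE // => /andP[t1 t2].
rewrite -natr1 in t2.
rewrite /M1i ivtE // -rmorphB -intr_norm.
set K := Num.truncn x^-1 in t1 t2 *.
have [h|h] := leqP N K.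
  have d : `|(mertensn K - mertensn N)%R|%:~R <= (K%:R - n : R).
    by rewrite /n -natrB // -[(K - N)%:R]/((Posz (K - N)%N)%:~R) ler_int mertensn_dist.
  apply: (le_trans d); rewrite (@le_trans _ _ (x^-1 - n)) //; first by rewrite lerB.
  by rewrite (le_trans (ler_norm _)) // lerDl.
have d : `|(mertensn K - mertensn N)%R|%:~R <= (n - K%:R : R).
  by rewrite distrC /n -natrB 1?ltnW // -[(N - K)%:R]/((Posz (N - K)%N)%:~R) ler_int mertensn_dist // ltnW.
apply: (le_trans d); rewrite (@le_trans _ _ (n - x^-1 + 1)) //; first by clear -t2; lra.
by rewrite lerD2r distrC ler_norm.
Qed.

(** A window of width 1/N centred at x = 1/N. Replacing M(1/x) by M(N) costs O(N^(-sg - 1)), the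
    order of the mass of the window, hence O(1) after division; the bound B N^(eta - 1) for the
    average becomes a multiple of N^(sg + eta). *)
Lemma mertens_pointwise (p be eta sg : R) : 1 < p -> p^-1 < be < 1 -> 0 < eta < 1 -> be < sg < 1 ->
  LpC_closure p%:E (Beurling_space R) (fun x : R => (lambda x)%:C) ->
  exists2 B : R, 0 < B & forall N, (8 <= N)%N ->
   `|(mertensn N)%:~R : R| <= B * N%:R `^ (sg + eta).
Proof.
move=> p1 hbe he hs Hc; have [B B0 HB] := kernel_bound p1 hbe he hs Hc; clear Hc.
have /andP[be1 be2] := hbe; have /andP[s1 s2] := hs; have /andP[e1 e2] := he.
have p0 : 0 < p^-1 by rewrite invr_gt0; lra.
have s01 : 0 < sg < 1 by apply/andP; split; lra.
have se0 : 0 <= sg + eta by lra.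
exists (8 / 3 * (B + 36 * expR 1)).
  by rewrite mulr_gt0 // addr_gt0 // mulr_gt0 ?expR_gt0.
move=> N N8; set n : R := N%:R.
have n8 : 8 <= n by rewrite /n ler_nat.
have n0 : 0 < n by lra.
have n1' : 1 <= n by lra.
have in0 : 0 < n^-1 by rewrite invr_gt0.
have [G [gi GI] HG] := tent_int n8 s01.
set M : R := (mertensn N)%:~R.
pose kr x := ker n^-1 (ln n) x.
have krE x : kr x = expR (- (((ln x + ln n) * n) ^+ 2 / 4)) by exact: kerE.
have kr0 x : 0 <= kr x by exact: expR_ge0.
pose g x := x `^ (sg - 1) * kr x.
have g0 x : 0 <= g x by rewrite mulr_ge0 ?powR_ge0.
have mg : measurable_fun I1 g.
  apply: measT01; apply: measurable_funM; [exact: measurable_powR|exact: meas_ker].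
have D x : 0 < x <= 1 -> `|M1i x - M| <= n * `|expR (- (ln x + ln n)) - 1| + 1.
  by move=> hx; apply: M1i_dist => //; exact: leq_trans N8.
have W x : I1 x -> `|(M1i x - M) * g x| <= 3 * expR 1 * G x.
  move=> /in_I01 hx; have /andP[x0 x1] := hx.
  rewrite normrM (ger0_norm (g0 x)) /g mulrCA.
  have := ker_dom (ln x + ln n) n8; rewrite -krE => K.
  apply: (@le_trans _ _ (x `^ (sg - 1) * (3 * expR 1 * expR (- (n / 4 * `|ln x + ln n|))))).
    rewrite ler_wpM2l ?powR_ge0 //; apply: le_trans K; rewrite ler_wpM2r //; exact: D.
  by rewrite mulrCA ler_wpM2l ?mulr_ge0 ?expR_ge0 // HG.
have W' x : I1 x -> `|g x| <= 3 * expR 1 * G x.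
  move=> /in_I01 hx; have /andP[x0 x1] := hx.
  rewrite (ger0_norm (g0 x)) /g.
  have := ker_dom (ln x + ln n) n8; rewrite -krE => K.
  apply: (@le_trans _ _ (x `^ (sg - 1) * (3 * expR 1 * expR (- (n / 4 * `|ln x + ln n|))))).
    rewrite ler_wpM2l ?powR_ge0 //; apply: le_trans K.
    by rewrite ler_peMl // lerDr mulr_ge0 // ltW.
  by rewrite mulrCA ler_wpM2l ?mulr_ge0 ?expR_ge0 // HG.
have Gi := itgZ (3 * expR 1) mI1 gi.
have gI : itg I1 g by apply: (itg_le _ mg Gi) => //; exact: mI1.
have dI : itg I1 (fun x => (M1i x - M) * g x).
  apply: (itg_le _ _ Gi) => //; first exact: mI1.
  apply: measurable_funM => //; apply: measurable_funB; last exact: measurable_cst.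
  by apply: measT01; exact: meas_M1i.
have E1 : \int[mu]_(x in I1) (M1i x * x `^ (sg - 1) * ker n^-1 (ln n) x) =
   M * \int[mu]_(x in I1) g x + \int[mu]_(x in I1) ((M1i x - M) * g x).
  rewrite -RintegralZl //; last exact: mI1.
  rewrite -RintegralD //; [|exact: mI1|by apply: itgZ gI; exact: mI1].
  by apply: eq_Rint => x _; rewrite /g /kr; ring.
have := HB (ln n) n^-1 in0; rewrite E1 => H1.
have H2 : `|\int[mu]_(x in I1) ((M1i x - M) * g x)| <= 36 * expR 1 * n `^ (- sg - 1).
  apply: (le_trans (Rint_norm_le mI1 dI Gi W)); rewrite RintegralZl //; last exact: mI1.
  have -> : 36 * expR 1 * n `^ (- sg - 1) = 3 * expR 1 * (12 * n `^ (- sg - 1)) by ring.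
  by rewrite ler_wpM2l ?mulr_ge0 ?expR_ge0.
have H3 : 3 / 8 * n `^ (- sg - 1) <= \int[mu]_(x in I1) g x by exact: ker_mass_low.
set T := n `^ (- sg - 1) in H2 H3.
have T0 : 0 < T by rewrite powR_gt0.
have H4 : `|M| * (3 / 8 * T) <= B * n^-1 `^ (1 - eta) + 36 * expR 1 * T.
  apply: (@le_trans _ _ (`|M| * \int[mu]_(x in I1) g x)); first by rewrite ler_wpM2l.
  have I0 : 0 <= \int[mu]_(x in I1) g x by apply: Rintegral_ge0 => x _.
  rewrite -{1}(ger0_norm I0) -normrM.
  set A := M * _ in H1 *; set A' := \int[mu]_(x in I1) ((M1i x - M) * g x) in H1 H2.
  have -> : A = (A + A') - A' by rewrite addrK.
  by rewrite (le_trans (ler_normB _ _)) // lerD.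
have E3 : n^-1 `^ (1 - eta) = T * n `^ (sg + eta).
  rewrite -powR_inv1 ?(ltW n0) // -powRrM /T -pwD //; congr (_ `^ _); ring.
rewrite E3 in H4.
have n1 : 1 <= n `^ (sg + eta) by exact: pw_ge1 se0 n1'.
have e0 := expR_gt0 (1 : R).
rewrite -(ler_pM2r T0).
have : 36 * expR 1 * T * 1 <= 36 * expR 1 * T * n `^ (sg + eta).
  by rewrite ler_wpM2l // mulr_ge0 ?(ltW T0) // mulr_ge0 // ltW.
set Q := n `^ (sg + eta) in n1 H4 *; move=> H5; clear -H4 H5; clearbody Q T M; lra.
Qed.

Lemma M1i_big x : 1 < x -> M1i x = 0.
Proof.
move=> x1; have x0 := lt_trans ltr01 x1.
rewrite /M1i ivtE // (@truncn_def _ _ 0) ?invr_ge0 ?(ltW x0) ?invf_lt1 //=.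
by rewrite /mertensn big_geq.
Qed.

Lemma nc_mertens1 x : 0 < x -> nc ((mertens1 x)%:~R : C) = `|M1i x|.
Proof.
by move=> x0; rewrite M1iE // -nc_real; congr normc; rewrite rmorph_int.
Qed.

Lemma theoremA_b (p r : R) : 1 < p ->
  LpC_closure p%:E (Beurling_space R) (fun x : R => (lambda x)%:C) -> 1 < r < p ->
  (LpC_norm r%:E (fun x : R => ((mertens1 x)%:~R)%R : C) < +oo)%E.
Proof.
move=> p1 Hc /andP[r1 rp].
have p0 : 0 < p by lra.
have r0 : 0 < r by lra.
have ipr : p^-1 < r^-1 by rewrite ltf_pV2 ?posrE.
have ir1 : r^-1 < 1 by rewrite invf_lt1.
have ip0 : 0 < p^-1 by rewrite invr_gt0.
(* An eighth of the gap leaves room for be, sg and eta: the final exponent p^-1 + 3d stays below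
   r^-1. *)
pose d := (r^-1 - p^-1) / 8.
have d0 : 0 < d by rewrite /d; lra.
have h1 : p^-1 < p^-1 + d < 1 by rewrite /d; apply/andP; split; lra.
have h2 : 0 < d < 1 by rewrite /d; apply/andP; split; lra.
have h3 : p^-1 + d < p^-1 + 2 * d < 1 by rewrite /d; apply/andP; split; lra.
have [B B0 HB] := mertens_pointwise p1 h1 h2 h3 Hc; clear Hc.
pose e := p^-1 + 2 * d + d.
have e0 : 0 < e by rewrite /e; lra.
have er : e * r < 1 by rewrite -ltr_pdivlMr // div1r /e /d; lra.
(* Adding 8 covers the arguments below 8, by |M(K)| <= K. *)
have HM x : 0 < x <= 1 -> `|M1i x| <= (B + 8) * x `^ (- e).
  move=> /andP[x0 x1]; have x1e : 1 <= x `^ (- e).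
    by rewrite powRN -invr1 lef_pV2 ?posrE ?powR_gt0 // pw_le1 // ltW.
  have := truncn_itv (ltW (ivt_gt0 x0)); rewrite ivtE // => /andP[t1 _].
  rewrite /M1i ivtE //; set K := Num.truncn _ in t1 *.
  have [K8|K8] := leqP 8 K.
    apply: (le_trans (HB K K8)); apply: ler_pM; rewrite ?powR_ge0 ?(ltW B0) //; first by lra.
    rewrite (_ : x `^ (- e) = x^-1 `^ e).
      by apply: ge0_ler_powR; rewrite ?nnegrE ?(ltW e0) ?ler0n ?invr_ge0 ?(ltW x0).
    by rewrite -powR_inv1 ?(ltW x0) // -powRrM mulN1r.
  apply: (le_trans (mertensn_leR R K)); apply: (@le_trans _ _ 8); first by rewrite ler_nat ltnW.
  by apply: (@le_trans _ _ (B + 8)); [lra|rewrite ler_peMr //; lra].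
have er1 : -1 < - (e * r) by rewrite ltrN2.
have gi : itg I1 (fun x => (B + 8) `^ r * x `^ (- (e * r))).
  by apply: itgZ; [exact: mI1|exact: itg_powR].
have I1h : I1 `<=` hl by move=> x /in_I01/andP[h _]; rewrite /half_line /= in_itv /= h.
have [ji _] := indic_sub mI1 (@mhl R) I1h gi.
apply/LpC_norm_fin => //; apply: (@le_lt_trans _ _ (\int[mu]_(x in hl) (\1_I1 x * ((B + 8) `^ r * x `^ (- (e * r))))%:E)%E).
  apply: ge0_le_integral.
  - exact: mhl.
  - by move=> x _; rewrite lee_fin powR_ge0.
  - apply/measurable_EFinP; apply: (@eq_measurable_fun _ _ _ _ _ (fun x => `|M1i x| `^ r)).
      by move=> x /set_mem/in_hl x0; rewrite nc_mertens1.
    by apply: meas_pow; apply: measurableT_comp => //; apply: measurable_funTS; exact: meas_M1i.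
  - exact: measurable_int ji.
  move=> x /in_hl x0; rewrite lee_fin nc_mertens1 // indicE.
  have [x1|x1] := leP x 1.
    rewrite mem_set; last by rewrite /I01 /= in_itv /= x0.
    rewrite mul1r -mulNr (powRrM x) -powRM ?powR_ge0 //; last by lra.
    by apply: ge0_ler_powR; rewrite ?nnegrE ?(ltW r0) ?mulr_ge0 ?powR_ge0 ?HM ?x0 //; lra.
  by rewrite M1i_big // normr0 powR0 ?gt_eqF // !mulr_ge0 ?powR_ge0 ?ler0n.
by rewrite (EFin_Rint (@mhl R) ji) ltry.
Qed.

End Pointwise.

(** * Approximating lambda from the integrability of M_1 *)

Section Riemann.
Variable R : realType.
Local Notation C := R[i].
Local Notation nc := (@normc R).
Local Notation mu := (@lebesgue_measure R).
Local Notation itg D f := (mu.-integrable D (EFin \o f)).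
Local Notation mT f := (measurable_fun (setT : set (measurableTypeR R)) f).
Local Notation I1 := (@I01 R).
Local Notation mI1 := (@mI01 R).
Local Notation hl := (half_line R : set (measurableTypeR R)).
Implicit Types (x y t u v : R) (a : R -> R) (k : nat).

Lemma truncn_mono (x y : R) : x <= y -> (Num.truncn x <= Num.truncn y)%N.
Proof. exact: le_truncn. Qed.

Lemma itg_bnd (D : set (measurableTypeR R)) (f : R -> R) (B : R) : measurable D -> D `<=` I1 ->
  measurable_fun D f -> (forall x, D x -> `|f x| <= B) -> itg D f.
Proof.
move=> mD DI mf H; apply: (itg_le mD mf _ H).
have ci : itg I1 (fun x : R => B * x `^ 0) by apply: itg_pw.
apply: (@integrableS _ _ _ mu I1) => //; first exact: mI1.
by apply: eq_itg ci; [exact: mI1|move=> x _; rewrite powRr0 mulr1].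
Qed.

(** [flr (x / t)] is [t/x], which counts the k >= 1 with k x <= t. *)
Lemma flr_div (x t : R) N : 0 < x -> 0 < t -> (Num.truncn (ivt (x / t)) <= N)%N ->
  flr (x / t) = \sum_(k < N) \1_(`[k.+1%:R * x, +oo[) t.
Proof.
move=> x0 t0 KN; rewrite -[flr _]/((Num.truncn (ivt (x / t)))%:R).
rewrite -{1}(minn_idPr KN) -SN_cst1 ?divr_gt0 //; apply: eq_bigr => k _.
rewrite dil_cst1 ?divr_gt0 // -le_inv_truncn ?divr_gt0 // indicE; congr (_%:R); congr nat_of_bool.
rewrite ler_pdivrMr // mulrC ler_pdivlMr ?ltr0n // mulrC.
by apply/idP/idP => [h|/set_mem]; [apply/mem_set|]; rewrite /= in_itv /= andbT.
Qed.

Lemma trunc_ratio (x t : R) : 0 < x -> 0 < t <= 1 -> (Num.truncn (ivt (x / t)) <= Num.truncn (ivt x))%N.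
Proof.
move=> x0 /andP[t0 t1]; apply: truncn_mono; rewrite !ivtE ?divr_gt0 // invf_div ler_piMl //.
by rewrite invr_ge0 ltW.
Qed.

(** Write [t/x] as the number of k with k x <= t. Substituting k t for t in the k-th term turns this
    condition into t >= x for every k; there the M(1/(k t)) add up to 1, and the integral of dt/t
    over [x, 1] remains. *)
Lemma phi_int x : 0 < x <= 1 -> itg I1 (fun t => M1i t * flr (x / t) * ivt t) /\
  \int[mu]_(t in I1) (M1i t * flr (x / t) * ivt t) = - ln x.
Proof.
move=> /andP[x0 x1]; set N := Num.truncn (ivt x).
pose f k (t : R) := M1i t * ivt t * \1_(`[k.+1%:R * x, +oo[) t.
have mf k : mT (f k).
  apply: measurable_funM; last by apply: measurable_indic; exact: measurable_itv.
  by apply: measurable_funM; [exact: meas_M1i|exact: meas_ivt].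
have fB k t : 0 < t <= 1 -> `|f k t| <= x^-1 * x^-1.
  move=> /andP[t0 t1]; rewrite /f indicE; case: (boolP (t \in _)) => h; last first.
    by rewrite mulr0 normr0 mulr_ge0 // invr_ge0 ltW.
  have xt : x <= t.
    have := set_mem h; rewrite /= in_itv /= andbT; apply: le_trans.
    by rewrite ler_peMl ?(ltW x0) // ler1n.
  have it : t^-1 <= x^-1 by rewrite lef_pV2 ?posrE.
  rewrite mulr1 normrM ivtE // normfV (gtr0_norm t0); apply: ler_pM; rewrite ?invr_ge0 ?(ltW t0) //.
  by rewrite (le_trans (M1i_le t0)).
have fi k : itg I1 (f k).
  by apply: (itg_bnd mI1 _ (measT01 (mf k))) => // t /in_I01; exact: fB.
have Ef t : I1 t -> \sum_(k < N) f k t = M1i t * flr (x / t) * ivt t.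
  move=> /in_I01 ht; have /andP[t0 t1] := ht.
  by rewrite (flr_div x0 t0 (trunc_ratio x0 ht)) mulrAC mulr_sumr.
split; first exact: (eq_itg mI1 Ef (itg_sum (index_enum 'I_N) mI1 (fun k : 'I_N => fi k))).
rewrite -(eq_Rint Ef).
rewrite Rint_sum //; last exact: mI1.
pose g k (t : R) := dil (@M1i R) (k.+1%:R^-1) t * (ivt t * \1_(`[x, +oo[) t).
have E k : itg I1 (g k) /\ \int[mu]_(t in I1) f k t = \int[mu]_(t in I1) g k t.
  have c0 : 0 < (k.+1%:R : R) by rewrite ltr0n.
  pose D : set (measurableTypeR R) := `]0, 1 / k.+1%:R]%classic.
  have mD : measurable D by exact: measurable_itv.
  have DI : D `<=` I1.
    by apply: subset_itvl; rewrite bnd_simp ler_pdivrMr // mul1r ler1n.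
  have Dc t : D t -> 0 < k.+1%:R * t <= 1.
    move=> /in_oc/andP[t0 t1]; rewrite mulr_gt0 //= mulrC -ler_pdivlMr //.
  have si : itg D (fun t => f k (k.+1%:R * t)).
    apply: (itg_bnd mD DI); last by move=> t /Dc; exact: fB.
    by apply: measurable_funTS; exact: meas_scale.
  have [_ ->] := @scale_eq R k.+1%:R 1 (f k) c0 (mf k) si.
  rewrite -RintegralZl //.
  have gi : itg D (fun t => k.+1%:R * f k (k.+1%:R * t)) by apply: itgZ.
  have [h1 h2] := indic_sub mD mI1 DI gi.
  have Eg t : I1 t -> \1_D t * (k.+1%:R * f k (k.+1%:R * t)) = g k t.
    move=> /in_I01/andP[t0 t1]; rewrite /g /dil indicE.
    have -> : (t \in D) = (t <= k.+1%:R^-1).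
      by apply/idP/idP => [/set_mem|h]; [|apply/mem_set]; rewrite /D /= in_itv /= div1r ?t0 // => /andP[].
    case: ifPn => h; last by rewrite !mul0r.
    rewrite mul1r /f invrK [t * _]mulrC !ivtE ?mulr_gt0 // invfM.
    have -> : \1_(`[k.+1%:R * x, +oo[) (k.+1%:R * t) = \1_(`[x, +oo[) t :> R.
      rewrite !indicE; congr (_%:R); congr nat_of_bool.
      by apply/idP/idP => /set_mem h'; apply/mem_set; move: h'; rewrite /= !in_itv /= !andbT ler_pM2l.
    by field; rewrite gt_eqF //= pnatr_eq0.
  split; first exact: eq_itg mI1 Eg h1.
  by rewrite -h2; apply: eq_Rint.
under eq_bigr do rewrite (E _).2.
rewrite -Rint_sum //; [|exact: mI1|by move=> k; exact: (E k).1].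
pose D : set (measurableTypeR R) := `[x, 1]%classic.
have mD : measurable D by exact: measurable_itv.
have DI : D `<=` I1 by apply: subset_itvr; rewrite bnd_simp.
have W : {within `[x, 1], continuous (fun t : R => t^-1)}.
  apply: (@within_cc _ 1) => // t /andP[t0 _].
  by apply: inv_continuous; rewrite gt_eqF.
have ii : itg D (fun t => t^-1) by exact: itg_cc.
have [_ h2] := indic_sub mD mI1 DI ii.
transitivity (\int[mu]_(t in D) t^-1).
  rewrite -h2; apply: eq_Rint => t /in_I01 ht; have /andP[t0 t1] := ht.
  rewrite /g -mulr_suml -/(SN (@M1i R) N t) !indicE.
  have -> : (t \in `[x, +oo[%classic) = (t \in D).
    by apply/idP/idP => /set_mem h'; apply/mem_set; move: h'; rewrite /D /= !in_itv /= t1 ?andbT.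
  case: (boolP (t \in D)) => h; last by rewrite mulr0 mulr0 mul0r.
  rewrite SN_M1i //; first by rewrite mul1r mulr1 mul1r ivtE.
  have := set_mem h; rewrite /D /= in_itv /= => /andP[xt _].
  by apply: truncn_mono; rewrite !ivtE // lef_pV2 ?posrE.
move: x1; rewrite le_eqVlt => /predU1P[xE|x1].
  by rewrite /D xE ln1 oppr0 set_itv1 Rintegral_set1.
rewrite -(sub0r (ln x)) -ln1.
by apply: Rint_FTC => // t /andP[xt _]; apply: is_derive1_ln; exact: lt_le_trans xt.
Qed.

Variable p : R.
Hypothesis p1 : 1 < p.
Hypothesis Mp : itg I1 (fun x => `|M1i x| `^ p).

Lemma itg_absM : itg I1 (fun x => `|M1i x|).
Proof.
have o : itg I1 (fun x : R => 1 * x `^ 0) by exact: itg_pw.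
apply: (itg_le mI1 _ (itgD mI1 o Mp)).
  by apply: measT01; apply: measurableT_comp => //; exact: meas_M1i.
move=> x _; rewrite normr_id powRr0 mulr1.
have [h|h] := leP `|M1i x| 1.
  by apply: (le_trans h); rewrite lerDl powR_ge0.
rewrite (@le_trans _ _ (`|M1i x| `^ p)) ?lerDr //.
rewrite -{1}(powRr1 (normr_ge0 (M1i x))) ler_powR // ltW //.
Qed.

Lemma itg_M : itg I1 (@M1i R).
Proof. by apply: (itg_le mI1 _ itg_absM) => //; apply: measT01; exact: meas_M1i. Qed.

(** Multiply [phi_int] by x and let x tend to 0: x [t/x] / t tends to 1 boundedly, and x ln x to
    0. *)
Lemma int_M0 : \int[mu]_(t in I1) M1i t = 0.
Proof.
pose xm (m : nat) : R := m.+1%:R^-1.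
have xm0 m : 0 < xm m by rewrite invr_gt0 ltr0n.
have xm1 m : 0 < xm m <= 1 by exact: inv_itv.
have E m : \int[mu]_(t in I1) (M1i t * (xm m / t * flr (xm m / t))) = - (xm m * ln (xm m)).
  have [i1 i2] := phi_int (xm1 m).
  rewrite -mulrN -i2 -RintegralZl //; last exact: mI1.
  by apply: eq_Rint => t /in_I01/andP[t0 _]; rewrite ivtE //; ring.
have C1 : (fun m => \int[mu]_(t in I1) (M1i t * (xm m / t * flr (xm m / t)))) @ \oo --> \int[mu]_(t in I1) M1i t.
  apply: (@Rint_dct _ _ _ _ (fun t => `|M1i t|)).
  - exact: mI1.
  - move=> m; have [i1 _] := phi_int (xm1 m).
    apply: (@eq_measurable_fun _ _ _ _ _ (fun t => xm m * (M1i t * flr (xm m / t) * ivt t))).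
      by move=> t /set_mem/in_I01/andP[t0 _]; rewrite ivtE //; ring.
    by apply: measurable_funM; [exact: measurable_cst|exact: itg_meas i1].
  - by apply: measT01; exact: meas_M1i.
  - exact: itg_absM.
  - move=> t m /in_I01/andP[t0 _]; have z0 : 0 < xm m / t by rewrite divr_gt0.
    have /andP[f0 f1] := flr_le z0.
    rewrite normrM ler_piMr // (ger0_norm (mulr_ge0 (ltW z0) f0)).
    by rewrite -ler_pdivlMl // mulr1.
  move=> t /in_I01/andP[t0 _]; rewrite -[X in _ --> X]mulr1; apply: cvgM; first exact: cvg_cst.
  have L : (fun m => t^-1 * xm m) @ \oo --> (0 : R) by apply: cvg0M; exact: cvg_invn.
  rewrite -[X in _ --> X](subr0 1); have L1 : (fun m => 1 - t^-1 * xm m) @ \oo --> (1 - 0 : R).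
    by apply: cvgB => //; exact: cvg_cst.
  apply: squeeze_cvgr L1 _; last by rewrite subr0; exact: cvg_cst.
  near=> m; have z0 : 0 < xm m / t by rewrite divr_gt0.
  have /andP[f0 f1] := flr_le z0; apply/andP; split; last first.
    by rewrite -ler_pdivlMl // mulr1.
  rewrite mulrC; set z := xm m / t in z0 f0 f1 *.
  have := truncn_itv (ltW (ivt_gt0 z0)); rewrite -natr1 -/(flr z) ivtE // => /andP[_ h].
  have : z * z^-1 <= z * (flr z + 1) by rewrite ler_wpM2l ?(ltW z0) // ltW.
  by rewrite mulfV ?gt_eqF //; lra.
have C2 : (fun m => - (xm m * ln (xm m))) @ \oo --> (0 : R).
  have h2 : 0 < (2^-1 : R) by rewrite invr_gt0.
  have L : (fun m => 2 * (1 / m.+1%:R : R) `^ 2^-1) @ \oo --> (0 : R).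
    by apply: cvg0M; exact: cvg_powR_seq.
  apply/norm_cvg0P; apply: squeeze_cvgr (cvg_cst _) L; near=> m.
  rewrite normr_ge0 normrN normrM (gtr0_norm (xm0 m)) div1r -/(xm m) /=.
  have := ln_le_pw h2 (xm1 m); rewrite invrK => h.
  apply: (@le_trans _ _ (xm m * (2 * xm m `^ (- 2^-1)))); first by rewrite ler_wpM2l // ltW.
  rewrite mulrCA ler_wpM2l // -{1}(powRr1 (ltW (xm0 m))) -pwD //.
  by rewrite (_ : 1 + - 2^-1 = 2^-1) //; field.
have C1' : (fun m => - (xm m * ln (xm m))) @ \oo --> \int[mu]_(t in I1) M1i t.
  by under eq_fun do rewrite -E.
exact: cvg_unique C1' C2.
Unshelve. all: by end_near. Qed.

Lemma Mp_small (tau : R) : 0 < tau -> exists2 d : R, 0 < d < 1 &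
  \int[mu]_(x in `]0, d]) `|M1i x| `^ p <= tau.
Proof.
move=> tau0; pose d (m : nat) : R := m.+2%:R^-1.
have d01 m : 0 < d m < 1 by rewrite invr_gt0 ltr0n /= invf_lt1 ?ltr0n // ltr1n.
have dm m : measurable (`]0, d m]%classic : set (measurableTypeR R)) by exact: measurable_itv.
have dI m : (`]0, d m]%classic : set (measurableTypeR R)) `<=` I1.
  by apply: subset_itvl; rewrite bnd_simp ltW //; have /andP[] := d01 m.
have CV : (fun m => \int[mu]_(x in I1) (\1_(`]0, d m]) x * `|M1i x| `^ p)) @ \oo --> \int[mu]_(x in I1) (0 : R).
  apply: (@Rint_dct _ _ _ _ (fun x => `|M1i x| `^ p)) => //.
  - exact: mI1.
  - move=> m; apply: measurable_funM; last exact: itg_meas Mp.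
    exact: measurable_indic.
  - by move=> x m _; rewrite normrM (ger0_norm (powR_ge0 _ _)) ler_piMl ?powR_ge0 // indicE; case: (_ \in _); rewrite ?normr1 ?normr0.
  move=> x /in_I01/andP[x0 _]; apply: cvg_near_cst; near=> m.
  rewrite indicE memNset ?mul0r //= in_itv /= x0 /= => h.
  have : x^-1 < m%:R by near: m; exact: nbhs_infty_gtr.
  have h' : m.+2%:R <= x^-1 by rewrite -[leLHS]invrK lef_pV2 ?posrE ?invr_gt0 ?ltr0n.
  by move=> /(le_lt_trans h'); rewrite ltr_nat ltnNge (leqW (leqnSn m)).
have R0 : \int[mu]_(x in I1) (0 : R) = 0 by rewrite /Rintegral integral0.
rewrite R0 in CV.
have /cvgrPdist_le/(_ _ tau0)[m _ Hm] := CV.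
exists (d m) => //; have := Hm m (leqnn _); rewrite /= sub0r normrN.
have [_ ->] := indic_sub (dm m) mI1 (dI m) (integrableS mI1 (dm m) (dI m) Mp).
by apply: le_trans; exact: ler_norm.
Unshelve. all: by end_near. Qed.

Lemma Rint_split (a b c : R) (f : R -> R) : a <= b -> b <= c -> itg `]a, c] f ->
  \int[mu]_(t in `]a, c]) f t = \int[mu]_(t in `]a, b]) f t + \int[mu]_(t in `]b, c]) f t.
Proof.
move=> ab bc fi.
have E : (`]a, c]%classic : set (measurableTypeR R)) = (`]a, b] `|` `]b, c])%classic.
  by apply: itv_bndbnd_setU; rewrite bnd_simp.
rewrite E in fi *; apply: Rintegral_setU => //.
apply/disj_setPS => t /= [].
by rewrite !in_itv /= => /andP[_ h1] /andP[h2 _]; move: h2; rewrite ltNge h1.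
Qed.

Lemma Rint_inv (a b : R) : 0 < a < b -> itg `[a, b] (fun t => t^-1) /\
  itg `]a, b] (fun t => t^-1) /\ \int[mu]_(t in `]a, b]) t^-1 = ln b - ln a.
Proof.
move=> /andP[a0 ab].
have W : {within `[a, b], continuous (fun t : R => t^-1)}.
  apply: (@within_cc _ b) => // t /andP[t0 _].
  by apply: inv_continuous; rewrite gt_eqF.
have i1 := itg_cc W.
have i2 : itg `]a, b] (fun t => t^-1).
  by apply: integrableS i1 => //; apply: subset_itvr; rewrite bnd_simp.
split => //; split => //; rewrite Rintegral_itv_obnd_cbnd //.
by apply: Rint_FTC => // t /andP[xt _]; apply: is_derive1_ln; exact: lt_le_trans xt.
Qed.

(** W majorises the variation of F, so that the errors of the cells telescope; each cell has mass
    [om] for dt/t. Unlike a modulus of continuity, W accommodates the jumps of M and rho. *)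
Lemma log_riemann_sum (F W : R -> R) (y om : R) : 0 < y -> 0 < om ->
  itg `]y, 1] (fun t => F t / t) ->
  (forall t u, y <= t -> t <= u -> u <= 1 -> `|F t - F u| <= W u - W t) ->
  forall m, y * expR (m%:R * om) <= 1 ->
  `|\int[mu]_(t in `]y, y * expR (m%:R * om)]) (F t / t) - om * \sum_(j < m) F (y * expR (j.+1%:R * om))|
   <= om * (W (y * expR (m%:R * om)) - W y).
Proof.
move=> y0 om0 Fi FW; elim=> [|m IH] H.
  by rewrite mul0r expR0 mulr1 big_ord0 mulr0 subr0 subrr mulr0 set_itvoc0 Rintegral_set0 normr0.
set a := y * expR (m%:R * om) in IH; set b := y * expR (m.+1%:R * om) in H *.
have ab : a < b by rewrite ltr_pM2l // ltr_expR ltr_pM2r // ltr_nat.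
have ya : y <= a by rewrite ler_peMr ?(ltW y0) // -[leLHS]expR0 ler_expR mulr_ge0 ?(ltW om0).
have a1 : a <= 1 by rewrite (le_trans (ltW ab)).
have a0 : 0 < a by exact: lt_le_trans ya.
have mab : measurable (`]a, b]%classic : set (measurableTypeR R)) by exact: measurable_itv.
have iyb : itg `]y, b] (fun t => F t / t).
  by apply: integrableS Fi => //; apply: subset_itvl; rewrite bnd_simp.
have iab : itg `]a, b] (fun t => F t / t).
  by apply: integrableS iyb => //; apply: subset_itvr; rewrite bnd_simp.
have lnab : ln b - ln a = om.
  by rewrite /a /b !lnM ?posrE ?expR_gt0 // !expRK -natr1; ring.
have hab : 0 < a < b by rewrite a0 ab.
have [_ [iv Iab]] := Rint_inv hab; rewrite lnab in Iab.
rewrite (Rint_split ya (ltW ab) iyb) big_ord_recr /= -/b mulrDr.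
set A := \int[mu]_(t in `]y, a]) _; set B := \int[mu]_(t in `]a, b]) _; set S := om * \sum_(_ < _) _.
have K : `|B - om * F b| <= om * (W b - W a).
  have fb : itg `]a, b] (fun t => F b * t^-1) by apply: itgZ.
  have wb : itg `]a, b] (fun t => (W b - W a) * t^-1) by apply: itgZ.
  have d := itgB mab iab fb.
  have E : \int[mu]_(t in `]a, b]) (F t / t - F b * t^-1) = B - om * F b.
    by rewrite RintegralB // RintegralZl // Iab mulrC.
  rewrite -E; apply: (le_trans (Rint_norm_le mab d wb _)); last by rewrite RintegralZl // Iab mulrC.
  move=> t; rewrite /= in_itv /= => /andP[h1 h2].
  have t0 : 0 < t by exact: lt_trans h1.
  rewrite -mulrBl normrM (gtr0_norm (_ : 0 < t^-1)) ?invr_gt0 // ler_wpM2r ?invr_ge0 ?(ltW t0) //.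
  apply: (le_trans (FW t b _ h2 H)); first by rewrite (le_trans ya) // ltW.
  rewrite lerB // -subr_ge0; apply: le_trans (FW a t ya (ltW h1) (le_trans h2 H)).
  exact: normr_ge0.
rewrite (_ : A + B - _ = (A - S) + (B - om * F b)); last by ring.
rewrite (le_trans (ler_normD _ _)) //.
have := IH a1; rewrite -/A -/S => IH'.
rewrite (_ : om * (W b - W y) = om * (W a - W y) + om * (W b - W a)); last by ring.
exact: lerD.
Qed.

End Riemann.

(** * The bound T_y on ]0, y] and its size as y tends to 0 *)

Section PartA.
Variable R : realType.
Local Notation C := R[i].
Local Notation nc := (@normc R).
Local Notation mu := (@lebesgue_measure R).
Local Notation itg D f := (mu.-integrable D (EFin \o f)).
Local Notation mT f := (measurable_fun (setT : set (measurableTypeR R)) f).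
Local Notation I1 := (@I01 R).
Local Notation mI1 := (@mI01 R).
Local Notation hl := (half_line R : set (measurableTypeR R)).
Implicit Types (x y t u v : R) (a : R -> R) (k : nat).

Lemma Rint_subset (A B : set (measurableTypeR R)) (f : R -> R) : measurable A -> measurable B ->
  A `<=` B -> (forall x, B x -> 0 <= f x) -> itg B f ->
  \int[mu]_(x in A) f x <= \int[mu]_(x in B) f x.
Proof.
move=> mA mB AB f0 fi; have fA : itg A f by exact: integrableS fi.
have [i1 <-] := indic_sub mA mB AB fA.
apply: le_Rintegral => // x Bx; rewrite indicE; case: (_ \in _); rewrite ?mul1r ?mul0r //.
exact: f0.
Qed.

Lemma oc_sub (y z : R) : 0 <= y -> z <= 1 -> (`]y, z]%classic : set (measurableTypeR R)) `<=` I1.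
Proof.
move=> y0 z1 x; rewrite /I01 /= !in_itv /= => /andP[h1 h2].
by rewrite (le_lt_trans y0 h1) (le_trans h2).
Qed.

Lemma Rint_pw_y (r y : R) : 0 < y < 1 -> 1 < r -> itg `]y, 1] (fun t => t `^ (- r)) /\
  \int[mu]_(t in `]y, 1]) t `^ (- r) <= y `^ (1 - r) / (r - 1).
Proof.
move=> /andP[y0 y1] r1.
have W2 : {within `[y, 1], continuous (fun x : R => x `^ (- r))}.
  by apply: (@within_cc _ 1) => // x /andP[x0 _]; exact: powR_cont.
have i1 := itg_cc W2.
have i2 : itg `]y, 1] (fun t => t `^ (- r)).
  by apply: integrableS i1 => //; apply: subset_itvr; rewrite bnd_simp.
split => //; rewrite Rintegral_itv_obnd_cbnd //.
have -> : \int[mu]_(t in `[y, 1]) t `^ (- r) = (1 - r)^-1 * 1 `^ (1 - r) - (1 - r)^-1 * y `^ (1 - r).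
  apply: (@Rint_FTC _ _ (fun x => (1 - r)^-1 * x `^ (1 - r))) => // x /andP[nx _].
  have x0 : 0 < x by exact: lt_le_trans nx.
  have d := dvZ (1 - r)^-1 (is_derive1_powR (1 - r) x0).
  have -> // : x `^ (- r) = (1 - r)^-1 * ((1 - r) * x `^ (1 - r - 1)).
  rewrite mulKf; last by rewrite lt_eqF // subr_lt0.
  by congr (_ `^ _); ring.
rewrite powR1 mulr1 -(opprB r 1) invrN mulNr opprK [_ / _]mulrC addrC gerDl.
by rewrite oppr_le0 invr_ge0 subr_ge0 ltW.
Qed.

Definition Ay y : R := \int[mu]_(t in `]y, 1]) M1i t.
(** The first term bounds the integral of M_1(t) rho(t/x) dt/t over ]y, 1], the second the
    correction (A_y / y) rho(y/x), by [Ay_le]. *)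
Definition Ty y : R := \int[mu]_(t in `]y, 1]) (`|M1i t| / t) + (\int[mu]_(t in `]0, y]) `|M1i t|) / y.

Lemma itg_absM_t y : 0 < y < 1 -> itg `]y, 1] (fun t => `|M1i t| / t).
Proof.
move=> /andP[y0 y1].
have m : measurable (`]y, 1]%classic : set (measurableTypeR R)) by exact: measurable_itv.
have yI := oc_sub (ltW y0) (lexx 1).
apply: (itg_bnd (B := y^-1 * y^-1) m yI).
  apply: (@eq_measurable_fun _ _ _ _ _ (fun t => `|M1i t| * ivt t)).
    by move=> t /set_mem/yI/in_I01/andP[t0 _]; rewrite ivtE.
  apply: measurable_funTS; apply: measurable_funM; last exact: meas_ivt.
  by apply: measurableT_comp => //; exact: meas_M1i.
move=> t; rewrite /= in_itv /= => /andP[h _]; have t0 := lt_trans y0 h.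
have it : t^-1 <= y^-1 by rewrite lef_pV2 ?posrE // ltW.
rewrite normrM normr_id normfV (gtr0_norm t0) ler_pM ?invr_ge0 ?(ltW t0) //.
exact: le_trans (M1i_le t0) it.
Qed.

(** As M_1 has integral 0 over ]0, 1], A_y is minus its integral over ]0, y]. *)
Lemma Ay_le p y : 1 < p -> itg I1 (fun x => `|M1i x| `^ p) -> 0 < y < 1 -> `|Ay y| / y <= (\int[mu]_(t in `]0, y]) `|M1i t|) / y.
Proof.
move=> p1 Mp /andP[y0 y1]; rewrite ler_wpM2r ?invr_ge0 ?(ltW y0) //.
have := int_M0 p1 Mp; rewrite (Rint_split (ltW y0) (ltW y1) (itg_M p1 Mp)) -/(Ay y) => /eqP.
rewrite addrC addr_eq0 => /eqP ->; rewrite normrN.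
have yI := oc_sub (lexx 0) (ltW y1).
have m : measurable (`]0, y]%classic : set (measurableTypeR R)) by exact: measurable_itv.
apply: Rint_norm_le => //.
- exact: (integrableS mI1 m yI (itg_M p1 Mp)).
- exact: (integrableS mI1 m yI (itg_absM p1 Mp)).
Qed.

(** In [young], the L_p mass of M_1 on ]0, d] makes one term small, and the dual powers integrate to
    multiples of [tau]. Beyond d, |M_1| <= 1/d leaves y^(1/p) |ln y| / d, which tends to 0. *)
Lemma T_small (p ep : R) : 1 < p -> itg I1 (fun x => `|M1i x| `^ p) -> 0 < ep -> exists2 y0 : R, 0 < y0 < 1 &
  forall y, 0 < y <= y0 -> y `^ p^-1 * Ty y <= ep.
Proof.
move=> p1 Mp ep0; have p0 : 0 < p := lt_trans ltr01 p1.
have p10 : 0 < p - 1 by rewrite subr_gt0.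
(* Then [tau * (p - 1) + tau] = ep / 4, the total of the dual terms on ]y, 1] and ]0, y]. *)
pose tau := ep / (4 * p).
have tau0 : 0 < tau by rewrite divr_gt0 // mulr_gt0.
pose K := tau `^ (1 - p).
have K0 : 0 < K by rewrite powR_gt0.
have eta0 : 0 < ep / (8 * K) by rewrite divr_gt0 // mulr_gt0.
have [d /andP[d0 d1] Hd] := Mp_small Mp eta0.
have z0 : 0 < (ep * d / (8 * p)) `^ (2 * p) by rewrite powR_gt0 // divr_gt0 ?mulr_gt0.
(* The second bound makes y^(1/p) |ln y| / d at most ep / 4, through |ln y| <= 2p y^(-1/(2p)). *)
pose y0 := Num.min d ((ep * d / (8 * p)) `^ (2 * p)).
exists y0; first by rewrite /y0 lt_min d0 z0 gt_min d1.
move=> y /andP[yg0 yy0].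
have yd : y <= d by apply: (le_trans yy0); rewrite /y0 ge_min lexx.
have yz : y <= (ep * d / (8 * p)) `^ (2 * p) by apply: (le_trans yy0); rewrite /y0 ge_min lexx orbT.
have y1 : y < 1 by exact: le_lt_trans d1.
have y01 : 0 < y < 1 by rewrite yg0.
pose q := p / (p - 1).
have q1 : 1 < q by rewrite /q ltr_pdivlMr //; lra.
have m0 : measurable (`]0, y]%classic : set (measurableTypeR R)) by exact: measurable_itv.
have m1 : measurable (`]y, 1]%classic : set (measurableTypeR R)) by exact: measurable_itv.
have md : measurable (`]0, d]%classic : set (measurableTypeR R)) by exact: measurable_itv.
have yI0 := oc_sub (lexx 0) (ltW y1).
have yI1 := oc_sub (ltW yg0) (lexx 1).
have dI := oc_sub (lexx 0) (ltW d1).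
have Md : itg `]0, d] (fun x => `|M1i x| `^ p) by exact: (integrableS mI1 _ _ Mp).
have My : itg `]0, y] (fun x => `|M1i x| `^ p) by exact: (integrableS mI1 _ _ Mp).
have aM := itg_absM p1 Mp.
have Hy : \int[mu]_(x in `]0, y]) `|M1i x| `^ p <= ep / (8 * K).
  apply: le_trans Hd; apply: Rint_subset => //.
  by apply: subset_itvl; rewrite bnd_simp.
have P2 : y `^ p^-1 * ((\int[mu]_(t in `]0, y]) `|M1i t|) / y) <= tau + K * (ep / (8 * K)).
  pose v := y `^ (p^-1 - 1).
  have v0 : 0 < v by rewrite powR_gt0.
  have -> : y `^ p^-1 * ((\int[mu]_(t in `]0, y]) `|M1i t|) / y) = v * \int[mu]_(t in `]0, y]) `|M1i t|.
    by rewrite /v pwD // pwN1 //; ring.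
  have ci : itg `]0, y] (fun x : R => tau * y^-1 * x `^ 0).
    by apply: itgZ => //; apply: itg_powR => //; lra.
  have ki := itgZ K m0 My.
  have ai : itg `]0, y] (fun x => `|M1i x|) by exact: (integrableS mI1 _ _ aM).
  rewrite -RintegralZl //.
  apply: (@le_trans _ _ (\int[mu]_(x in `]0, y]) (tau * y^-1 * x `^ 0 + K * `|M1i x| `^ p))).
    apply: le_Rintegral => //; [exact: itgZ|exact: itgD|].
    move=> x _; rewrite powRr0 mulr1 mulrC.
    have := young p1 tau0 (normr_ge0 (M1i x)) v0.
    rewrite /v -powRrM -/K; have -> : (p^-1 - 1) * (p / (p - 1)) = -1 by field; apply/andP; split; rewrite gt_eqF.
    by rewrite pwN1.
  rewrite RintegralD // !RintegralZl //; last by apply: itg_powR => //; lra.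
  rewrite Rint_powR //.
  rewrite add0r powRr1 ?(ltW yg0) // divr1 divfK ?gt_eqF // lerD2l.
  by rewrite ler_wpM2l // ltW.
have P1 : y `^ p^-1 * \int[mu]_(t in `]y, 1]) (`|M1i t| / t) <=
    d^-1 * y `^ p^-1 * - ln y + (tau * (p - 1) + K * (ep / (8 * K))).
  have mi : itg `]y, 1] (fun t => \1_(`]0, d]) t * `|M1i t| `^ p).
    have [i1 _] := indic_sub md mI1 dI Md.
    exact: (integrableS mI1 m1 yI1 i1).
  have [ri rb] := Rint_pw_y y01 q1.
  have [_ [vi vE]] := Rint_inv y01.
  have a1 := itgZ (d^-1 * y `^ p^-1) m1 vi.
  have a2 := itgZ (tau * y `^ (q - 1)) m1 ri.
  have a3 := itgZ K m1 mi.
  have a23 := itgD m1 a2 a3.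
  have a123 := itgD m1 a1 a23.
  have ai := itg_absM_t y01.
  rewrite -RintegralZl //.
  apply: (@le_trans _ _ (\int[mu]_(t in `]y, 1]) (d^-1 * y `^ p^-1 * t^-1 + (tau * y `^ (q - 1) * t `^ (- q) + K * (\1_(`]0, d]) t * `|M1i t| `^ p))))).
    apply: le_Rintegral => //; first exact: itgZ.
    move=> t; rewrite /= in_itv /= => /andP[yt t1]; have t0 := lt_trans yg0 yt.
    have b1 : 0 <= d^-1 * y `^ p^-1 / t by rewrite !mulr_ge0 ?powR_ge0 ?invr_ge0 ?(ltW d0) ?(ltW t0).
    have b2 : 0 <= tau * y `^ (q - 1) * t `^ (- q) by rewrite mulr_ge0 ?powR_ge0 // mulr_ge0 ?powR_ge0 // ltW.
    have b3 : 0 <= K * (\1_(`]0, d]) t * `|M1i t| `^ p) by rewrite !mulr_ge0 ?powR_ge0 ?(ltW K0) ?ler0n.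
    have [td|td] := leP t d.
      apply: (@le_trans _ _ (tau * y `^ (q - 1) * t `^ (- q) + K * (\1_(`]0, d]) t * `|M1i t| `^ p))); last by rewrite lerDr.
      rewrite indicE mem_set /= ?in_itv /= ?t0 // mul1r.
      have v0 : 0 < y `^ p^-1 / t by rewrite divr_gt0 // powR_gt0.
      have := young p1 tau0 (normr_ge0 (M1i t)) v0; rewrite mulrCA -/q -/K.
      rewrite (_ : (y `^ p^-1 / t) `^ q = y `^ (q - 1) * t `^ (- q)); first by move=> h; apply: (le_trans h); rewrite mulrA.
      rewrite powRM ?powR_ge0 ?invr_ge0 ?(ltW t0) // -powRrM -(powR_inv1 (ltW t0)) -powRrM mulN1r.
      by congr (_ `^ _ * _); rewrite /q; field; apply/andP; split; rewrite gt_eqF.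
    apply: (@le_trans _ _ (d^-1 * y `^ p^-1 / t)); last by rewrite lerDl addr_ge0.
    rewrite mulrA ler_wpM2r ?invr_ge0 ?(ltW t0) // mulrC ler_wpM2r ?powR_ge0 //.
    by apply: (le_trans (M1i_le t0)); rewrite lef_pV2 ?posrE // ltW.
  rewrite RintegralD // RintegralD // !RintegralZl // vE ln1 sub0r lerD2l; apply: lerD.
    apply: (@le_trans _ _ (tau * y `^ (q - 1) * (y `^ (1 - q) / (q - 1)))).
      by rewrite ler_wpM2l // mulr_ge0 ?powR_ge0 // ltW.
    rewrite -mulrA ler_pM2l // mulrA -pwD // addrA subrK subrr powRr0 div1r.
    rewrite (_ : q - 1 = (p - 1)^-1) ?invrK //; rewrite /q; field; rewrite gt_eqF //.
  rewrite ler_pM2l //; apply: le_trans Hd.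
  have [i1 E1] := indic_sub md mI1 dI Md.
  rewrite -E1; apply: Rint_subset => //; first exact: mI1.
have P3 : d^-1 * y `^ p^-1 * - ln y <= ep / 4.
  have r0 : 0 < (2 * p)^-1 by rewrite invr_gt0 mulr_gt0.
  have y1' : 0 < y <= 1 by rewrite yg0 ltW.
  have := ln_le_pw r0 y1'; rewrite ler0_norm ?ln_le0 ?(ltW y1) // invrK => h.
  apply: (@le_trans _ _ (d^-1 * y `^ p^-1 * (2 * p * y `^ (- (2 * p)^-1)))).
    by rewrite ler_wpM2l // mulr_ge0 ?powR_ge0 // invr_ge0 ltW.
  have -> : d^-1 * y `^ p^-1 * (2 * p * y `^ (- (2 * p)^-1)) = d^-1 * (2 * p) * y `^ (2 * p)^-1.
    have -> : y `^ p^-1 = y `^ (2 * p)^-1 * y `^ (2 * p)^-1.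
      by rewrite -pwD //; congr (_ `^ _); field; rewrite gt_eqF.
    rewrite powRN; field; rewrite !gt_eqF ?powR_gt0 //.
  have : y `^ (2 * p)^-1 <= ep * d / (8 * p).
    have s0 : 0 <= ep * d / (8 * p) by rewrite divr_ge0 ?mulr_ge0 ?ltW.
    have pE : ((ep * d / (8 * p)) `^ (2 * p)) `^ (2 * p)^-1 = ep * d / (8 * p).
      by rewrite -powRrM mulfV ?powRr1 // gt_eqF // mulr_gt0.
    rewrite -pE; apply: ge0_ler_powR; rewrite ?nnegrE ?(ltW r0) ?(ltW yg0) ?powR_ge0 //.
  have c0 : 0 <= d^-1 * (2 * p) by rewrite mulr_ge0 ?invr_ge0 ?mulr_ge0 ?ltW.
  move=> /(ler_wpM2l c0) h2; apply: (le_trans h2).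
  by rewrite le_eqVlt; apply/orP; left; apply/eqP; field; rewrite !gt_eqF.
have KE : K * (ep / (8 * K)) = ep / 8 by field; rewrite gt_eqF.
have tE : tau * (p - 1) + tau = ep / 4 by rewrite /tau; field; rewrite gt_eqF.
rewrite /Ty mulrDr; rewrite KE in P1 P2; apply: (le_trans (lerD P1 P2)).
by clear -P3 tE ep0; clearbody tau; lra.
Qed.

End PartA.

(** * The approximant on a geometric grid *)

Section Approximant.
Variable R : realType.
Local Notation C := R[i].
Local Notation nc := (@normc R).
Local Notation mu := (@lebesgue_measure R).
Local Notation itg D f := (mu.-integrable D (EFin \o f)).
Local Notation mT f := (measurable_fun (setT : set (measurableTypeR R)) f).
Local Notation I1 := (@I01 R).
Local Notation mI1 := (@mI01 R).
Local Notation hl := (half_line R : set (measurableTypeR R)).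
Implicit Types (x y t u v : R) (a : R -> R) (j k J : nat).

Lemma flr_mono t u : 0 < t -> t <= u -> flr u <= flr t.
Proof.
move=> t0 tu; have u0 := lt_le_trans t0 tu.
by rewrite /flr ler_nat truncn_mono // !ivtE // lef_pV2 ?posrE.
Qed.

Lemma M1_mod t u : 0 < t -> t <= u -> `|M1i t - M1i u| <= flr t - flr u.
Proof.
move=> t0 tu; have := flr_mono t0 tu; rewrite /flr ler_nat => h.
rewrite /M1i -rmorphB -intr_norm -natrB // -[X in _ <= X]/((Posz (_ - _)%N)%:~R) ler_int.
exact: mertensn_dist.
Qed.

Lemma rhoi_E (x t : R) : 0 < x -> 0 < t -> rhoi (x / t) = t / x - flr (x / t).
Proof. by move=> x0 t0; rewrite /rhoi -/(flr (x / t)) ivtE ?divr_gt0 // invf_div. Qed.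

Lemma rho_mod (x t u : R) : 0 < x -> 0 < t -> t <= u ->
  `|rhoi (x / t) - rhoi (x / u)| <= (u - t) / x + (flr (x / u) - flr (x / t)).
Proof.
move=> x0 t0 tu; have u0 := lt_le_trans t0 tu; rewrite !rhoi_E //.
have h : flr (x / t) <= flr (x / u).
  by apply: flr_mono; rewrite ?divr_gt0 // ler_wpM2l ?(ltW x0) // lef_pV2 ?posrE.
rewrite (_ : _ - _ - _ = (flr (x / u) - flr (x / t)) - (u - t) / x); last by ring.
rewrite (le_trans (ler_normB _ _)) // addrC lerD // ger0_norm ?subr_ge0 //.
by rewrite divr_ge0 ?subr_ge0 // ltW.
Qed.

Lemma rhoi_le1 (z : R) : 0 < z -> `|rhoi z| <= 1.
Proof. by move=> z0; have /andP[h1 h2] := rhoi_itv z0; rewrite ger0_norm. Qed.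

Lemma flr1 : flr (1 : R) = 1.
Proof. by rewrite /flr ivtE // invr1 truncn1. Qed.

Variables (y : R) (J : nat).
Hypothesis y01 : 0 < y < 1.
Hypothesis J0 : (0 < J)%N.

Definition om : R := - ln y / J%:R.
(* The geometric grid from grid 0 = y to grid J = 1, with ratio e^om: dt/t gives
   mass om to each cell. *)
Definition grid j : R := y * expR (j%:R * om).
(** A Riemann sum for [Ay y]. With it in place of [Ay y], the coefficients of [fB] satisfy sum c
    theta = 0 exactly, so that [fB] vanishes on ]1, +oo[. *)
Definition Ah : R := om * \sum_(j < J) M1i (grid j.+1) * grid j.+1.
Definition fB x : R := om * \sum_(j < J) M1i (grid j.+1) * rhoi (x / grid j.+1) - Ah / y * rhoi (x / y).

Lemma y_gt0 : 0 < y. Proof. by case/andP: y01. Qed.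

Lemma om_gt0 : 0 < om.
Proof. by rewrite divr_gt0 ?ltr0n // oppr_gt0 ln_lt0. Qed.

Lemma tgJ : grid J = 1.
Proof.
have E : J%:R * om = - ln y by rewrite /om mulrC divfK // pnatr_eq0 -lt0n.
by rewrite /grid E expRN lnK ?posrE ?y_gt0 // mulfV // gt_eqF // y_gt0.
Qed.

Lemma tg_itv j : (j <= J)%N -> y <= grid j <= 1.
Proof.
move=> jJ; have y0 := y_gt0; have o0 := om_gt0; apply/andP; split.
  by rewrite ler_peMr ?(ltW y0) // -[leLHS]expR0 ler_expR mulr_ge0 ?(ltW o0).
by rewrite -tgJ /grid ler_pM2l // ler_expR ler_pM2r // ler_nat.
Qed.

Lemma tg_gt0 j : 0 < grid j. Proof. by rewrite mulr_gt0 ?expR_gt0 ?y_gt0. Qed.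

Lemma M1y t : y <= t -> `|M1i t| <= y^-1.
Proof.
move=> yt; have y0 := y_gt0; have t0 := lt_le_trans y0 yt.
by apply: (le_trans (M1i_le t0)); rewrite lef_pV2 ?posrE.
Qed.

Lemma itg_y1 (F : R -> R) (B : R) : measurable_fun I1 F -> (forall t, y <= t -> t <= 1 -> `|F t| <= B) ->
  itg `]y, 1] (fun t => F t / t).
Proof.
move=> mF FB; have y0 := y_gt0.
have m : measurable (`]y, 1]%classic : set (measurableTypeR R)) by exact: measurable_itv.
have yI := oc_sub (ltW y0) (lexx 1).
apply: (itg_bnd (B := B * y^-1) m yI).
  apply: (@eq_measurable_fun _ _ _ _ _ (fun t => F t * ivt t)).
    by move=> t /set_mem/yI/in_I01/andP[t0 _]; rewrite ivtE.
  apply: measurable_funM; first exact: (measurable_funS mI1 yI mF).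
  exact: (measurable_funTS (@meas_ivt R)).
move=> t; rewrite /= in_itv /= => /andP[h t1]; have t0 := lt_trans y0 h.
rewrite normrM normfV (gtr0_norm t0) ler_pM ?invr_ge0 ?(ltW t0) ?FB ?(ltW h) //.
by rewrite lef_pV2 ?posrE // ltW.
Qed.

Lemma meas_rho_x x : 0 < x -> measurable_fun I1 (fun t => rhoi (x / t)).
Proof.
move=> x0; apply: (@eq_measurable_fun _ _ _ _ _ (fun t => rhoi (x * ivt t))).
  by move=> t /set_mem/in_I01/andP[t0 _]; rewrite ivtE.
apply: measT01; apply: (measurableT_comp (@meas_rhoi R)).
by apply: measurable_funM; [exact: measurable_cst|exact: meas_ivt].
Qed.

Lemma mM1 : measurable_fun I1 (@M1i R). Proof. by apply: measT01; exact: meas_M1i. Qed.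

Lemma itg1 x : 0 < x -> itg `]y, 1] (fun t => (M1i t * rhoi (x / t)) / t).
Proof.
move=> x0; have y0 := y_gt0; apply: (@itg_y1 _ (y^-1 * 1)).
  by apply: measurable_funM; [exact: mM1|exact: meas_rho_x].
move=> t yt t1; have t0 := lt_le_trans y0 yt.
by rewrite normrM ler_pM // ?M1y // rhoi_le1 // divr_gt0.
Qed.

Lemma grid_riemann (F W : R -> R) : itg `]y, 1] (fun t => F t / t) ->
  (forall t u, y <= t -> t <= u -> u <= 1 -> `|F t - F u| <= W u - W t) ->
  `|\int[mu]_(t in `]y, 1]) (F t / t) - om * \sum_(j < J) F (grid j.+1)| <= om * (W 1 - W y).
Proof.
move=> Fi FW; have := @log_riemann_sum _ F W y om y_gt0 om_gt0 Fi FW J.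
by rewrite -/(grid J) tgJ lexx => /(_ isT).
Qed.

(** As t grows, t/x and [t/x] increase and [1/t] decreases; with |M_1| <= 1/y and 0 <= rho <= 1 the
    combination (t/x + [t/x]) / y - [1/t] majorises the variation of the product. *)
Lemma riemann_M1_rho x : 0 < x <= 1 ->
  `|\int[mu]_(t in `]y, 1]) ((M1i t * rhoi (x / t)) / t) -
    om * \sum_(j < J) (M1i (grid j.+1) * rhoi (x / grid j.+1))| <= om * (3 / (x * y)).
Proof.
move=> /andP[x0 x1]; have y0 := y_gt0.
apply: (le_trans (@grid_riemann (fun t => M1i t * rhoi (x / t))
  (fun t => y^-1 * (t / x + flr (x / t)) - flr t) (itg1 x0) _)).
  move=> t u yt tu u1; have t0 := lt_le_trans y0 yt; have u0 := lt_le_trans t0 tu.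
  rewrite (_ : _ - _ = M1i t * (rhoi (x / t) - rhoi (x / u)) + (M1i t - M1i u) * rhoi (x / u)); last by ring.
  rewrite (le_trans (ler_normD _ _)) // !normrM.
  rewrite [leRHS](_ : _ = y^-1 * ((u - t) / x + (flr (x / u) - flr (x / t))) + (flr t - flr u)); last by ring.
  apply: lerD; first by apply: ler_pM; rewrite ?M1y ?rho_mod.
  apply: le_trans (M1_mod t0 tu); rewrite ler_piMr // rhoi_le1 // divr_gt0 //.
rewrite ler_wpM2l ?(ltW om_gt0) // divr1 flr1.
have /andP[a1 a2] := flr_le x0.
have xy : 0 < x / y by rewrite divr_gt0.
have /andP[a3 _] := flr_le xy.
have /andP[a4 a5] := flr_le y0.
have iy : 0 < y^-1 by rewrite invr_gt0.
have ix : 1 <= x^-1 by rewrite invf_ge1.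
have -> : 3 / (x * y) = y^-1 * (x^-1 + x^-1) + y^-1 * x^-1 by field; rewrite !gt_eqF.
have b1 : y^-1 * (1 / x + flr x) <= y^-1 * (x^-1 + x^-1) by rewrite ler_wpM2l ?(ltW iy) // div1r lerD.
have b2 : y^-1 <= y^-1 * x^-1 by rewrite ler_peMr // ltW.
have b3 : 0 <= y^-1 * (y / x + flr (x / y)).
  by rewrite mulr_ge0 ?(ltW iy) // addr_ge0 // divr_ge0 ?(ltW x0) ?(ltW y0).
lra.
Qed.

Lemma riemann_absM1 : om * \sum_(j < J) `|M1i (grid j.+1)| <= \int[mu]_(t in `]y, 1]) (`|M1i t| / t) + om / y.
Proof.
have y0 := y_gt0; have := @grid_riemann (fun t => `|M1i t|) (fun t => - flr t) (itg_absM_t y01).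
have /andP[a4 a5] := flr_le y0 => H.
have : om * (- flr 1 - - flr y) <= om / y.
  by rewrite ler_wpM2l ?(ltW om_gt0) // flr1; lra.
move=> h2; have : `|\int[mu]_(t in `]y, 1]) (`|M1i t| / t) - (om * \sum_(j < J) `|M1i (grid j.+1)|)| <= om / y.
  apply: le_trans h2; apply: H => t u yt tu u1; have t0 := lt_le_trans y0 yt.
  rewrite (_ : - flr u - - flr t = flr t - flr u); last by ring.
  by apply: le_trans (M1_mod t0 tu); exact: ler_dist_dist.
by rewrite distrC => /(le_trans (ler_norm _)); lra.
Qed.

Lemma Ay_t : Ay y = \int[mu]_(t in `]y, 1]) ((M1i t * t) / t).
Proof.
apply: eq_Rint => t; rewrite /= in_itv /= => /andP[yt _].
by rewrite mulfK // gt_eqF // (lt_trans y_gt0).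
Qed.

Lemma riemann_Ay : `|Ay y - Ah| <= om * (2 / y).
Proof.
have y0 := y_gt0; rewrite Ay_t /Ah.
have i : itg `]y, 1] (fun t => (M1i t * t) / t).
  apply: (@itg_y1 _ (y^-1 * 1)); first by apply: measurable_funM; [exact: mM1|exact: measurable_id].
  by move=> t yt t1; rewrite normrM ler_pM // ?M1y // ger0_norm // (le_trans (ltW y0)).
apply: (le_trans (@grid_riemann (fun t => M1i t * t) (fun t => t / y - flr t) i _)).
  move=> t u yt tu u1; have t0 := lt_le_trans y0 yt; have u0 := lt_le_trans t0 tu.
  rewrite (_ : _ - _ = M1i t * (t - u) + (M1i t - M1i u) * u); last by ring.
  rewrite (le_trans (ler_normD _ _)) // !normrM.
  rewrite [leRHS](_ : _ = y^-1 * (u - t) + (flr t - flr u)); last by ring.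
  apply: lerD.
    by apply: ler_pM; rewrite ?M1y // distrC ger0_norm ?subr_ge0.
  by apply: le_trans (M1_mod t0 tu); rewrite ler_piMr // ger0_norm // ltW.
rewrite ler_wpM2l ?(ltW om_gt0) // div1r flr1 mulfV ?gt_eqF //.
by have /andP[a4 a5] := flr_le y0; lra.
Qed.

(** rho(t/x) = t/x - [t/x], and [t/x] = 0 for t <= y < x, so that [phi_int] also gives the integral
    over ]y, 1]. *)
Lemma M1_rho_int x : y < x -> x <= 1 ->
  \int[mu]_(t in `]y, 1]) ((M1i t * rhoi (x / t)) / t) = Ay y / x + ln x.
Proof.
move=> yx x1; have y0 := y_gt0; have x0 := lt_trans y0 yx.
have hx : 0 < x <= 1 by rewrite x0.
have [pi1 pE] := phi_int hx.
have m : measurable (`]y, 1]%classic : set (measurableTypeR R)) by exact: measurable_itv.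
have yI := oc_sub (ltW y0) (lexx 1).
have pi2 := integrableS mI1 m yI pi1.
have [_ E2] := indic_sub m mI1 yI pi2.
have E3 : \int[mu]_(t in `]y, 1]) (M1i t * flr (x / t) * ivt t) = - ln x.
  rewrite -pE -E2; apply: eq_Rint => t /in_I01/andP[t0 t1]; rewrite indicE.
  case: (boolP (t \in _)) => h; first by rewrite mul1r.
  have ty : t <= y.
    by rewrite leNgt; apply/negP => yt; move/negP: h; apply; apply/mem_set; rewrite /= in_itv /= yt t1.
  have z0 : 0 < x / t by rewrite divr_gt0.
  have : flr (x / t) = 0; last by move=> ->; rewrite mulr0 mul0r mul0r.
  rewrite /flr ivtE // invf_div (@truncn_def _ _ 0) //.
  by rewrite divr_ge0 ?(ltW t0) ?(ltW x0) //= ltr_pdivrMr // mul1r (le_lt_trans ty).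
have mi : itg `]y, 1] (@M1i R).
  apply: (itg_bnd (B := y^-1) m yI); first by apply: measurable_funTS; exact: meas_M1i.
  by move=> t; rewrite /= in_itv /= => /andP[h _]; apply: M1y; exact: ltW.
rewrite /Ay mulrC -(opprK (ln x)) -E3 -RintegralZl // -RintegralB //; last by apply: itgZ.
apply: eq_Rint => t /= ; rewrite in_itv /= => /andP[yt _]; have t0 := lt_trans y0 yt.
by rewrite rhoi_E // ivtE //; field; rewrite !gt_eqF.
Qed.

Lemma fB_mid x : y < x -> x <= 1 -> `|ln x - fB x| <= om * (5 / (y * y)).
Proof.
move=> yx x1; have y0 := y_gt0; have x0 := lt_trans y0 yx; have o0 := om_gt0.
have hx : 0 < x <= 1 by rewrite x0.
have := riemann_M1_rho hx; rewrite (M1_rho_int yx x1) /fB; set S := om * _ => H1.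
have E : rhoi (x / y) = y / x by rewrite rhoi_big ?invf_div // ltr_pdivlMr // mul1r.
rewrite E; have -> : ln x - (S - Ah / y * (y / x)) = (Ay y / x + ln x - S) - (Ay y - Ah) / x.
  by field; rewrite !gt_eqF.
rewrite (le_trans (ler_normB _ _)) //.
have ixy : x^-1 <= y^-1 by rewrite lef_pV2 ?posrE // ltW.
have H2 : `|(Ay y - Ah) / x| <= om * (2 / y) * y^-1.
  by rewrite normrM normfV (gtr0_norm x0) ler_pM ?invr_ge0 ?(ltW x0) // riemann_Ay.
have H3 : om * (3 / (x * y)) <= om * (3 / (y * y)).
  by rewrite ler_pM2l // ler_pM2l // lef_pV2 ?posrE ?mulr_gt0 // ler_pM2r // ltW.
have -> : om * (5 / (y * y)) = om * (3 / (y * y)) + om * (2 / y) * y^-1 by field; rewrite gt_eqF.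
by apply: lerD => //; exact: le_trans H1 H3.
Qed.

Lemma fB_low x : 0 < x -> `|Ay y| / y <= (\int[mu]_(t in `]0, y]) `|M1i t|) / y ->
  `|fB x| <= Ty y + om * (3 / (y * y)).
Proof.
move=> x0 HA; have y0 := y_gt0; have o0 := om_gt0; have /andP[_ y1] := y01; rewrite /fB (le_trans (ler_normB _ _)) //.
have A1 : `|om * \sum_(j < J) M1i (grid j.+1) * rhoi (x / grid j.+1)| <= \int[mu]_(t in `]y, 1]) (`|M1i t| / t) + om / y.
  apply: le_trans riemann_absM1; rewrite normrM (gtr0_norm o0) ler_pM2l // (le_trans (ler_norm_sum _ _ _)) //.
  by apply: ler_sum => j _; rewrite normrM ler_piMr // rhoi_le1 // divr_gt0 // tg_gt0.
have A2 : `|Ah / y * rhoi (x / y)| <= (\int[mu]_(t in `]0, y]) `|M1i t|) / y + om * (2 / y) / y.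
  rewrite normrM (@le_trans _ _ (`|Ah / y|)) ?ler_piMr ?rhoi_le1 ?divr_gt0 //.
  rewrite normrM normfV (gtr0_norm y0).
  have : `|Ah| <= `|Ay y| + om * (2 / y).
    by have := riemann_Ay; have := ler_distD 0 Ah (Ay y); rewrite !subr0 sub0r normrN distrC; have := lerB_dist Ah (Ay y); rewrite distrC; lra.
  move=> h; have : `|Ah| / y <= (`|Ay y| + om * (2 / y)) / y by rewrite ler_wpM2r ?invr_ge0 ?(ltW y0).
  by rewrite mulrDl; lra.
have A3 : om / y <= om * (1 / (y * y)).
  rewrite ler_pM2l // div1r lef_pV2 ?posrE ?mulr_gt0 //.
  by rewrite ger_pMl // ltW.
have E : om * (3 / (y * y)) = om * (1 / (y * y)) + om * (2 / y) / y by field; rewrite gt_eqF.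
rewrite E /Ty; lra.
Qed.

Lemma fB_big x : 1 < x -> fB x = 0.
Proof.
move=> x1; have y0 := y_gt0; have x0 := lt_trans ltr01 x1; have /andP[_ y1] := y01.
have K t : 0 < t -> t <= 1 -> rhoi (x / t) = t / x.
  move=> t0 t1; rewrite rhoi_big ?invf_div // ltr_pdivlMr // mul1r; exact: le_lt_trans x1.
rewrite /fB (K y y0 (ltW y1)) /Ah.
have -> : \sum_(j < J) M1i (grid j.+1) * rhoi (x / grid j.+1) = (\sum_(j < J) M1i (grid j.+1) * grid j.+1) / x.
  rewrite mulr_suml; apply: eq_bigr => j _; have /andP[_ h] := tg_itv (ltn_ord j).
  by rewrite K ?tg_gt0 // mulrA.
by field; rewrite !gt_eqF.
Qed.

Lemma fB_Beurling : Beurling_space R (fun x => (fB x)%:C).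
Proof.
have y0 := y_gt0; have /andP[_ y1] := y01.
pose c (k : nat) : R := if (k < J)%N then om * M1i (grid k.+1) else - (Ah / y).
pose th (k : nat) : R := if (k < J)%N then grid k.+1 else y.
exists J.+1, (fun k : 'I_J.+1 => (c k)%:C), (fun k : 'I_J.+1 => th k); split.
  move=> k; rewrite /th; case: ifP => kJ; last by rewrite y0 ltW.
  by have /andP[_ h] := tg_itv kJ; rewrite tg_gt0.
move=> x x0; rewrite big_ord_recr /= /c /th ltnn frac_rhoi //.
rewrite (_ : \sum_(i < J) _ = (om * \sum_(j < J) M1i (grid j.+1) * rhoi (x / grid j.+1))%:C).
  by rewrite -rmorphM -rmorphD mulNr.
rewrite mulr_sumr rmorph_sum; apply: eq_bigr => j _.
by rewrite /= ltn_ord frac_rhoi ?tg_gt0 // -rmorphM mulrA.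
Qed.

Lemma meas_fB : mT fB.
Proof.
have K t : mT (fun x => rhoi (x / t)).
  by under eq_fun do rewrite mulrC; apply: meas_scale; exact: meas_rhoi.
apply: measurable_funB; apply: measurable_funM => //; try exact: measurable_cst.
by apply: measurable_sum => j; apply: measurable_funM => //; exact: measurable_cst.
Qed.

End Approximant.

(** * Norm estimates for the approximant, and the conclusion *)

Section PartAFinal.
Variable R : realType.
Local Notation C := R[i].
Local Notation nc := (@normc R).
Local Notation mu := (@lebesgue_measure R).
Local Notation itg D f := (mu.-integrable D (EFin \o f)).
Local Notation mT f := (measurable_fun (setT : set (measurableTypeR R)) f).
Local Notation I1 := (@I01 R).
Local Notation mI1 := (@mI01 R).
Local Notation hl := (half_line R : set (measurableTypeR R)).
Implicit Types (x y t u v : R).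

Lemma I1_hl : I1 `<=` hl.
Proof. by move=> x /in_I01/andP[h _]; rewrite /half_line /= in_itv /= h. Qed.

(** [ln_le_pw] with exponent 1 / (2p), which leaves a power of x integrable at 0. *)
Lemma ln_pow p x : 0 < p -> 0 < x <= 1 -> `|ln x| `^ p <= (2 * p) `^ p * x `^ (- 2^-1).
Proof.
move=> p0 hx; have /andP[x0 x1] := hx.
have r0 : 0 < (2 * p)^-1 by rewrite invr_gt0 mulr_gt0.
have := ln_le_pw r0 hx; rewrite invrK => h.
apply: (@le_trans _ _ ((2 * p * x `^ (- (2 * p)^-1)) `^ p)).
  by apply: ge0_ler_powR; rewrite ?nnegrE ?(ltW p0) // mulr_ge0 ?powR_ge0 ?mulr_ge0 ?ltW.
rewrite powRM ?powR_ge0 ?mulr_ge0 ?(ltW p0) // -powRrM.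
by rewrite (_ : - (2 * p)^-1 * p = - 2^-1) //; field; rewrite gt_eqF.
Qed.

Lemma hl_int_le (p : R) (h : R -> C) (G : R -> R) : 0 < p -> cmeas hl h -> itg I1 G ->
  (forall x, 1 < x -> h x = 0) -> (forall x, 0 < x <= 1 -> nc (h x) `^ p <= G x) ->
  (\int[mu]_(x in hl) (nc (h x) `^ p)%:E <= (\int[mu]_(x in I1) G x)%R%:E)%E.
Proof.
move=> p0 mh Gi h1 hG.
have [i1 <-] := indic_sub mI1 (@mhl R) I1_hl Gi.
rewrite -(EFin_Rint (@mhl R) i1); apply: ge0_le_integral.
- exact: mhl.
- by move=> x _; rewrite lee_fin powR_ge0.
- by apply/measurable_EFinP; apply: meas_pow; exact: cmeas_nc.
- exact: measurable_int i1.
move=> x /in_hl x0; rewrite lee_fin indicE.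
have [x1|x1] := leP x 1.
  rewrite mem_set; last by rewrite /I01 /= in_itv /= x0.
  by rewrite mul1r hG // x0.
by rewrite h1 // normc0 powR0 ?gt_eqF // memNset ?mul0r //; move=> /in_I01/andP[_]; rewrite leNgt x1.
Qed.

Lemma lambda_LpC (p : R) : 0 < p -> LpC p%:E (fun x : R => (lambda x)%:C).
Proof.
move=> p0; have ml : measurable_fun hl (@lambda R) by apply: measurable_funTS; exact: meas_lambda.
have gi : itg I1 (fun x => (2 * p) `^ p * x `^ (- 2^-1)).
  by apply: itgZ; [exact: mI1|apply: itg_powR => //; lra].
split; [exact: ml|exact: measurable_cst|].
apply/LpC_norm_fin => //; apply: le_lt_trans (ltry _).
apply: (hl_int_le p0 _ gi); first exact: cmeas_real.
- by move=> x x1; rewrite lambda_big.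
- by move=> x hx; rewrite nc_real lambda_I01 // ln_pow.
Qed.

Lemma pow_add (p u v : R) : 0 < p -> 0 <= u -> 0 <= v -> (u + v) `^ p <= 2 `^ p * (u `^ p + v `^ p).
Proof.
move=> p0 u0 v0; have K (a b : R) : 0 <= a -> a <= b -> (a + b) `^ p <= 2 `^ p * b `^ p.
  move=> a0 ab; have b0 := le_trans a0 ab; rewrite -powRM //.
  by apply: ge0_ler_powR; rewrite ?nnegrE ?(ltW p0) ?addr_ge0 ?mulr_ge0 //; lra.
have [h|h] := leP u v.
  by apply: (le_trans (K _ _ u0 h)); rewrite ler_wpM2l ?powR_ge0 // lerDr powR_ge0.
rewrite addrC; apply: (le_trans (K _ _ v0 (ltW h))).
by rewrite ler_wpM2l ?powR_ge0 // lerDl powR_ge0.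
Qed.

Lemma theoremA_a (p : R) : 1 < p ->
  (LpC_norm p%:E (fun x : R => ((mertens1 x)%:~R)%R : C) < +oo)%E ->
  LpC_closure p%:E (Beurling_space R) (fun x : R => (lambda x)%:C).
Proof.
move=> p1 HM; have p0 : 0 < p by lra.
have Mp : itg I1 (fun x => `|M1i x| `^ p).
  have mM : measurable_fun I1 (fun x => `|M1i x| `^ p).
    by apply: meas_pow; apply: measurableT_comp => //; apply: measT01; exact: meas_M1i.
  apply/integrableP; split; first exact/measurable_EFinP.
  move/(LpC_norm_fin _ p0): HM; apply: le_lt_trans.
  apply: (@le_trans _ _ (\int[mu]_(x in I1) (`|M1i x| `^ p)%R%:E)%E).
    by rewrite le_eqVlt; apply/orP; left; apply/eqP; apply: eq_integral => x _; rewrite /= ger0_norm ?powR_ge0.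
  apply: (@le_trans _ _ (\int[mu]_(x in hl) (`|M1i x| `^ p)%R%:E)%E); last first.
    rewrite le_eqVlt; apply/orP; left; apply/eqP.
    by apply: eq_integral => x /set_mem/in_hl x0; rewrite nc_mertens1.
  have mhM : measurable_fun hl (EFin \o (fun x => `|M1i x| `^ p)).
    apply/measurable_EFinP; apply: meas_pow; apply: measurableT_comp => //.
    by apply: measurable_funTS; exact: meas_M1i.
  by apply: ge0_subset_integral => //; [exact: mI1|exact: mhl|exact: I1_hl].
clear HM; split; first exact: lambda_LpC.
move=> e e0; pose E := e `^ p.
have E0 : 0 < E by rewrite powR_gt0.
(* Chosen so that (4 ep)^p = E / 8. *)
pose ep := (E / (8 * 4 `^ p)) `^ p^-1.
have ip0 : 0 < p^-1 by rewrite invr_gt0.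
have EK0 : 0 < E / (8 * 4 `^ p) by rewrite divr_gt0 // mulr_gt0 // powR_gt0.
have ep0 : 0 < ep by rewrite powR_gt0.
have epE : ep `^ p = E / (8 * 4 `^ p) by rewrite /ep -powRrM mulVf ?gt_eqF // powRr1 // ltW.
have [y0 /andP[y00 y01] HT] := T_small p1 Mp ep0.
pose c2 := 2 `^ p * (2 * p) `^ p.
have c20 : 0 < c2 by rewrite mulr_gt0 ?powR_gt0 // mulr_gt0.
(* The second bound absorbs the 1 in [Ty y + 1], which is room for the discretisation error; the
   third makes the contribution of |log x|^p on ]0, y] at most E / 8. *)
pose y := Num.min y0 (Num.min (ep `^ p) ((E / (16 * c2)) ^+ 2)).
have yg0 : 0 < y by rewrite !lt_min y00 powR_gt0 // exprn_gt0 // divr_gt0 // mulr_gt0.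
have yy0 : y <= y0 by rewrite /y ge_min lexx.
have yep : y <= ep `^ p by rewrite /y ge_min [X in _ || X]ge_min lexx orbT.
have yE : y <= (E / (16 * c2)) ^+ 2 by rewrite /y ge_min [X in _ || X]ge_min lexx !orbT.
have y1 : y < 1 by exact: le_lt_trans y01.
have yI : 0 < y < 1 by rewrite yg0.
have HTy : y `^ p^-1 * Ty y <= ep by apply: HT; rewrite yg0.
have Ty0 : 0 <= Ty y.
  rewrite addr_ge0 //; first (apply: Rintegral_ge0 => t; rewrite /= in_itv /= => /andP[h _]).
    by rewrite divr_ge0 // ltW // (lt_trans yg0).
  by rewrite divr_ge0 ?(ltW yg0) //; apply: Rintegral_ge0.
have T1 : 0 <= Ty y + 1 := addr_ge0 Ty0 ler01.
pose ka := Num.min 1 ((E / 4) `^ p^-1).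
have ka0 : 0 < ka by rewrite lt_min ltr01 powR_gt0 // divr_gt0.
have ka1 : ka <= 1 by rewrite /ka ge_min lexx.
have kaE : ka `^ p <= E / 4.
  have h4 : ((E / 4) `^ p^-1) `^ p = E / 4 by rewrite -powRrM mulVf ?gt_eqF // powRr1 // divr_ge0 // ltW.
  rewrite -h4; apply: ge0_ler_powR; rewrite ?nnegrE ?(ltW p0) ?(ltW ka0) ?powR_ge0 //.
  by rewrite /ka ge_min lexx orbT.
have ln0 : 0 < - ln y by rewrite oppr_gt0 ln_lt0.
(* J is taken at least [bd], which brings the discretisation error on ]y, 1] below [ka] and the one
   on ]0, y] below 1. *)
pose bd := - ln y * (5 / (y * y)) / ka.
pose J := (Num.truncn bd).+1.
have J0 : (0 < J)%N by [].
have yy : 0 < y * y by rewrite mulr_gt0.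
have bd0 : 0 <= bd by exact: divr_ge0 (mulr_ge0 (ltW ln0) (divr_ge0 (ler0n _ 5) (ltW yy))) (ltW ka0).
have Jb : bd <= J%:R by have /andP[_ h] := truncn_itv bd0; exact: ltW.
have o5 : om y J * (5 / (y * y)) <= ka.
  by rewrite /om mulrAC ler_pdivrMr ?ltr0n // [ka * _]mulrC -ler_pdivrMr.
have o3 : om y J * (3 / (y * y)) <= 1.
  apply: le_trans ka1; apply: le_trans o5; rewrite ler_wpM2l ?(ltW (om_gt0 yI J0)) //.
  by rewrite ler_pM2r ?invr_gt0 // ler_nat.
pose f x := fB y J x.
exists (fun x => (f x)%:C); first exact: fB_Beurling.
apply: lt_LpC_norm => //.
pose D : set (measurableTypeR R) := `]0, y]%classic.
have mD : measurable D by exact: measurable_itv.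
have DI : D `<=` I1 by exact: oc_sub (lexx 0) (ltW y1).
pose g x := c2 * x `^ (- 2^-1) + 2 `^ p * (Ty y + 1) `^ p * x `^ 0.
have h2 : -1 < - 2^-1 :> R by lra.
have g1 : itg D (fun x => c2 * x `^ (- 2^-1)) by apply: itgZ => //; exact: itg_powR.
have g2 : itg D (fun x => 2 `^ p * (Ty y + 1) `^ p * x `^ 0) by apply: itgZ => //; exact: itg_powR.
have gi : itg D g by exact: itgD.
have [ji jE] := indic_sub mD mI1 DI gi.
have ki : itg I1 (fun x : R => ka `^ p * x `^ 0) by apply: itg_pw.
have Gi := itgD mI1 ji ki.
apply: (@le_lt_trans _ _ (\int[mu]_(x in I1) (\1_D x * g x + ka `^ p * x `^ 0))%R%:E).
  apply: (hl_int_le p0 _ Gi).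
  - split; first under eq_fun do rewrite cReD cReN.
      by apply: measurable_funTS; apply: measurable_funB; [exact: meas_lambda|exact: meas_fB].
    by under eq_fun do rewrite cImD cImN /= subr0; exact: measurable_cst.
  - by move=> x x1; rewrite lambda_big // /f fB_big // subr0.
  move=> x hx; have /andP[x0 x1] := hx.
  rewrite -rmorphB nc_real lambda_I01 // powRr0 mulr1 indicE.
  have [xy|xy] := leP x y.
    rewrite mem_set; last by rewrite /D /= in_itv /= x0.
    rewrite mul1r (@le_trans _ _ (g x)) ?lerDl ?powR_ge0 //.
    have B1 : `|f x| <= Ty y + 1.
      by apply: (le_trans (fB_low yI J0 x0 (Ay_le p1 Mp yI))); rewrite lerD2l.
    apply: (@le_trans _ _ ((`|ln x| + (Ty y + 1)) `^ p)).
      apply: ge0_ler_powR; rewrite ?nnegrE ?(ltW p0) ?(addr_ge0 (normr_ge0 _) T1) //.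
      by rewrite (le_trans (ler_normB _ _)) // lerD2l.
    apply: (le_trans (pow_add p0 (normr_ge0 _) T1)).
    rewrite /g powRr0 mulr1 mulrDr lerD2r /c2 -mulrA ler_wpM2l ?powR_ge0 //.
    exact: ln_pow.
  rewrite memNset; last by move=> /in_oc/andP[_]; rewrite leNgt xy.
  rewrite mul0r add0r; apply: ge0_ler_powR; rewrite ?nnegrE ?(ltW p0) ?(ltW ka0) //.
  by apply: le_trans o5; exact: fB_mid.
rewrite lte_fin RintegralD //; last exact: mI1.
have h0 : -1 < (0 : R) by [].
have K1 : \int[mu]_(x in D) (c2 * x `^ (- 2^-1)) = c2 * (y `^ (- 2^-1 + 1) / (- 2^-1 + 1)).
  rewrite RintegralZl //; first by rewrite Rint_powR.
  exact: itg_powR.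
have K2 : \int[mu]_(x in D) (2 `^ p * (Ty y + 1) `^ p * x `^ 0) = 2 `^ p * (Ty y + 1) `^ p * y.
  rewrite RintegralZl //; first by rewrite Rint_powR // add0r powRr1 ?(ltW yg0) // divr1.
  exact: itg_powR.
have K3 : \int[mu]_(x in I1) (ka `^ p * x `^ 0) = ka `^ p.
  rewrite RintegralZl //; [|exact: mI1|exact: itg_powR].
  by rewrite Rint_powR // add0r powRr1 // divr1 mulr1.
rewrite jE /g RintegralD // K1 K2 K3.
have S1 : c2 * (y `^ (- 2^-1 + 1) / (- 2^-1 + 1)) <= E / 8.
  have -> : - 2^-1 + 1 = 2^-1 :> R by field.
  rewrite invrK; have : y `^ 2^-1 <= E / (16 * c2).
    have s0 : 0 <= E / (16 * c2) := divr_ge0 (ltW E0) (mulr_ge0 (ler0n _ 16) (ltW c20)).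
    by rewrite powR12_sqrt ?(ltW yg0) // -(ger0_norm s0) -sqrtr_sqr ler_sqrt // sqr_ge0.
  move=> h; apply: (@le_trans _ _ (c2 * (E / (16 * c2) * 2))).
    by rewrite ler_wpM2l ?(ltW c20) // ler_wpM2r.
  by rewrite le_eqVlt; apply/orP; left; apply/eqP; field; rewrite gt_eqF.
have S2 : 2 `^ p * (Ty y + 1) `^ p * y <= E / 8.
  have yp : (y `^ p^-1) `^ p = y by rewrite -powRrM mulVf ?gt_eqF // powRr1 // ltW.
  have yp1 : y `^ p^-1 <= ep.
    have -> : ep = (ep `^ p) `^ p^-1 by rewrite -powRrM mulfV ?gt_eqF // powRr1 // ltW.
    by apply: ge0_ler_powR; rewrite ?nnegrE ?powR_ge0 ?(ltW ip0) ?(ltW yg0).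
  have -> : 2 `^ p * (Ty y + 1) `^ p * y = (2 * (y `^ p^-1 * (Ty y + 1))) `^ p.
    by rewrite !powRM ?mulr_ge0 ?powR_ge0 // yp; ring.
  apply: (@le_trans _ _ ((4 * ep) `^ p)).
    apply: ge0_ler_powR; rewrite ?nnegrE ?mulr_ge0 ?powR_ge0 ?(ltW p0) ?(ltW ep0) //.
    rewrite mulrDr mulr1 (_ : 4 * ep = 2 * (ep + ep)); last by ring.
    by rewrite ler_pM2l // lerD.
  rewrite powRM ?(ltW ep0) // epE le_eqVlt; apply/orP; left; apply/eqP.
  by field; rewrite gt_eqF // powR_gt0.
rewrite -/E; apply: le_lt_trans (lerD (lerD S1 S2) kaE) _.
by clear -E0; clearbody E; lra.
Qed.

End PartAFinal.

Theorem theoremA (R : realType) (p : R) (hp : 1 < p) :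
  ((LpC_norm p%:E (fun x : R => (mertens1 x)%:~R%R) < +oo)%E ->
    LpC_closure p%:E (Beurling_space R) (fun x : R => (lambda x)%:C)) /\
  (LpC_closure p%:E (Beurling_space R) (fun x : R => (lambda x)%:C) ->
    forall r : R, 1 < r < p ->
      (LpC_norm r%:E (fun x : R => (mertens1 x)%:~R%R) < +oo)%E).
Proof.
split; first exact: theoremA_a.
by move=> Hc r hr; exact: theoremA_b Hc hr.
Qed.
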